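(* Let $0<q<1$, $\mu\in\mathbb{C}$, $\alpha=q^\mu\in\mathbb{C}^*$, $\kappa=-\frac{2\pi}{\ln q}>0$, and for $k\in\mathbb{Z}$ let $\mu_k=\mu+k\kappa i$. Let $$F(\mu;q,x)=\sum_{n\ge 0}\frac{(q^\mu;q)_n}{n!}(-x)^n,\qquad G(a;q,x)=\sum_{n\ge 0}\frac{(a)_n\,q^{n(n+1)/2}}{(q;q)_n}(-x)^n .$$ Then the following properties hold. (1) The functions $F(\mu;q,x)$ and $x^{-\mu_k}G(\mu_k;q,\frac1x)$, $k\in\mathbb{Z}$, all satisfy the functional-differential equation $y'(x)=\alpha\,y(qx)-y(x)$. (2) Moreover, if $\mu\in\mathbb{C}\setminus(\mathbb{Z}_{\le 0}\oplus\kappa\mathbb{Z}i)$, then for all $x\in\mathbb{C}$ with $\Re(x)>0$, $$F(\mu;q,x)=\frac{\kappa\,(q^\mu;q)_\infty}{2\pi\,(q;q)_\infty}\sum_{k\in\mathbb{Z}}\Gamma(\mu_k)\,x^{-\mu_k}\,G\Bigl(\mu_k;q,\frac1x\Bigr),$$ where $\Gamma$ is the Euler Gamma function.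
   Context: Notation: $(a)_0=(a;q)_0=1$, $(a)_n=\prod_{j=0}^{n-1}(a+j)$, $(a;q)_n=\prod_{j=0}^{n-1}(1-aq^j)$, $(a;q)_\infty=\prod_{j\ge0}(1-aq^j)$. Complex powers are $x^{\beta}=e^{\beta\log x}$ with $\log$ the complex logarithm on its Riemann surface $\tilde{\mathbb{C}}^*$; the half-plane $\Re(x)>0$ is identified with $\{-\frac\pi2<\arg x<\frac\pi2\}\subset\tilde{\mathbb{C}}^*$. Both $F(\mu;q,\cdot)$ and $G(a;q,\cdot)$ are entire. $F$ solves the equation on $\mathbb{C}$, and $x^{-\mu_k}G(\mu_k;q,1/x)$ is considered on $\tilde{\mathbb{C}}^*$. $\mathbb{Z}_{\le0}\oplus\kappa\mathbb{Z}i=\{m+\kappa k i: m\in\mathbb{Z},\ m\le 0,\ k\in\mathbb{Z}\}$. *)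

(* Defs.v *)
From Stdlib Require Import Reals ZArith.
From Coquelicot Require Import Coquelicot.
Open Scope R_scope.

Definition Cexp (z : C) : C :=
  (exp (Re z) * cos (Im z), exp (Re z) * sin (Im z)).

(** The Riemann surface of the logarithm: a point of the universal
    cover of [C \ {0}] is represented by its logarithm
    [w = ln |x| + i arg x], which identifies the surface with the plane [C];
    the covering map is then the exponential. *)
Definition logsurf : Type := C.

Definition proj (w : logsurf) : C := Cexp w.

Definition spow (w : logsurf) (b : C) : C := Cexp (b * w)%C.

(** The positive real [r], taken with argument [0]. *)
Definition of_pos (r : R) : logsurf := (ln r, 0).

(** The right half-plane, identified with [- PI / 2 < arg x < PI / 2];
    meaningful only when [0 < Re x]. *)
Definition of_rhp (x : C) : logsurf := (ln (Cmod x), atan (Im x / Re x)).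

(** Multiplication by [r > 0]: the modulus is multiplied by [r] and the
    argument is unchanged. *)
Definition dilate (r : R) (w : logsurf) : logsurf := Cplus (of_pos r) w.

(** [l] is the derivative of [y] at [w] with respect to [x = proj w], which is
    a local coordinate of the surface; it is not the derivative with respect
    to [w]. *)
Definition is_derive_surf (y : logsurf -> C) (w : logsurf) (l : C) : Prop :=
  filterlim (fun v : C => ((y v - y w) / (proj v - proj w))%C)
    (@locally' C_UniformSpace w) (@locally C_UniformSpace l).

(** Like [Lim_seq] and [Series], these total operators are meaningful only in
    the case of convergence. *)
Definition CLim_seq (u : nat -> C) : C :=
  (real (Lim_seq (fun n => Re (u n))), real (Lim_seq (fun n => Im (u n)))).

Definition CSeries (a : nat -> C) : C :=
  (Series (fun n => Re (a n)), Series (fun n => Im (a n))).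

(** Convergence of a series over [Z] means convergence of both halves,
    [k >= 0] and [k <= -1]. *)
Definition is_Zseries (a : Z -> C) (s : C) : Prop :=
  exists s1 s2 : C,
    @is_series C_AbsRing C_NormedModule (fun n : nat => a (Z.of_nat n)) s1 /\
    @is_series C_AbsRing C_NormedModule
      (fun n : nat => a (- Z.of_nat (S n))%Z) s2 /\
    s = (s1 + s2)%C.

Fixpoint Cprod (f : nat -> C) (n : nat) : C :=
  match n with
  | O => RtoC 1
  | S m => (Cprod f m * f m)%C
  end.

Definition poch (a : C) (n : nat) : C :=
  Cprod (fun j => (a + RtoC (INR j))%C) n.

Definition qpoch (a : C) (q : R) (n : nat) : C :=
  Cprod (fun j => (1 - a * RtoC (q ^ j))%C) n.

Definition qpoch_inf (a : C) (q : R) : C := CLim_seq (qpoch a q).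

(** The integral of [t ^ (z - 1) * exp (- t)] over [t > 0], for [0 < Re z]. *)
Definition Gamma_int (z : C) : C :=
  @RInt_gen C_R_CompleteNormedModule
    (fun t : R => (spow (of_pos t) (z - 1) * RtoC (exp (- t)))%C)
    (at_right 0) (Rbar_locally p_infty).

(** The analytic continuation [Gamma (z + n) / (z (z + 1) ... (z + n - 1))],
    where [n] is a natural number with [0 < Re (z + n)]; [n = 0] when
    [0 < Re z]. Unspecified at the poles [0, -1, -2, ...]. *)
Definition Gamma (z : C) : C :=
  let n := Z.to_nat (up (- Re z)) in
  (Gamma_int (z + RtoC (INR n)) / poch z n)%C.

Definition F (mu : C) (q : R) (x : C) : C :=
  CSeries (fun n : nat =>
    (qpoch (spow (of_pos q) mu) q n / RtoC (INR (fact n)) * Cpow (- x) n)%C).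

Definition G (a : C) (q : R) (x : C) : C :=
  CSeries (fun n : nat =>
    (poch a n * RtoC (q ^ Nat.div2 (n * (n + 1))) / qpoch (RtoC q) q n
     * Cpow (- x) n)%C).

(* Main.v *)
Require Import Defs.
From Stdlib Require Import Reals ZArith Lra Lia FunctionalExtensionality.
From Coquelicot Require Import Coquelicot.
Open Scope R_scope.

(** Write [x = exp w], [L = - ln q] and [kappa = 2 PI / L].

    The two families solve the equation because their power series do so term
    by term; for [x ^ (- a) G(a; q, 1 / x)] this uses [alpha * q ^ (- a) = 1],
    which holds for every [a = mu_k] since [q ^ (i kappa k) = 1]
    ([Cderive_F], [Cderive_Ysol]).

    For the connection formula let first [Re mu > 0], that is [|alpha| < 1].
    Euler's expansion of [1 / (z; q)_inf] turns [(alpha; q)_n] into a series in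
    the powers of [q ^ n], and summing over [n] gives
    [F(x) = (alpha; q)_inf * sum_(m >= 0) alpha ^ m / (q; q)_m * exp (- q ^ m x)]
    ([F_times_qprod_inv]). Here [1 / (q; q)_m] is
    [(q ^ (m + 1); q)_inf / (q; q)_inf], which vanishes for negative [m], so the
    sum may run over all integers. Euler's expansion of [(q z; q)_inf], with
    coefficients [b_j = (- 1) ^ j q ^ (j (j + 1) / 2) / (q; q)_j], then splits
    [F] into the sums
    [sum_(m in Z) q ^ (m (mu + j)) * exp (- q ^ m x)]. Each of them is a sum over
    a lattice in the variable [ln t], and by Poisson summation it equals
    [1 / L * sum_k Gamma (mu_k + j) x ^ (- mu_k - j)] ([poisson]). Since
    [Gamma (mu_k + j) = Gamma (mu_k) * (mu_k)_j], summing over [j] rebuilds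
    [Gamma (mu_k) x ^ (- mu_k) G(mu_k; q, 1 / x)] ([connection_base]).

    Poisson summation is proved with the Fejer kernel. The integrals in that
    argument are expressed by a primitive of the Gamma integrand,
    [lower_gamma], an exponential times an entire power series in [exp]:
    Fourier coefficients are increments of this primitive, increments over
    consecutive cells telescope to [Gamma], rotating the ray of integration is
    an estimate of an increment, and [mean_value_inequality] takes the place of
    every estimate of an integral. The freedom to rotate the ray also gives the
    exponential decay of [Gamma] on vertical lines, hence all the convergence
    that is required ([gamma_term_bound]).

    The general case follows by descending induction from [mu + 1] to [mu]
    ([connection_step]). Let [D] be the difference of the two sides for [mu].
    The relations [alpha y_mu(q x) - y_mu(x) = - c y_(mu + 1)(x)], valid for both
    sides with the same constants, give [alpha D(q x) = D(x)]; the differential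
    equations turn the same relations into [D' = 0], so [D(q x) = D(x)], and
    [alpha <> 1] forces [D = 0]. *)

(** * Limits and series of complex numbers *)

Notation RA := R_AbsRing.
Notation RN := R_NormedModule.
Notation Cis_series := (@is_series C_AbsRing C_NormedModule).

(** Limits are phrased through the modulus, so that estimates apply directly
    instead of through the neighbourhoods of a product space. *)
Definition Clim (u : nat -> C) (l : C) : Prop :=
  is_lim_seq (fun n => Cmod (u n - l)%C) 0.

Lemma Cmod_minus_sym (x y : C) : Cmod (x - y)%C = Cmod (y - x)%C.
Proof. rewrite <- Cmod_opp. f_equal. ring. Qed.

Lemma im_le_Cmod (c : C) : Rabs (Im c) <= Cmod c.
Proof. destruct c as [a b]. generalize (Rmax_Cmod (a, b)). simpl.
  generalize (Rmax_r (Rabs a) (Rabs b)). lra. Qed.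

Lemma Cmod_le_abs (c : C) : Cmod c <= Rabs (Re c) + Rabs (Im c).
Proof.
  destruct c as [a b]. replace (a, b) with (RtoC a + Ci * RtoC b)%C
    by (unfold Ci, RtoC, Cplus, Cmult; simpl; f_equal; ring).
  eapply Rle_trans; [apply Cmod_triangle|]. rewrite Cmod_mult, Cmod_Ci, !Cmod_R.
  simpl. rewrite !Rplus_0_l, ?Rmult_0_l, ?Rmult_1_l. right. f_equal; f_equal; ring.
Qed.

Lemma Cmod_triangle_minus (x y z : C) :
  Cmod (x - z)%C <= Cmod (x - y)%C + Cmod (y - z)%C.
Proof. replace (x - z)%C with ((x - y) + (y - z))%C by ring. apply Cmod_triangle. Qed.

Lemma Cmod_ge_minus (x y : C) : Cmod x - Cmod y <= Cmod (x + y)%C.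
Proof.
  replace (Cmod x) with (Cmod ((x + y) + (- y))%C) by (f_equal; ring).
  generalize (Cmod_triangle (x + y)%C (- y)%C). rewrite Cmod_opp. lra.
Qed.

Lemma Clim_le (u : nat -> C) (l : C) (v : nat -> R) :
  (forall n, Cmod (u n - l)%C <= v n) -> is_lim_seq v 0 -> Clim u l.
Proof.
  intros H Hv. apply (is_lim_seq_le_le (fun _ => 0) _ v 0); auto.
  - intros n. split; [apply Cmod_ge_0 | apply H].
  - apply is_lim_seq_const.
Qed.

Lemma Clim_ext (u v : nat -> C) (l : C) :
  (forall n, u n = v n) -> Clim u l -> Clim v l.
Proof. intros H. apply is_lim_seq_ext. intros n. now rewrite H. Qed.

Lemma Clim_const (c : C) : Clim (fun _ => c) c.
Proof.
  apply (Clim_le _ _ (fun _ => 0)); [|apply is_lim_seq_const].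
  intros _. replace (c - c)%C with (RtoC 0) by ring. rewrite Cmod_0. lra.
Qed.

Lemma is_lim_seq_plus0 (u v : nat -> R) :
  is_lim_seq u 0 -> is_lim_seq v 0 -> is_lim_seq (fun n => u n + v n) 0.
Proof.
  intros Hu Hv. replace (Finite 0) with (Rbar_plus 0 0) by (simpl; f_equal; ring).
  apply is_lim_seq_plus'; assumption.
Qed.

Lemma is_lim_seq_scal0 (u : nat -> R) (c : R) :
  is_lim_seq u 0 -> is_lim_seq (fun n => c * u n) 0.
Proof.
  intros Hu. replace (Finite 0) with (Rbar_mult c 0) by (simpl; f_equal; ring).
  apply is_lim_seq_scal_l; assumption.
Qed.

Lemma Clim_plus (u v : nat -> C) (l m : C) :
  Clim u l -> Clim v m -> Clim (fun n => u n + v n)%C (l + m)%C.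
Proof.
  intros Hu Hv. eapply Clim_le; [|apply (is_lim_seq_plus0 _ _ Hu Hv)].
  intros n. replace (u n + v n - (l + m))%C with ((u n - l) + (v n - m))%C by ring.
  apply Cmod_triangle.
Qed.

Lemma Clim_scal (u : nat -> C) (l c : C) :
  Clim u l -> Clim (fun n => c * u n)%C (c * l)%C.
Proof.
  intros Hu. eapply Clim_le; [|apply (is_lim_seq_scal0 _ (Cmod c) Hu)].
  intros n. replace (c * u n - c * l)%C with (c * (u n - l))%C by ring.
  rewrite Cmod_mult. lra.
Qed.

Lemma Clim_minus (u v : nat -> C) (l m : C) :
  Clim u l -> Clim v m -> Clim (fun n => u n - v n)%C (l - m)%C.
Proof.
  intros Hu Hv. generalize (Clim_plus _ _ _ _ Hu (Clim_scal _ _ (- (1))%C Hv)).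
  replace (l + - (1) * m)%C with (l - m)%C by ring.
  apply Clim_ext. intros n. ring.
Qed.

Lemma Clim_unique (u : nat -> C) (l m : C) : Clim u l -> Clim u m -> l = m.
Proof.
  intros Hl Hm. generalize (Clim_minus _ _ _ _ Hl Hm). intros H.
  assert (H0 : is_lim_seq (fun _ => Cmod (l - m)%C) 0).
  { refine (is_lim_seq_ext _ _ _ _ H). intros n. cbv beta.
    rewrite <- Cmod_opp. f_equal. ring. }
  assert (E : Finite (Cmod (l - m)%C) = Finite 0).
  { rewrite <- (is_lim_seq_unique _ _ H0). symmetry. apply Lim_seq_const. }
  injection E. intros E1. apply Cmod_eq_0 in E1.
  replace l with ((l - m) + m)%C by ring. rewrite E1. ring.
Qed.

Lemma Clim_bound (u : nat -> C) (l : C) (v : nat -> R) (M : R) :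
  Clim u l -> (forall n, Cmod (u n) <= v n) -> is_lim_seq v M -> Cmod l <= M.
Proof.
  intros Hu Hb Hv.
  assert (H : is_lim_seq (fun n => v n + Cmod (u n - l)%C) (M + 0)).
  { apply is_lim_seq_plus'; auto. }
  rewrite Rplus_0_r in H.
  apply (is_lim_seq_le (fun _ => Cmod l) (fun n => v n + Cmod (u n - l)%C) (Cmod l) M); auto.
  - intros n. specialize (Hb n).
    replace (Cmod l) with (Cmod (u n + - (u n - l))%C) by (f_equal; ring).
    eapply Rle_trans; [apply Cmod_triangle|]. rewrite Cmod_opp. lra.
  - apply is_lim_seq_const.
Qed.

Lemma Clim_incr_1 (u : nat -> C) (l : C) : Clim (fun n => u (S n)) l <-> Clim u l.
Proof. unfold Clim. symmetry. apply (is_lim_seq_incr_1 (fun n => Cmod (u n - l)%C)). Qed.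

Lemma Clim_Re (u : nat -> C) (l : C) : Clim u l -> is_lim_seq (fun n => Re (u n)) (Re l).
Proof.
  intros H. apply is_lim_seq_spec. intros eps.
  apply is_lim_seq_spec in H. destruct (H eps) as [N HN]. exists N. intros n Hn.
  specialize (HN n Hn). rewrite Rminus_0_r, Rabs_pos_eq in HN by apply Cmod_ge_0.
  eapply Rle_lt_trans; [|apply HN].
  replace (Re (u n) - Re l) with (Re (u n - l)%C) by reflexivity. apply re_le_Cmod.
Qed.

Lemma Clim_Im (u : nat -> C) (l : C) : Clim u l -> is_lim_seq (fun n => Im (u n)) (Im l).
Proof.
  intros H. apply is_lim_seq_spec. intros eps.
  apply is_lim_seq_spec in H. destruct (H eps) as [N HN]. exists N. intros n Hn.
  specialize (HN n Hn). rewrite Rminus_0_r, Rabs_pos_eq in HN by apply Cmod_ge_0.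
  eapply Rle_lt_trans; [|apply HN].
  replace (Im (u n) - Im l) with (Im (u n - l)%C) by reflexivity. apply im_le_Cmod.
Qed.

Lemma Clim_of_ReIm (u : nat -> C) (l : C) :
  is_lim_seq (fun n => Re (u n)) (Re l) -> is_lim_seq (fun n => Im (u n)) (Im l) -> Clim u l.
Proof.
  intros H1 H2.
  assert (K1 : is_lim_seq (fun n => Rabs (Re (u n) - Re l)) 0).
  { apply (is_lim_seq_abs_0 (fun n => Re (u n) - Re l)).
    replace (Finite 0) with (Finite (Re l - Re l)) by (f_equal; ring).
    apply is_lim_seq_minus'; auto. apply is_lim_seq_const. }
  assert (K2 : is_lim_seq (fun n => Rabs (Im (u n) - Im l)) 0).
  { apply (is_lim_seq_abs_0 (fun n => Im (u n) - Im l)).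
    replace (Finite 0) with (Finite (Im l - Im l)) by (f_equal; ring).
    apply is_lim_seq_minus'; auto. apply is_lim_seq_const. }
  eapply Clim_le; [|apply (is_lim_seq_plus0 _ _ K1 K2)].
  intros n. apply Cmod_le_abs.
Qed.

Lemma CLim_seq_unique (u : nat -> C) (l : C) : Clim u l -> CLim_seq u = l.
Proof.
  intros H. unfold CLim_seq. rewrite (is_lim_seq_unique _ _ (Clim_Re _ _ H)),
    (is_lim_seq_unique _ _ (Clim_Im _ _ H)). now destruct l.
Qed.

Lemma filterlim_Clim (u : nat -> C) (l : C) :
  filterlim u eventually (@locally C_UniformSpace l) <-> Clim u l.
Proof.
  split.
  - intros H. apply Clim_of_ReIm.
    + intros P HP. destruct HP as [e He].
      apply (H (fun z : C => P (Re z))). exists e. intros y [Hy _]. apply He, Hy.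
    + intros P HP. destruct HP as [e He].
      apply (H (fun z : C => P (Im z))). exists e. intros y [_ Hy]. apply He, Hy.
  - intros H P [e He]. apply is_lim_seq_spec in H. destruct (H e) as [N HN].
    exists N. intros n Hn. apply He. apply C_NormedModule_mixin_compat1.
    specialize (HN n Hn). rewrite Rminus_0_r, Rabs_pos_eq in HN by apply Cmod_ge_0.
    exact HN.
Qed.

Definition Csum (a : nat -> C) (n : nat) : C := @sum_n C_AbelianMonoid a n.

Lemma Csum_O (a : nat -> C) : Csum a 0 = a 0%nat.
Proof. apply (@sum_O C_AbelianMonoid). Qed.

Lemma Csum_S (a : nat -> C) (n : nat) : Csum a (S n) = (Csum a n + a (S n))%C.
Proof. apply (@sum_Sn C_AbelianMonoid). Qed.

Lemma Csum_ext (a b : nat -> C) (n : nat) :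
  (forall k, a k = b k) -> Csum a n = Csum b n.
Proof. intros H. apply (@sum_n_ext C_AbelianMonoid). exact H. Qed.

Lemma is_series_Clim (a : nat -> C) (s : C) : Cis_series a s <-> Clim (Csum a) s.
Proof. apply filterlim_Clim. Qed.

Lemma Cis_series_ext (a b : nat -> C) (s : C) :
  (forall n, a n = b n) -> Cis_series a s -> Cis_series b s.
Proof. apply (@is_series_ext C_AbsRing C_NormedModule). Qed.

Lemma Cis_series_unique (a : nat -> C) (s t : C) : Cis_series a s -> Cis_series a t -> s = t.
Proof. rewrite !is_series_Clim. apply Clim_unique. Qed.

Lemma Cis_series_plus (a b : nat -> C) (s t : C) :
  Cis_series a s -> Cis_series b t -> Cis_series (fun n => a n + b n)%C (s + t)%C.
Proof. apply (@is_series_plus C_AbsRing C_NormedModule). Qed.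

Lemma Cis_series_scal (a : nat -> C) (s c : C) :
  Cis_series a s -> Cis_series (fun n => c * a n)%C (c * s)%C.
Proof. apply (@is_series_scal C_AbsRing C_NormedModule). Qed.

Lemma Cis_series_minus (a b : nat -> C) (s t : C) :
  Cis_series a s -> Cis_series b t -> Cis_series (fun n => a n - b n)%C (s - t)%C.
Proof. apply (@is_series_minus C_AbsRing C_NormedModule). Qed.

Lemma Cis_series_decr_1 (a : nat -> C) (s : C) :
  Cis_series (fun n => a (S n)) s -> Cis_series a (a 0%nat + s)%C.
Proof.
  intros H. apply (@is_series_decr_1 C_AbsRing C_NormedModule).
  refine (eq_ind s (fun t : C => Cis_series (fun n => a (S n)) t) H _ _).
  change (s = (a 0%nat + s) + - a 0%nat)%C. ring.
Qed.

Lemma Cis_series_incr_1 (a : nat -> C) (s : C) :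
  Cis_series a s -> Cis_series (fun n => a (S n)) (s - a 0%nat)%C.
Proof.
  intros H. apply (@is_series_incr_1 C_AbsRing C_NormedModule).
  refine (eq_ind s (fun t : C => Cis_series a t) H _ _).
  change (s = (s - a 0%nat) + a 0%nat)%C. ring.
Qed.

Lemma CSeries_unique (a : nat -> C) (s : C) : Cis_series a s -> CSeries a = s.
Proof.
  rewrite is_series_Clim. intros H.
  assert (HR : forall n, Re (Csum a n) = sum_n (fun k => Re (a k)) n).
  { induction n as [|n IH]; [now rewrite Csum_O, sum_O|].
    rewrite Csum_S, sum_Sn, <- IH. reflexivity. }
  assert (HI : forall n, Im (Csum a n) = sum_n (fun k => Im (a k)) n).
  { induction n as [|n IH]; [now rewrite Csum_O, sum_O|].
    rewrite Csum_S, sum_Sn, <- IH. reflexivity. }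
  unfold CSeries.
  rewrite (is_series_unique (fun n => Re (a n)) (Re s)),
    (is_series_unique (fun n => Im (a n)) (Im s)).
  - now destruct s.
  - change (is_lim_seq (sum_n (fun n => Im (a n))) (Im s)). apply (is_lim_seq_ext (fun n => Im (Csum a
    n))); auto. now apply Clim_Im.
  - change (is_lim_seq (sum_n (fun n => Re (a n))) (Re s)). apply (is_lim_seq_ext (fun n => Re (Csum a
    n))); auto. now apply Clim_Re.
Qed.

Lemma ex_series_le_pos (a b : nat -> R) :
  (forall n, 0 <= a n <= b n) -> ex_series b -> ex_series a.
Proof.
  intros H. apply (@ex_series_le RA R_CompleteNormedModule).
  intros n. change (Rabs (a n) <= b n). rewrite Rabs_pos_eq; apply H.
Qed.

Lemma ex_series_geo (c g : R) : 0 <= g < 1 -> ex_series (fun n => c * g ^ n).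
Proof.
  intros Hg. apply (ex_series_scal (V := RN)). apply ex_series_geom. rewrite Rabs_pos_eq; lra.
Qed.

Definition Cabs_conv (a : nat -> C) : Prop := ex_series (fun n => Cmod (a n)).

Lemma Cabs_conv_le (a : nat -> C) (b : nat -> R) :
  (forall n, Cmod (a n) <= b n) -> ex_series b -> Cabs_conv a.
Proof.
  intros H Hb. apply ex_series_le_pos with b; auto. intros n. split; auto. apply Cmod_ge_0.
Qed.

Lemma CSeries_correct (a : nat -> C) : Cabs_conv a -> Cis_series a (CSeries a).
Proof.
  intros H. assert (E : @ex_series C_AbsRing C_NormedModule a).
  { apply (@ex_series_le C_AbsRing C_CompleteNormedModule) with (fun n => Cmod (a n)); auto.
    intros n. apply Rle_refl. }
  destruct E as [s Hs]. now rewrite (CSeries_unique _ _ Hs).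
Qed.

Lemma Cmod_Csum_le (a : nat -> C) (n : nat) :
  Cmod (Csum a n) <= sum_n (fun k => Cmod (a k)) n.
Proof.
  induction n as [|n IH]; [rewrite Csum_O, sum_O; lra|].
  rewrite Csum_S, sum_Sn. eapply Rle_trans; [apply Cmod_triangle|].
  change (plus (sum_n (fun k => Cmod (a k)) n) (Cmod (a (S n))))
    with (sum_n (fun k => Cmod (a k)) n + Cmod (a (S n))). lra.
Qed.

Lemma Cis_series_bound (a : nat -> C) (s : C) (b : nat -> R) (t : R) :
  Cis_series a s -> (forall n, Cmod (a n) <= b n) -> is_series b t -> Cmod s <= t.
Proof.
  rewrite is_series_Clim. intros Hs Hb Ht. apply (Clim_bound _ _ (sum_n b) t Hs); auto.
  intros n. eapply Rle_trans; [apply Cmod_Csum_le|]. now apply sum_n_m_le.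
Qed.

Lemma CSeries_bound (a : nat -> C) (b : nat -> R) :
  (forall n, Cmod (a n) <= b n) -> ex_series b -> Cmod (CSeries a) <= Series b.
Proof.
  intros H Hb. apply (Cis_series_bound a _ b); auto.
  - apply CSeries_correct. now apply Cabs_conv_le with b.
  - now apply Series_correct.
Qed.

Lemma CSeries_ext (a b : nat -> C) : (forall n, a n = b n) -> CSeries a = CSeries b.
Proof. intros H. unfold CSeries. f_equal; apply Series_ext; intros n; now rewrite H. Qed.

Lemma Csum_scal (a : nat -> C) (c : C) n : Csum (fun k => c * a k)%C n = (c * Csum a n)%C.
Proof.
  induction n as [|n IH]; [now rewrite !Csum_O|]. rewrite !Csum_S, IH. ring.
Qed.

Lemma Csum_series (a : nat -> nat -> C) (t : nat -> C) (J : nat) :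
  (forall j, Cis_series (a j) (t j)) -> Cis_series (fun k => Csum (fun j => a j k) J) (Csum t J).
Proof.
  intros H. induction J as [|J IH].
  - rewrite Csum_O. apply Cis_series_ext with (2 := H 0%nat). intros n. now rewrite Csum_O.
  - rewrite Csum_S. apply Cis_series_ext with (2 := Cis_series_plus _ _ _ _ IH (H (S J))).
    intros n. now rewrite Csum_S.
Qed.

Lemma series_tail (u : nat -> R) :
  ex_series u -> is_lim_seq (fun n => Series u - sum_n u n) 0.
Proof.
  intros H. replace (Finite 0) with (Finite (Series u - Series u)) by (f_equal; ring).
  apply is_lim_seq_minus'; [apply is_lim_seq_const|]. apply (Series_correct _ H).
Qed.

Lemma Cis_series_tail (a : nat -> C) (s : C) (u : nat -> R) (J : nat) :
  Cis_series a s -> (forall n, Cmod (a n) <= u n) -> ex_series u ->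
  Cmod (s - Csum a J)%C <= Series u - sum_n u J.
Proof.
  intros Hs Hu Hex. rewrite is_series_Clim in Hs.
  assert (H : forall n, Cmod (Csum a (n + J) - Csum a J)%C <= sum_n u (n + J) - sum_n u J).
  { induction n as [|n IH].
    - simpl. replace (Csum a J - Csum a J)%C with (RtoC 0) by ring. rewrite Cmod_0. lra.
    - simpl. rewrite Csum_S, sum_Sn.
      change (plus (sum_n u (n + J)) (u (S (n + J)))) with (sum_n u (n + J) + u (S (n + J))).
      replace (Csum a (n + J) + a (S (n + J)) - Csum a J)%C
        with ((Csum a (n + J) - Csum a J) + a (S (n + J)))%C by ring.
      eapply Rle_trans; [apply Cmod_triangle|]. specialize (Hu (S (n + J))). lra. }
  apply (Clim_bound (fun n => Csum a (n + J) - Csum a J)%C _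
    (fun n => sum_n u (n + J) - sum_n u J)); auto.
  - apply Clim_minus; [|apply Clim_const].
    unfold Clim. apply (is_lim_seq_incr_n (fun n => Cmod (Csum a n - s)%C) J). exact Hs.
  - apply is_lim_seq_minus'; [|apply is_lim_seq_const].
    apply (is_lim_seq_incr_n (sum_n u) J). apply (Series_correct _ Hex).
Qed.

(** Truncating the outer sum at [J] leaves an error whose [k]-th entry is at
    most the tail of [u] times [v k], and this tends to 0 after summing over
    [k]. All the double series below have such product bounds. *)
Lemma Cseries_swap (a : nat -> nat -> C) (u v : nat -> R) :
  (forall j k, Cmod (a j k) <= u j * v k) -> (forall j, 0 <= u j) -> (forall k, 0 <= v k) ->
  ex_series u -> ex_series v ->
  exists s : C, Cis_series (fun j => CSeries (fun k => a j k)) s /\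
    Cis_series (fun k => CSeries (fun j => a j k)) s.
Proof.
  intros H Hu0 Hv0 Hu Hv.
  assert (Hrow : forall j, Cis_series (fun k => a j k) (CSeries (fun k => a j k))).
  { intros j. apply CSeries_correct. apply Cabs_conv_le with (fun k => u j * v k); auto.
    now apply (ex_series_scal (V := RN)). }
  assert (Hcol : forall k, Cis_series (fun j => a j k) (CSeries (fun j => a j k))).
  { intros k. apply CSeries_correct. apply Cabs_conv_le with (fun j => u j * v k); auto.
    now apply ex_series_scal_r. }
  assert (Bcol : forall k, Cmod (CSeries (fun j => a j k)) <= Series u * v k).
  { intros k. rewrite <- Series_scal_r. apply CSeries_bound; auto.
    now apply ex_series_scal_r. }
  assert (Hs : Cis_series (fun k => CSeries (fun j => a j k))
                 (CSeries (fun k => CSeries (fun j => a j k)))).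
  { apply CSeries_correct. apply Cabs_conv_le with (fun k => Series u * v k); auto.
    now apply (ex_series_scal (V := RN)). }
  set (s := CSeries (fun k => CSeries (fun j => a j k))) in *.
  exists s. split; auto.
  rewrite is_series_Clim.
  apply Clim_le with (fun J => Series v * (Series u - sum_n u J)).
  2: { apply is_lim_seq_scal0. now apply series_tail. }
  intros J.
  generalize (Csum_series (fun j k => a j k) (fun j => CSeries (fun k => a j k)) J Hrow).
  intros HJ. rewrite Cmod_minus_sym.
  generalize (Cis_series_minus _ _ _ _ Hs HJ). intros HD.
  apply (Cis_series_bound _ _ (fun k => v k * (Series u - sum_n u J)) _ HD).
  - intros k. cbv beta.
    replace (v k * (Series u - sum_n u J)) with
      (Series (fun j => u j * v k) - sum_n (fun j => u j * v k) J).
    + apply (Cis_series_tail (fun j => a j k)); auto. now apply ex_series_scal_r.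
    + rewrite Series_scal_r. rewrite (sum_n_mult_r (K := R_Ring)).
      change (Series u * v k - sum_n u J * v k = v k * (Series u - sum_n u J)). ring.
  - rewrite Rmult_comm. apply is_series_ext with (fun k => (Series u - sum_n u J) * v k).
    { intros k. apply Rmult_comm. }
    apply (is_series_scal (V := RN)). now apply Series_correct.
Qed.

(** * Complex derivatives and the mean value inequality *)

Lemma Cplus_minus_r (x y : C) : (x + (y - x))%C = y.
Proof. ring. Qed.

(** The codomain carries the norm of the ring, so that the generic product
    and chain rules apply; [Cderive_is_derive] passes to [C_NormedModule],
    whose uniform structure is that of the product. *)
Definition Cderive (f : C -> C) (z l : C) : Prop :=
  @is_derive C_AbsRing (AbsRing_NormedModule C_AbsRing) f z l.

Lemma Cderive_eps (f : C -> C) (z l : C) :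
  Cderive f z l <->
  forall eps : R, 0 < eps -> exists delta : R, 0 < delta /\
    forall h : C, Cmod h < delta -> Cmod (f (z + h) - f z - h * l)%C <= eps * Cmod h.
Proof.
  split.
  - intros [_ H] eps Heps.
    destruct (H z (fun P HP => HP) (mkposreal eps Heps)) as [d Hd].
    exists d. split; [apply cond_pos|]. intros h Hh.
    specialize (Hd (z + h)%C).
    assert (Hb : @ball (AbsRing_UniformSpace C_AbsRing) z d (z + h)%C).
    { change (Cmod (z + h - z)%C < d). replace (z + h - z)%C with h by ring. exact Hh. }
    specialize (Hd Hb).
    change (Cmod (f (z + h) - f z - (z + h - z) * l)%C <= eps * Cmod (z + h - z)%C) in Hd.
    replace (z + h - z)%C with h in Hd by ring. exact Hd.
  - intros H. split; [apply is_linear_scal_l|].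
    intros x Hx eps.
    assert (E : z = x) by (apply (@is_filter_lim_locally_unique C_AbsRing (AbsRing_NormedModule
      C_AbsRing)); exact Hx).
    subst x. destruct (H eps (cond_pos eps)) as [d [Hd0 Hd]].
    exists (mkposreal d Hd0). intros y Hy.
    specialize (Hd (y - z)%C Hy). rewrite (Cplus_minus_r z y) in Hd.
    exact Hd.
Qed.

Lemma Cderive_is_derive (f : C -> C) (z l : C) :
  Cderive f z l -> @is_derive C_AbsRing C_NormedModule f z l.
Proof.
  intros H0. assert (H := proj1 (Cderive_eps f z l) H0). split; [apply is_linear_scal_l|].
  intros x Hx eps.
  assert (E : z = x) by (apply (@is_filter_lim_locally_unique C_AbsRing (AbsRing_NormedModule C_AbsRing));
    exact Hx).
  subst x. destruct (H eps (cond_pos eps)) as [d [Hd0 Hd]].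
  exists (mkposreal d Hd0). intros y Hy.
  specialize (Hd (y - z)%C Hy). rewrite (Cplus_minus_r z y) in Hd.
  exact Hd.
Qed.

Lemma Cderive_quad (f : C -> C) (z l : C) (K r : R) :
  0 < r -> (forall h, Cmod h < r -> Cmod (f (z + h) - f z - h * l)%C <= K * Cmod h ^ 2) ->
  Cderive f z l.
Proof.
  intros Hr H. apply Cderive_eps. intros eps He.
  exists (Rmin r (eps / (Rabs K + 1))).
  assert (HK : 0 < Rabs K + 1) by (generalize (Rabs_pos K); lra).
  split; [apply Rmin_glb_lt; auto; now apply Rdiv_lt_0_compat|].
  intros h Hh. eapply Rle_trans; [apply H; eapply Rlt_le_trans; [apply Hh|apply Rmin_l]|].
  assert (H2 : Cmod h < eps / (Rabs K + 1)) by (eapply Rlt_le_trans; [apply Hh|apply Rmin_r]).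
  assert (H3 : Cmod h * (Rabs K + 1) < eps).
  { apply (Rmult_lt_compat_r (Rabs K + 1)) in H2; auto. replace (eps / (Rabs K + 1) * (Rabs K + 1)) with
    eps in H2 by (field; lra). exact H2. }
  generalize (Cmod_ge_0 h) (Rle_abs K). intros. nra.
Qed.

Lemma Cderive_ext (f g : C -> C) (z l : C) :
  (forall x, f x = g x) -> Cderive f z l -> Cderive g z l.
Proof. intros H. apply is_derive_ext. exact H. Qed.

Lemma Cderive_const (c z : C) : Cderive (fun _ => c) z 0.
Proof. exact (@is_derive_const C_AbsRing (AbsRing_NormedModule C_AbsRing) c z). Qed.

Lemma Cderive_id (z : C) : Cderive (fun x => x) z 1.
Proof. exact (@is_derive_id C_AbsRing z). Qed.

Lemma Cderive_plus (f g : C -> C) (z l m : C) :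
  Cderive f z l -> Cderive g z m -> Cderive (fun x => f x + g x)%C z (l + m)%C.
Proof. exact (@is_derive_plus C_AbsRing (AbsRing_NormedModule C_AbsRing) f g z l m). Qed.

Lemma Cderive_mult (f g : C -> C) (z l m : C) :
  Cderive f z l -> Cderive g z m -> Cderive (fun x => f x * g x)%C z (l * g z + f z * m)%C.
Proof.
  intros Hf Hg. exact (@is_derive_mult C_AbsRing f g z l m Hf Hg Cmult_comm).
Qed.

Lemma Cderive_comp (f g : C -> C) (z l m : C) :
  Cderive f (g z) l -> Cderive g z m -> Cderive (fun x => f (g x)) z (m * l)%C.
Proof. exact (@is_derive_comp C_AbsRing (AbsRing_NormedModule C_AbsRing) f g z l m). Qed.

Lemma Cderive_eq (f : C -> C) (z l m : C) : Cderive f z l -> l = m -> Cderive f z m.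
Proof. now intros H <-. Qed.

Lemma Cderive_scal (f : C -> C) (c z l : C) :
  Cderive f z l -> Cderive (fun x => c * f x)%C z (c * l)%C.
Proof.
  intros H. eapply Cderive_eq; [apply (Cderive_mult (fun _ => c) f z _ _ (Cderive_const c z) H)|].
  ring.
Qed.

Lemma Cderive_lin (a b z : C) : Cderive (fun x => a * x + b)%C z a.
Proof.
  eapply Cderive_eq; [apply Cderive_plus; [apply Cderive_scal; apply Cderive_id|apply Cderive_const]|].
  ring.
Qed.

(** Componentwise, so that the mean value theorem of real analysis applies. *)
Definition Rderive (f : R -> C) (t : R) (l : C) : Prop :=
  is_derive (fun x => Re (f x)) t (Re l) /\ is_derive (fun x => Im (f x)) t (Im l).

Lemma Rderive_eq (f : R -> C) (t : R) (l m : C) : Rderive f t l -> l = m -> Rderive f t m.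
Proof. now intros H <-. Qed.

Lemma Rderive_ext (f g : R -> C) (t : R) (l : C) :
  (forall x, f x = g x) -> Rderive f t l -> Rderive g t l.
Proof.
  intros H [H1 H2]. split; (eapply is_derive_ext; [|eassumption]); intros x; cbv beta; now rewrite H.
Qed.

Lemma Rderive_mult (f g : R -> C) (t : R) (l m : C) :
  Rderive f t l -> Rderive g t m -> Rderive (fun x => f x * g x)%C t (l * g t + f t * m)%C.
Proof.
  intros [F1 F2] [G1 G2]. split.
  - eapply is_derive_ext; [intros x; symmetry; apply re_mult|].
    replace (Re (l * g t + f t * m)%C) with
      ((Re l * Re (g t) + Re (f t) * Re m) - (Im l * Im (g t) + Im (f t) * Im m))
      by (rewrite re_plus, !re_mult; ring).
    apply (is_derive_minus (V := RN)); apply (is_derive_mult (K := RA)); auto; exact Rmult_comm.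
  - eapply is_derive_ext; [intros x; symmetry; apply im_mult|].
    replace (Im (l * g t + f t * m)%C) with
      ((Re l * Im (g t) + Re (f t) * Im m) + (Im l * Re (g t) + Im (f t) * Re m))
      by (rewrite im_plus, !im_mult; ring).
    apply (is_derive_plus (V := RN)); apply (is_derive_mult (K := RA)); auto; exact Rmult_comm.
Qed.

Lemma Rderive_plus (f g : R -> C) (t : R) (l m : C) :
  Rderive f t l -> Rderive g t m -> Rderive (fun x => f x + g x)%C t (l + m)%C.
Proof.
  intros [F1 F2] [G1 G2]. split; rewrite ?re_plus, ?im_plus.
  - apply (is_derive_plus (V := RN) (fun x => Re (f x)) (fun x => Re (g x))); auto.
  - apply (is_derive_plus (V := RN) (fun x => Im (f x)) (fun x => Im (g x))); auto.
Qed.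

Lemma Rderive_const (c : C) (t : R) : Rderive (fun _ => c) t 0.
Proof. split; apply (is_derive_const (V := RN)). Qed.

Lemma Rderive_scal (f : R -> C) (c : C) (t : R) (l : C) :
  Rderive f t l -> Rderive (fun x => c * f x)%C t (c * l)%C.
Proof.
  intros H. eapply Rderive_eq; [apply (Rderive_mult (fun _ => c) f t _ _ (Rderive_const c t) H)|]. ring.
Qed.

Lemma Rderive_real (f : R -> R) (t l : R) : is_derive f t l -> Rderive (fun x => RtoC (f x)) t (RtoC l).
Proof. intros H. split; [exact H|]. exact (is_derive_const (V := RN) 0 t). Qed.

Lemma Rderive_line (f : C -> C) (z v : C) (t : R) (l : C) :
  Cderive f (z + RtoC t * v)%C l -> Rderive (fun x => f (z + RtoC x * v)%C) t (v * l)%C.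
Proof.
  intros H.
  assert (K : forall p : C -> R, (forall a b, p (a - b)%C = p a - p b) ->
     (forall r a, p (RtoC r * a)%C = r * p a) -> (forall a, Rabs (p a) <= Cmod a) ->
     is_derive (fun x => p (f (z + RtoC x * v)%C)) t (p (v * l)%C)).
  { intros p Hp1 Hp2 Hp3. apply is_derive_Reals. intros eps Heps.
    assert (Hv : 0 < Cmod v + 1) by (generalize (Cmod_ge_0 v); lra).
    assert (He2 : 0 < eps / (2 * (Cmod v + 1))) by (apply Rdiv_lt_0_compat; lra).
    destruct (proj1 (Cderive_eps _ _ _) H _ He2) as [d [Hd0 Hd]].
    assert (Hd2 : 0 < d / (Cmod v + 1)) by (apply Rdiv_lt_0_compat; lra).
    exists (mkposreal _ Hd2). intros h Hh0 Hh. simpl in Hh.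
    specialize (Hd (RtoC h * v)%C). rewrite Cmod_mult, Cmod_R in Hd.
    assert (Hhd : Rabs h * Cmod v < d).
    { apply (Rmult_lt_compat_r (Cmod v + 1)) in Hh; auto.
      replace (d / (Cmod v + 1) * (Cmod v + 1)) with d in Hh by (field; lra).
      generalize (Rabs_pos h). nra. }
    specialize (Hd Hhd).
    replace (z + RtoC t * v + RtoC h * v)%C with (z + RtoC (t + h) * v)%C in Hd
      by (rewrite RtoC_plus; ring).
    replace (RtoC h * v * l)%C with (RtoC h * (v * l))%C in Hd by ring.
    assert (Hq : Rabs (p (f (z + RtoC (t + h) * v)%C) - p (f (z + RtoC t * v)%C) - h * p (v * l)%C)
       <= eps / (2 * (Cmod v + 1)) * (Rabs h * Cmod v)).
    { eapply Rle_trans; [|apply Hd]. rewrite <- Hp2, <- !Hp1. apply Hp3. }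
    assert (Hah : 0 < Rabs h) by now apply Rabs_pos_lt.
    replace ((p (f (z + RtoC (t + h) * v)%C) - p (f (z + RtoC t * v)%C)) / h - p (v * l)%C)
      with ((p (f (z + RtoC (t + h) * v)%C) - p (f (z + RtoC t * v)%C) - h * p (v * l)%C) / h)
      by (field; auto).
    unfold Rdiv at 1. rewrite Rabs_mult, Rabs_inv.
    apply Rle_lt_trans with (eps / (2 * (Cmod v + 1)) * Cmod v).
    - apply (Rmult_le_compat_r (/ Rabs h)) in Hq; [|left; now apply Rinv_0_lt_compat].
      eapply Rle_trans; [apply Hq|]. right. field. split; lra.
    - apply Rle_lt_trans with (eps / (2 * (Cmod v + 1)) * (Cmod v + 1)).
      + apply Rmult_le_compat_l; lra.
      + replace (eps / (2 * (Cmod v + 1)) * (Cmod v + 1)) with (eps / 2) by (field; lra). lra. }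
  split.
  - apply K; [reflexivity|intros; apply re_scal_l|apply re_le_Cmod].
  - apply K; [reflexivity|intros; apply im_scal_l|apply im_le_Cmod].
Qed.

Lemma nondecreasing_MVT (g g' : R -> R) (a b : R) :
  a <= b -> (forall t, a <= t <= b -> is_derive g t (g' t)) ->
  (forall t, a <= t <= b -> 0 <= g' t) -> g a <= g b.
Proof.
  intros Hab Hg Hp.
  destruct (MVT_gen g a b g') as [c [Hc He]].
  - rewrite Rmin_left, Rmax_right by lra. intros x Hx. apply Hg. lra.
  - rewrite Rmin_left, Rmax_right by lra. intros x Hx.
    apply continuity_pt_filterlim.
    apply (@ex_derive_continuous R_AbsRing R_NormedModule).
    exists (g' x). apply Hg. lra.
  - rewrite Rmin_left, Rmax_right in Hc by lra. specialize (Hp c Hc). nra.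
Qed.

(** With [d = f b - f a], the real function [|d| g - Re (conj d * f)] is
    nondecreasing. Applied to an explicit primitive [f], the inequality bounds
    the integral of [f']. *)
Lemma mean_value_inequality (f f' : R -> C) (g g' : R -> R) (a b : R) :
  a <= b ->
  (forall t, a <= t <= b -> Rderive f t (f' t)) ->
  (forall t, a <= t <= b -> is_derive g t (g' t)) ->
  (forall t, a <= t <= b -> Cmod (f' t) <= g' t) ->
  Cmod (f b - f a)%C <= g b - g a.
Proof.
  intros Hab Hf Hg Hb.
  set (d := (f b - f a)%C).
  assert (Hgg : g a <= g b).
  { apply (nondecreasing_MVT g g'); auto. intros t Ht.
    eapply Rle_trans; [apply Cmod_ge_0|apply Hb, Ht]. }
  assert (H : Cmod d * g a - (Re d * Re (f a) + Im d * Im (f a)) <=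
              Cmod d * g b - (Re d * Re (f b) + Im d * Im (f b))).
  { apply (nondecreasing_MVT (fun t => Cmod d * g t - (Re d * Re (f t) + Im d * Im (f t)))
      (fun t => Cmod d * g' t - (Re d * Re (f' t) + Im d * Im (f' t)))); auto.
    - intros t Ht. destruct (Hf t Ht) as [F1 F2].
      apply (is_derive_minus (V := RN) (fun t => Cmod d * g t) (fun t => (Re d * Re (f t) + Im d * Im (f
        t)))).
      + apply is_derive_scal. now apply Hg.
      + apply (is_derive_plus (V := RN) (fun t => (Re d * Re (f t))) (fun t => (Im d * Im (f t)))).
        * now apply (is_derive_scal (fun t => Re (f t))).
        * now apply (is_derive_scal (fun t => Im (f t))).
    - intros t Ht. specialize (Hb t Ht).
      assert (E : Re d * Re (f' t) + Im d * Im (f' t) = Re (Cconj d * f' t)%C).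
      { rewrite re_mult, re_conj, im_conj. ring. }
      rewrite E. generalize (re_le_Cmod (Cconj d * f' t)%C) (Rle_abs (Re (Cconj d * f' t)%C)).
      rewrite Cmod_mult, Cmod_conj. generalize (Cmod_ge_0 d). nra. }
  assert (E : Re d * Re (f b) + Im d * Im (f b) - (Re d * Re (f a) + Im d * Im (f a)) = Cmod d ^ 2).
  { rewrite Cmod2_alt. unfold d. change (Re (f b - f a)%C) with (Re (f b) - Re (f a)).
    change (Im (f b - f a)%C) with (Im (f b) - Im (f a)). ring. }
  destruct (Rle_lt_or_eq_dec 0 (Cmod d) (Cmod_ge_0 d)) as [Hd|Hd]; nra.
Qed.

Lemma Rderive_zero_const (f : R -> C) (a b : R) :
  a <= b -> (forall t, a <= t <= b -> Rderive f t 0) -> f b = f a.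
Proof.
  intros Hab Hf. assert (H : Cmod (f b - f a)%C <= 0 - 0).
  { apply (mean_value_inequality f (fun _ => RtoC 0) (fun _ => 0) (fun _ => 0)); auto.
    - intros. apply (is_derive_const (V := RN)).
    - intros. rewrite Cmod_0. lra. }
  apply Ceq_minus. apply Cmod_eq_0. generalize (Cmod_ge_0 (f b - f a)%C). lra.
Qed.

(** * Entire power series *)

Definition PS (a : nat -> C) (z : C) : C := CSeries (fun n => a n * z ^ n)%C.

(** Only radii at least 1 are tested; for them [r ^ n] increases with [n]. *)
Definition entire (a : nat -> C) : Prop :=
  forall r : R, 1 <= r -> ex_series (fun n => Cmod (a n) * r ^ n).

Definition dcoef (a : nat -> C) (n : nat) : C := (RtoC (INR (S n)) * a (S n))%C.

Lemma entire_abs (a : nat -> C) (r : R) (z : C) :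
  entire a -> Cmod z <= r -> 1 <= r -> Cabs_conv (fun n => a n * z ^ n)%C.
Proof.
  intros H Hz Hr. apply Cabs_conv_le with (fun n => Cmod (a n) * r ^ n); [|now apply H].
  intros n. rewrite Cmod_mult, Cmod_pow. apply Rmult_le_compat_l; [apply Cmod_ge_0|].
  apply pow_incr. split; [apply Cmod_ge_0|exact Hz].
Qed.

Lemma PS_correct (a : nat -> C) (z : C) : entire a -> Cis_series (fun n => a n * z ^ n)%C (PS a z).
Proof.
  intros H. apply CSeries_correct. generalize (Cmod_ge_0 z). intros.
  apply (entire_abs a (1 + Cmod z)); auto; lra.
Qed.

Lemma INR_le_pow2 (n : nat) : INR n <= 2 ^ n.
Proof.
  induction n as [|n IH]; [simpl; lra|]. rewrite S_INR. simpl.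
  assert (1 <= 2 ^ n) by (apply pow_R1_Rle; lra). lra.
Qed.

Lemma entire_dcoef (a : nat -> C) : entire a -> entire (dcoef a).
Proof.
  intros H r Hr.
  apply ex_series_le_pos with (fun n => Cmod (a (S n)) * (2 * r) ^ S n).
  - intros n. assert (0 <= r ^ n) by (apply pow_le; lra).
    split; [apply Rmult_le_pos; auto; apply Cmod_ge_0|].
    unfold dcoef. rewrite Cmod_mult, Cmod_R, (Rabs_pos_eq (INR (S n))) by apply pos_INR.
    rewrite Rpow_mult_distr. rewrite (Rmult_comm (INR (S n))), Rmult_assoc.
    apply Rmult_le_compat_l; [apply Cmod_ge_0|].
    apply Rmult_le_compat; auto; [apply pos_INR|apply INR_le_pow2|].
    simpl. nra.
  - apply (ex_series_incr_1 (fun n => Cmod (a n) * (2 * r) ^ n)). apply H. lra.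
Qed.

(** The derived series indexed as the original one, so that the two can be
    combined termwise; the term [n = 0] vanishes. *)
Lemma PS_dcoef_correct (a : nat -> C) (z : C) : entire a ->
  Cis_series (fun n => a n * (RtoC (INR n) * z ^ pred n))%C (PS (dcoef a) z).
Proof.
  intros Ha. assert (Hs := PS_correct _ z (entire_dcoef _ Ha)).
  replace (PS (dcoef a) z) with (a 0%nat * (RtoC (INR 0) * z ^ pred 0) + PS (dcoef a) z)%C
    by (simpl INR; ring).
  apply Cis_series_decr_1. eapply Cis_series_ext; [|apply Hs].
  intros n. unfold dcoef. simpl pred. ring.
Qed.

(** The second order Taylor remainder of [z ^ n], with [n <= 2 ^ n] used to
    absorb the polynomial factor into the geometric one. *)
Lemma pow_quad_bound (z h : C) (r : R) (n : nat) :
  1 <= r -> Cmod z <= r -> Cmod (z + h)%C <= r ->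
  Cmod ((z + h) ^ n - z ^ n - h * (RtoC (INR n) * z ^ pred n))%C <= Cmod h ^ 2 * (2 * r) ^ n.
Proof.
  intros Hr Hz Hzh. induction n as [|n IH].
  - simpl. replace (1 - 1 - h * (0 * 1))%C with (RtoC 0) by ring. rewrite Cmod_0.
    generalize (pow2_ge_0 (Cmod h)). simpl. lra.
  - replace ((z + h) ^ S n - z ^ S n - h * (RtoC (INR (S n)) * z ^ pred (S n)))%C with
      ((z + h) * ((z + h) ^ n - z ^ n - h * (RtoC (INR n) * z ^ pred n)) + h * h * (RtoC (INR n) * z ^ pred
        n))%C.
    2: { rewrite S_INR, RtoC_plus. destruct n as [|n]; simpl; ring. }
    eapply Rle_trans; [apply Cmod_triangle|]. rewrite !Cmod_mult, Cmod_R, Cmod_pow.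
    rewrite (Rabs_pos_eq (INR n)) by apply pos_INR.
    set (D := Cmod ((z + h) ^ n - z ^ n - h * (RtoC (INR n) * z ^ pred n))%C) in *.
    assert (Hp : Cmod z ^ pred n <= r ^ n).
    { apply Rle_trans with (r ^ pred n).
      - apply pow_incr. split; auto. apply Cmod_ge_0.
      - apply Rle_pow; auto. lia. }
    assert (0 <= Cmod z ^ pred n) by (apply pow_le, Cmod_ge_0).
    assert (H2 : INR n * Cmod z ^ pred n <= (2 * r) ^ n).
    { rewrite Rpow_mult_distr. apply Rmult_le_compat; auto; [apply pos_INR|apply INR_le_pow2]. }
    assert (0 <= Cmod h ^ 2) by apply pow2_ge_0.
    assert (0 <= (2 * r) ^ n) by (apply pow_le; lra).
    assert (0 <= D) by apply Cmod_ge_0.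
    apply Rle_trans with (r * (Cmod h ^ 2 * (2 * r) ^ n) + Cmod h ^ 2 * (2 * r) ^ n).
    + apply Rplus_le_compat.
      * apply Rmult_le_compat; auto; [apply Cmod_ge_0].
      * replace (Cmod h * Cmod h) with (Cmod h ^ 2) by ring. apply Rmult_le_compat_l; auto.
    + simpl ((2 * r) ^ S n). assert (0 <= Cmod h ^ 2 * (2 * r) ^ n) by now apply Rmult_le_pos. nra.
Qed.

Lemma Cderive_PS (a : nat -> C) (z : C) : entire a -> Cderive (PS a) z (PS (dcoef a) z).
Proof.
  intros Ha. set (r := Cmod z + 1).
  assert (Hr : 1 <= r) by (unfold r; generalize (Cmod_ge_0 z); lra).
  apply (Cderive_quad _ _ _ (Series (fun n => Cmod (a n) * (2 * r) ^ n)) 1); [lra|].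
  intros h Hh.
  assert (Hd := PS_dcoef_correct a z Ha).
  assert (Hzh : Cmod (z + h)%C <= r) by (unfold r; generalize (Cmod_triangle z h); lra).
  generalize (Cis_series_minus _ _ _ _ (Cis_series_minus _ _ _ _ (PS_correct a (z + h)%C Ha) (PS_correct a
    z Ha))
    (Cis_series_scal _ _ h Hd)). intros HS.
  apply (Cis_series_bound _ _ (fun n => Cmod (a n) * (2 * r) ^ n * Cmod h ^ 2) _ HS).
  - intros n. cbv beta.
    replace (a n * (z + h) ^ n - a n * z ^ n - h * (a n * (RtoC (INR n) * z ^ pred n)))%C
      with (a n * ((z + h) ^ n - z ^ n - h * (RtoC (INR n) * z ^ pred n)))%C by ring.
    rewrite Cmod_mult. rewrite Rmult_assoc. apply Rmult_le_compat_l; [apply Cmod_ge_0|].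
    rewrite (Rmult_comm ((2 * r) ^ n)). apply pow_quad_bound; auto. unfold r; lra.
  - apply is_series_scal_r. apply Series_correct. apply Ha. lra.
Qed.

Lemma entire_ratio (a : nat -> C) (rho : nat -> R) :
  (forall n, Cmod (a (S n)) <= rho n * Cmod (a n)) -> is_lim_seq rho 0 -> entire a.
Proof.
  intros H Hrho r Hr. apply is_lim_seq_spec in Hrho.
  assert (He : 0 < / (2 * r)) by (apply Rinv_0_lt_compat; lra).
  destruct (Hrho (mkposreal _ He)) as [N HN]. simpl in HN.
  apply (ex_series_incr_n (fun n => Cmod (a n) * r ^ n) N).
  apply ex_series_le_pos with (fun n => Cmod (a N) * r ^ N * (1 / 2) ^ n).
  2: { apply ex_series_geo. lra. }
  intros n. split; [apply Rmult_le_pos; [apply Cmod_ge_0|apply pow_le; lra]|].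
  induction n as [|n IH].
  - rewrite Nat.add_0_r. simpl. lra.
  - rewrite Nat.add_succ_r. simpl.
    assert (Hn : rho (N + n)%nat <= / (2 * r)).
    { specialize (HN (N + n)%nat ltac:(lia)). rewrite Rminus_0_r in HN.
      generalize (Rle_abs (rho (N + n)%nat)). lra. }
    specialize (H (N + n)%nat).
    assert (0 <= r ^ (N + n)) by (apply pow_le; lra).
    assert (Ha0 := Cmod_ge_0 (a (N + n)%nat)).
    assert (H1 : Cmod (a (S (N + n))) * r <= 1 / 2 * Cmod (a (N + n)%nat)).
    { apply Rle_trans with (rho (N + n)%nat * Cmod (a (N + n)%nat) * r).
      - apply Rmult_le_compat_r; lra.
      - apply Rle_trans with (/ (2 * r) * Cmod (a (N + n)%nat) * r).
        + apply Rmult_le_compat_r; [lra|]. now apply Rmult_le_compat_r.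
        + right. field. lra. }
    nra.
Qed.

(** * The complex exponential *)

Lemma Cexp_plus (z w : C) : Cexp (z + w)%C = (Cexp z * Cexp w)%C.
Proof.
  unfold Cexp. destruct z as [a b], w as [c d]. simpl.
  rewrite exp_plus, cos_plus, sin_plus. unfold Cmult. simpl. f_equal; ring.
Qed.

Lemma Cexp_0 : Cexp 0 = 1%C.
Proof. unfold Cexp. simpl. rewrite exp_0, cos_0, sin_0. unfold RtoC. f_equal; ring. Qed.

Lemma Cmod_Cexp (z : C) : Cmod (Cexp z) = exp (Re z).
Proof.
  assert (H : Cmod (Cexp z) ^ 2 = exp (Re z) ^ 2).
  { rewrite Cmod2_alt. unfold Cexp. simpl.
    generalize (sin2_cos2 (Im z)). unfold Rsqr. intros E.
    transitivity (exp (Re z) * exp (Re z) * (sin (Im z) * sin (Im z) + cos (Im z) * cos (Im z))); [ring|].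
    rewrite E. ring. }
  generalize (Cmod_ge_0 (Cexp z)) (exp_pos (Re z)). nra.
Qed.

Lemma Cexp_neq_0 (z : C) : Cexp z <> 0%C.
Proof. apply Cmod_gt_0. rewrite Cmod_Cexp. apply exp_pos. Qed.

Lemma Cexp_opp (z : C) : Cexp (- z)%C = (/ Cexp z)%C.
Proof.
  assert (H : (Cexp (- z) * Cexp z)%C = 1%C).
  { rewrite <- Cexp_plus. replace (- z + z)%C with (RtoC 0) by ring. apply Cexp_0. }
  assert (N := Cexp_neq_0 z).
  replace (Cexp (- z)) with (Cexp (- z) * Cexp z * / Cexp z)%C by (field; exact N).
  rewrite H. ring.
Qed.

Lemma Cexp_RtoC (x : R) : Cexp (RtoC x) = RtoC (exp x).
Proof. unfold Cexp, RtoC. simpl. rewrite cos_0, sin_0. f_equal; ring. Qed.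

Lemma Cexp_INR (n : nat) (z : C) : Cexp (RtoC (INR n) * z)%C = (Cexp z ^ n)%C.
Proof.
  induction n as [|n IH].
  - simpl. replace (0 * z)%C with (RtoC 0) by ring. apply Cexp_0.
  - rewrite S_INR, RtoC_plus. simpl. rewrite <- IH, <- Cexp_plus. f_equal. ring.
Qed.

Definition expcoef (n : nat) : C := RtoC (/ INR (fact n)).

Lemma expcoef_S n : (RtoC (INR (S n)) * expcoef (S n))%C = expcoef n.
Proof.
  unfold expcoef. rewrite <- RtoC_mult. f_equal. rewrite fact_simpl, mult_INR.
  field. split; [apply INR_fact_neq_0|now apply not_0_INR].
Qed.

Lemma is_lim_seq_inv_S : is_lim_seq (fun n => / INR (S n)) 0.
Proof.
  apply (is_lim_seq_incr_1 (fun n => / INR n)).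
  replace (Finite 0) with (Rbar_inv p_infty) by reflexivity.
  apply is_lim_seq_inv; [apply is_lim_seq_INR|discriminate].
Qed.

Lemma entire_expcoef : entire expcoef.
Proof.
  apply entire_ratio with (fun n => / INR (S n)); [|apply is_lim_seq_inv_S].
  intros n. rewrite <- (expcoef_S n), Cmod_mult, Cmod_R.
  assert (H : 0 < INR (S n)) by (apply lt_0_INR; lia).
  rewrite Rabs_pos_eq by lra. right. field. lra.
Qed.

Lemma PS_0 (a : nat -> C) : PS a 0 = a 0%nat.
Proof.
  unfold PS. apply CSeries_unique. rewrite is_series_Clim.
  apply Clim_ext with (fun _ => a 0%nat); [|apply Clim_const].
  induction n as [|n IH]; [rewrite Csum_O; simpl; ring|].
  rewrite Csum_S, <- IH. simpl. ring.
Qed.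

Lemma Cderive_PS_exp (z : C) : Cderive (PS expcoef) z (PS expcoef z).
Proof.
  eapply Cderive_eq; [apply Cderive_PS, entire_expcoef|].
  apply CSeries_ext. intros n. unfold dcoef. now rewrite expcoef_S.
Qed.

Lemma Cexp_line_derive (z : C) (t : R) :
  Rderive (fun x => Cexp (RtoC x * z)%C) t (z * Cexp (RtoC t * z))%C.
Proof.
  destruct z as [a b]. split.
  - eapply is_derive_ext with (f := fun x => exp (x * a) * cos (x * b)).
    { intros x. unfold Cexp. simpl. f_equal; [f_equal; ring|]. f_equal; ring. }
    unfold Cexp; simpl. auto_derive; auto.
    replace (t * a - 0 * b) with (t * a) by ring. replace (t * b + 0 * a) with (t * b) by ring. ring.
  - eapply is_derive_ext with (f := fun x => exp (x * a) * sin (x * b)).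
    { intros x. unfold Cexp. simpl. f_equal; [f_equal; ring|]. f_equal; ring. }
    unfold Cexp; simpl. auto_derive; auto.
    replace (t * a - 0 * b) with (t * a) by ring. replace (t * b + 0 * a) with (t * b) by ring. ring.
Qed.

Lemma PSexp_line_derive (z : C) (t : R) :
  Rderive (fun x => PS expcoef (RtoC x * z)%C) t (z * PS expcoef (RtoC t * z))%C.
Proof.
  apply Rderive_ext with (fun x => PS expcoef (0 + RtoC x * z)%C).
  { intros x. f_equal. ring. }
  replace (RtoC t * z)%C with (0 + RtoC t * z)%C by ring.
  apply Rderive_line, Cderive_PS_exp.
Qed.

(** The product [f (t z) * g (- t z)] has zero derivative in [t]. *)
Lemma exp_like_inverse (f g : C -> C) (z : C) :
  f 0 = 1%C -> g 0 = 1%C ->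
  (forall z t, Rderive (fun x => f (RtoC x * z)%C) t (z * f (RtoC t * z)%C)%C) ->
  (forall z t, Rderive (fun x => g (RtoC x * z)%C) t (z * g (RtoC t * z)%C)%C) ->
  (f z * g (- z) = 1)%C.
Proof.
  intros F0 G0 HF HG.
  assert (H := Rderive_zero_const (fun x => f (RtoC x * z) * g (RtoC x * (- z)))%C 0 1 ltac:(lra)).
  cbv beta in H. replace (RtoC 1 * z)%C with z in H by ring. replace (RtoC 1 * - z)%C with (-z)%C in H
    by ring.
  rewrite H.
  - replace (RtoC 0 * z)%C with (RtoC 0) by ring. replace (RtoC 0 * - z)%C with (RtoC 0) by ring.
    rewrite F0, G0. ring.
  - intros t _. eapply Rderive_eq; [apply Rderive_mult; [apply HF|apply HG]|]. cbv beta. ring.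
Qed.

(** Both functions satisfy [y' = y] and take the value 1 at 0. *)
Lemma PS_exp (z : C) : PS expcoef z = Cexp z.
Proof.
  assert (E0 : PS expcoef 0 = 1%C).
  { rewrite PS_0. unfold expcoef. simpl. f_equal. apply Rinv_1. }
  assert (H1 := exp_like_inverse (PS expcoef) Cexp z E0 Cexp_0 PSexp_line_derive Cexp_line_derive).
  rewrite Cexp_opp in H1. assert (N := Cexp_neq_0 z).
  replace (PS expcoef z) with (PS expcoef z * / Cexp z * Cexp z)%C by (field; exact N).
  rewrite H1. ring.
Qed.

Lemma Cderive_Cexp (z : C) : Cderive Cexp z (Cexp z).
Proof.
  rewrite <- PS_exp. eapply Cderive_ext; [apply PS_exp|apply Cderive_PS_exp].
Qed.

Lemma Cderive_exp_scal (a z : C) : Cderive (fun x => Cexp (a * x)%C) z (a * Cexp (a * z))%C.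
Proof.
  apply (Cderive_comp Cexp (fun x => (a * x)%C)); [apply Cderive_Cexp|].
  eapply Cderive_eq; [apply Cderive_scal, Cderive_id|]. ring.
Qed.

(** * The incomplete Gamma function *)

Lemma Rderive_comp (f : R -> C) (g : R -> R) (t : R) (l : C) (m : R) :
  Rderive f (g t) l -> is_derive g t m -> Rderive (fun x => f (g x)) t (RtoC m * l)%C.
Proof.
  intros [F1 F2] Hg. split.
  - rewrite re_scal_l. exact (is_derive_comp (V := RN) (fun x => Re (f x)) g t _ _ F1 Hg).
  - rewrite im_scal_l. exact (is_derive_comp (V := RN) (fun x => Im (f x)) g t _ _ F2 Hg).
Qed.

Lemma exp_le (x y : R) : x <= y -> exp x <= exp y.
Proof. intros [H| ->]; [left; now apply exp_increasing|lra]. Qed.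

(** One term of the exponential series; by induction, since differentiating
    the difference lowers [n]. *)
Lemma exp_ge_monomial (x : R) (n : nat) : 0 <= x -> x ^ n / INR (fact n) <= exp x.
Proof.
  intros Hx. revert x Hx. induction n as [|n IH]; intros x Hx.
  - simpl. generalize (exp_ineq1_le x). lra.
  - assert (Hf : INR (fact (S n)) <> 0) by apply INR_fact_neq_0.
    assert (K : (exp 0 - 0 ^ S n / INR (fact (S n))) <= (exp x - x ^ S n / INR (fact (S n)))).
    { apply (nondecreasing_MVT (fun x => exp x - x ^ S n / INR (fact (S n)))
               (fun x => exp x - x ^ n / INR (fact n))); auto.
      - intros t Ht.
        replace (t ^ n / INR (fact n)) with (INR (S n) * t ^ n / INR (fact (S n))).
        2: { rewrite fact_simpl, mult_INR. field. split; [apply INR_fact_neq_0|now apply not_0_INR]. }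
        generalize (INR (fact (S n))). intros c. auto_derive; auto. simpl pred.
        change (match n with O => 1 | S _ => INR n + 1 end) with (INR (S n)). unfold Rdiv. ring.
      - intros t Ht. specialize (IH t ltac:(lra)). lra. }
    rewrite exp_0, pow_ne_zero in K by lia. unfold Rdiv in K at 1. lra.
Qed.

Lemma pow_exp_le (t c : R) (n : nat) : 0 <= t -> 0 < c -> t ^ n * exp (- (t * c)) <= INR (fact n) / c ^ n.
Proof.
  intros Ht Hc. assert (H := exp_ge_monomial (t * c) n ltac:(nra)).
  rewrite exp_Ropp. assert (He := exp_pos (t * c)). assert (Hf := INR_fact_lt_0 n).
  assert (Hcn : 0 < c ^ n) by now apply pow_lt.
  rewrite Rpow_mult_distr in H.
  apply (Rmult_le_reg_r (exp (t * c))); auto. rewrite Rmult_assoc, Rinv_l, Rmult_1_r by lra.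
  apply (Rmult_le_compat_l (INR (fact n) / c ^ n)) in H.
  2: { left. now apply Rdiv_lt_0_compat. }
  eapply Rle_trans; [|apply H]. right. field. lra.
Qed.

(** With [t = exp z], this is [t ^ s * exp (- t)], the Gamma integrand with
    respect to [dt / t]. *)
Definition gker (s z : C) : C := (Cexp (s * z) * Cexp (- Cexp z))%C.

Definition pcoef (s : C) (n : nat) : C := (expcoef n * (- (1)) ^ n / (s + RtoC (INR n)))%C.

(** The lower incomplete Gamma function at [t = exp z], integrated termwise:
    [sum_n (- 1) ^ n t ^ (s + n) / (n! (s + n))]. It is a primitive of [gker s]
    on the whole plane of logarithms, so its increments stand for contour
    integrals. *)
Definition lower_gamma (s z : C) : C := (Cexp (s * z) * PS (pcoef s) (Cexp z))%C.

Lemma Re_plus_INR (s : C) (n : nat) : Re (s + RtoC (INR n))%C = Re s + INR n.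
Proof. now rewrite re_plus, re_RtoC. Qed.

Lemma Re_pos_neq_0 (s : C) : 0 < Re s -> s <> 0%C.
Proof. intros H E. rewrite E in H. simpl in H. lra. Qed.

Lemma plus_INR_neq_0 (s : C) (n : nat) : 0 < Re s -> (s + RtoC (INR n))%C <> 0%C.
Proof.
  intros H. apply Re_pos_neq_0. rewrite Re_plus_INR. generalize (pos_INR n). lra.
Qed.

Lemma Re_le_Cmod (c : C) : Re c <= Cmod c.
Proof. generalize (re_le_Cmod c) (Rle_abs (Re c)). lra. Qed.

Lemma entire_pcoef (s : C) : 0 < Re s -> entire (pcoef s).
Proof.
  intros Hs r Hr.
  apply ex_series_le_pos with (fun n => / Re s * (Cmod (expcoef n) * r ^ n)).
  2: { apply (ex_series_scal (V := RN)). now apply entire_expcoef. }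
  intros n. assert (0 <= r ^ n) by (apply pow_le; lra).
  split; [apply Rmult_le_pos; auto; apply Cmod_ge_0|].
  rewrite <- Rmult_assoc. apply Rmult_le_compat_r; auto.
  assert (N := plus_INR_neq_0 s n Hs).
  unfold pcoef. rewrite Cmod_div, Cmod_mult, Cmod_pow, Cmod_opp, Cmod_1, pow1, Rmult_1_r by auto.
  unfold Rdiv. rewrite Rmult_comm. apply Rmult_le_compat_r; [apply Cmod_ge_0|].
  apply Rinv_le_contravar; auto.
  eapply Rle_trans; [|apply Re_le_Cmod]. rewrite Re_plus_INR. generalize (pos_INR n). lra.
Qed.

(** The factors [s + n] produced by differentiation cancel the denominators
    and leave the exponential series at [- t]. *)
Lemma Cderive_lower_gamma (s z : C) : 0 < Re s -> Cderive (lower_gamma s) z (gker s z).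
Proof.
  intros Hs. assert (He := entire_pcoef s Hs).
  assert (D1 := Cderive_exp_scal s z).
  assert (D2 : Cderive (fun z => PS (pcoef s) (Cexp z)) z (Cexp z * PS (dcoef (pcoef s)) (Cexp z))%C).
  { apply (Cderive_comp (PS (pcoef s)) Cexp); [now apply Cderive_PS|apply Cderive_Cexp]. }
  eapply Cderive_eq; [apply (Cderive_mult _ _ _ _ _ D1 D2)|].
  unfold gker. rewrite <- (PS_exp (- Cexp z)%C).
  set (t := Cexp z). set (e := Cexp (s * z)).
  replace (PS expcoef (- t)) with (s * PS (pcoef s) t + t * PS (dcoef (pcoef s)) t)%C.
  { ring. }
  apply Cis_series_unique with (fun n => expcoef n * (- t) ^ n)%C.
  2: { apply PS_correct, entire_expcoef. }
  apply Cis_series_ext with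
    (fun n => s * (pcoef s n * t ^ n) + t * (pcoef s n * (RtoC (INR n) * t ^ pred n)))%C.
  - intros n.
    replace (- t)%C with (- (1) * t)%C by ring. rewrite Cpow_mult_l. unfold pcoef.
    assert (N := plus_INR_neq_0 s n Hs).
    destruct n as [|n].
    + simpl. field. now apply Re_pos_neq_0.
    + simpl pred. rewrite (Cpow_S t). set (p := ((- (1)) ^ S n)%C). set (k := RtoC (INR (S n))) in *.
      field. exact N.
  - apply Cis_series_plus.
    + apply Cis_series_scal. now apply PS_correct.
    + apply Cis_series_scal. now apply PS_dcoef_correct.
Qed.

Lemma Rderive_lower_gamma (s w : C) (t : R) : 0 < Re s ->
  Rderive (fun u => lower_gamma s (RtoC u + w)%C) t (gker s (RtoC t + w)%C).
Proof.
  intros Hs. apply Rderive_ext with (fun u => lower_gamma s (w + RtoC u * 1)%C).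
  { intros x. f_equal. ring. }
  eapply Rderive_eq; [apply Rderive_line, Cderive_lower_gamma, Hs|].
  replace (w + RtoC t * 1)%C with (RtoC t + w)%C by ring. ring.
Qed.

(** The logarithm of the point of modulus [exp u] and argument [th]. *)
Definition logpt (u th : R) : C := (u, th).

Lemma logpt_eq (u th : R) : logpt u th = (RtoC u + (0, th))%C.
Proof. unfold logpt, RtoC, Cplus. simpl. f_equal; ring. Qed.

Lemma Cmod_Cexp_mult (s : C) (u th : R) : Cmod (Cexp (s * logpt u th)%C) = exp (Re s * u) * exp (- (th * Im
  s)).
Proof.
  rewrite Cmod_Cexp, <- exp_plus. f_equal. destruct s as [a b]. simpl. ring.
Qed.

Lemma Cmod_gker (s : C) (u th : R) :
  Cmod (gker s (logpt u th)) = exp (- (th * Im s)) * (exp (Re s * u) * exp (- (exp u * cos th))).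
Proof.
  unfold gker. rewrite Cmod_mult, Cmod_Cexp_mult, Cmod_Cexp.
  unfold Cexp at 1. simpl. ring.
Qed.

(** Good for [u] near [- infinity]: the exponential factor is at most 1 in the
    right half-plane. *)
Lemma gker_bound_neg (s : C) (u th : R) : 0 <= cos th ->
  Cmod (gker s (logpt u th)) <= exp (- (th * Im s)) * exp (Re s * u).
Proof.
  intros Hc. rewrite Cmod_gker. apply Rmult_le_compat_l; [left; apply exp_pos|].
  rewrite <- (Rmult_1_r (exp (Re s * u))) at 2. apply Rmult_le_compat_l; [left; apply exp_pos|].
  rewrite <- exp_0. apply exp_le. generalize (exp_pos u). nra.
Qed.

Lemma exp_mult_INR (n : nat) (u : R) : exp (INR n * u) = exp u ^ n.
Proof.
  induction n as [|n IH]; [simpl; rewrite Rmult_0_l; apply exp_0|].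
  rewrite S_INR. simpl. rewrite <- IH, <- exp_plus. f_equal. ring.
Qed.

(** With [t = exp u], a power [t ^ n] with [n >= sg + 1] is still beaten by
    [exp (- t c)], leaving the spare factor [1 / t]. *)
Lemma exp_decay_bound (sg u c : R) (n : nat) : 0 <= u -> 0 < c -> sg + 1 <= INR n ->
  exp (sg * u) * exp (- (exp u * c)) <= INR (fact n) / c ^ n * exp (- u).
Proof.
  intros Hu Hc Hn.
  assert (H1 : exp (sg * u) <= exp u ^ n * exp (- u)).
  { rewrite <- exp_mult_INR, <- exp_plus. apply exp_le. nra. }
  assert (H := pow_exp_le (exp u) c n ltac:(left; apply exp_pos) Hc).
  assert (E1 := exp_pos (- (exp u * c))). assert (E2 := exp_pos (- u)).
  apply Rle_trans with (exp u ^ n * exp (- u) * exp (- (exp u * c))).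
  - apply Rmult_le_compat_r; lra.
  - replace (exp u ^ n * exp (- u) * exp (- (exp u * c))) with (exp u ^ n * exp (- (exp u * c)) * exp (-
    u)) by ring.
    apply Rmult_le_compat_r; lra.
Qed.

Lemma gker_bound_pos (s : C) (u th c : R) (n : nat) : 0 <= u -> 0 < c <= cos th -> Re s + 1 <= INR n ->
  Cmod (gker s (logpt u th)) <= exp (- (th * Im s)) * (INR (fact n) / c ^ n * exp (- u)).
Proof.
  intros Hu Hc Hn. rewrite Cmod_gker. apply Rmult_le_compat_l; [left; apply exp_pos|].
  eapply Rle_trans; [|apply (exp_decay_bound (Re s) u c n); auto; lra].
  apply Rmult_le_compat_l; [left; apply exp_pos|]. apply exp_le. generalize (exp_pos u). nra.
Qed.

Lemma lower_gamma_increment_pos (s : C) (a b th : R) (n : nat) :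
  0 < Re s -> 0 <= a <= b -> 0 < cos th -> Re s + 1 <= INR n ->
  Cmod (lower_gamma s (logpt b th) - lower_gamma s (logpt a th))%C <=
    exp (- (th * Im s)) * (INR (fact n) / cos th ^ n) * (exp (- a) - exp (- b)).
Proof.
  intros Hs Hab Hc Hn. set (K := exp (- (th * Im s)) * (INR (fact n) / cos th ^ n)).
  replace (K * (exp (- a) - exp (- b))) with ((- (K * exp (- b))) - (- (K * exp (- a)))) by ring.
  rewrite (logpt_eq a), (logpt_eq b).
  apply (mean_value_inequality (fun u => lower_gamma s (RtoC u + (0, th))%C) (fun u => gker s (RtoC u + (0,
    th))%C)
    (fun u => - (K * exp (- u))) (fun u => K * exp (- u))); [lra| | |].
  - intros t _. now apply Rderive_lower_gamma.
  - intros t _. auto_derive; auto. ring.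
  - intros t Ht. rewrite <- logpt_eq. unfold K. rewrite Rmult_assoc. apply gker_bound_pos; auto; lra.
Qed.

Lemma lower_gamma_increment_neg (s : C) (a b th : R) :
  0 < Re s -> a <= b -> 0 <= cos th ->
  Cmod (lower_gamma s (logpt b th) - lower_gamma s (logpt a th))%C <=
    exp (- (th * Im s)) / Re s * (exp (Re s * b) - exp (Re s * a)).
Proof.
  intros Hs Hab Hc. set (K := exp (- (th * Im s)) / Re s).
  replace (K * (exp (Re s * b) - exp (Re s * a))) with (K * exp (Re s * b) - K * exp (Re s * a)) by ring.
  rewrite (logpt_eq a), (logpt_eq b).
  apply (mean_value_inequality (fun u => lower_gamma s (RtoC u + (0, th))%C) (fun u => gker s (RtoC u + (0,
    th))%C)
    (fun u => K * exp (Re s * u)) (fun u => exp (- (th * Im s)) * exp (Re s * u))); [lra| | |].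
  - intros t _. now apply Rderive_lower_gamma.
  - intros t _. auto_derive; auto. unfold K. field. lra.
  - intros t Ht. rewrite <- logpt_eq. now apply gker_bound_neg.
Qed.

(** Gamma on the right half-plane, as the value at infinity of its primitive;
    [Gamma_int_eq] identifies it with the integral. *)
Definition Gam (s : C) : C := CLim_seq (fun n => lower_gamma s (logpt (INR n) 0)).

Lemma is_lim_exp_neg (c : R) : 0 < c -> is_lim_seq (fun n => exp (- (c * INR n))) 0.
Proof.
  intros Hc.
  assert (Hk : Rabs (exp (- c)) < 1).
  { rewrite Rabs_pos_eq by (left; apply exp_pos). rewrite <- exp_0. apply exp_increasing. lra. }
  apply is_lim_seq_ext with (2 := is_lim_seq_geom _ Hk).
  intros n. rewrite <- exp_mult_INR. f_equal. ring.
Qed.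

Lemma nat_above (x : R) : exists n : nat, x <= INR n.
Proof.
  destruct (nfloor_ex (Rabs x) (Rabs_pos x)) as [n Hn]. exists (S n).
  rewrite S_INR. generalize (Rle_abs x). lra.
Qed.

Lemma Gam_lim0 (s : C) : 0 < Re s -> Clim (fun n => lower_gamma s (logpt (INR n) 0)) (Gam s).
Proof.
  intros Hs. destruct (nat_above (Re s + 1)) as [N HN].
  set (u := fun n => lower_gamma s (logpt (INR n) 0)).
  assert (Hb : forall n, Cmod (u (S n) - u n)%C <= INR (fact N) * exp (-1) ^ n).
  { intros n. unfold u. eapply Rle_trans; [apply (lower_gamma_increment_pos s (INR n) (INR (S n)) 0 N);
    auto|].
    - split; [apply pos_INR|apply le_INR; lia].
    - rewrite cos_0. lra.
    - rewrite cos_0, pow1, Rmult_0_l, Ropp_0, exp_0.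
      replace (1 * (INR (fact N) / 1)) with (INR (fact N)) by field.
      apply Rmult_le_compat_l; [apply pos_INR|].
      rewrite <- exp_mult_INR. replace (INR n * -1) with (- INR n) by ring.
      generalize (exp_pos (- INR (S n))). lra. }
  assert (Hex : Cabs_conv (fun n => u (S n) - u n)%C).
  { apply Cabs_conv_le with (1 := Hb). apply ex_series_geo.
    split; [left; apply exp_pos|]. rewrite <- exp_0. apply exp_increasing. lra. }
  apply CSeries_correct in Hex. rewrite is_series_Clim in Hex.
  assert (HS : forall n, Csum (fun n => u (S n) - u n)%C n = (u (S n) - u 0%nat)%C).
  { induction n as [|n IH]; [now rewrite Csum_O|]. rewrite Csum_S, IH. ring. }
  assert (HL : Clim u (CSeries (fun n => u (S n) - u n)%C + u 0%nat)%C).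
  { apply Clim_incr_1. eapply Clim_ext; [|apply (Clim_plus _ _ _ _ Hex (Clim_const (u 0%nat)))].
    intros n. cbv beta. rewrite HS. ring. }
  unfold Gam. fold u. now rewrite (CLim_seq_unique _ _ HL).
Qed.

Lemma cos_le_abs (t th : R) : Rabs t <= Rabs th -> Rabs th < PI / 2 -> cos th <= cos t.
Proof.
  assert (HP := PI_RGT_0).
  assert (E : forall x, cos x = cos (Rabs x)).
  { intros x. unfold Rabs. destruct (Rcase_abs x); auto. now rewrite cos_neg. }
  intros H1 H2. rewrite (E t), (E th). generalize (Rabs_pos t) (Rabs_pos th). intros.
  destruct (Req_dec (Rabs t) (Rabs th)) as [->|Hne]; [lra|].
  left. apply cos_decreasing_1; lra.
Qed.

Lemma cos_pos_abs (th : R) : Rabs th < PI / 2 -> 0 < cos th.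
Proof. intros H. apply Rabs_def2 in H. apply cos_gt_0; lra. Qed.

Lemma lower_gamma_Gam_dist0 (s : C) : 0 < Re s -> exists K, forall u, 0 <= u ->
  Cmod (lower_gamma s (logpt u 0) - Gam s)%C <= K * exp (- u).
Proof.
  intros Hs. destruct (nat_above (Re s + 1)) as [N HN].
  exists (exp (- (0 * Im s)) * (INR (fact N) / cos 0 ^ N)). set (K := exp _ * _).
  assert (HK : 0 <= K).
  { unfold K. rewrite cos_0, pow1. apply Rmult_le_pos; [left; apply exp_pos|].
    unfold Rdiv. rewrite Rinv_1, Rmult_1_r. apply pos_INR. }
  intros u Hu. destruct (nat_above u) as [M HM].
  apply (Clim_bound (fun n => lower_gamma s (logpt u 0) - lower_gamma s (logpt (INR (n + M)) 0))%C _ (fun _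
    => K * exp (- u))).
  - apply Clim_minus; [apply Clim_const|]. unfold Clim.
    apply (is_lim_seq_incr_n (fun n => Cmod (lower_gamma s (logpt (INR n) 0) - Gam s)%C) M).
      now apply Gam_lim0.
  - intros n. rewrite Cmod_minus_sym. eapply Rle_trans; [apply (lower_gamma_increment_pos s u (INR (n + M))
    0 N); auto|].
    + split; auto. rewrite plus_INR. generalize (pos_INR n). lra.
    + rewrite cos_0. lra.
    + fold K. apply Rmult_le_compat_l; auto. generalize (exp_pos (- INR (n + M))). lra.
  - apply is_lim_seq_const.
Qed.

(** Moving the end point from argument 0 to argument [th] on the circle of
    radius [exp u] changes the primitive by an exponentially small amount in
    [u]: this is the rotation of the ray of integration. *)
Lemma lower_gamma_vertical (s : C) (u th : R) (n : nat) : 0 < Re s -> 0 <= u -> Rabs th < PI / 2 ->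
  Re s + 1 <= INR n ->
  Cmod (lower_gamma s (logpt u th) - lower_gamma s (logpt u 0))%C <=
    exp (Rabs th * Rabs (Im s)) * (INR (fact n) / cos th ^ n) * Rabs th * exp (- u).
Proof.
  intros Hs Hu Hth Hn.
  set (K := exp (Rabs th * Rabs (Im s)) * (INR (fact n) / cos th ^ n * exp (- u))).
  assert (H : Cmod (lower_gamma s (logpt u th) - lower_gamma s (logpt u 0))%C <= K * Rabs th * 1 - K * Rabs
    th * 0).
  { replace (logpt u th) with (RtoC u + RtoC 1 * (0, th))%C
      by (unfold logpt, RtoC, Cplus, Cmult; simpl; f_equal; ring).
    replace (logpt u 0) with (RtoC u + RtoC 0 * (0, th))%C
      by (unfold logpt, RtoC, Cplus, Cmult; simpl; f_equal; ring).
    apply (mean_value_inequality (fun t => lower_gamma s (RtoC u + RtoC t * (0, th))%C)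
       (fun t => (0, th) * gker s (RtoC u + RtoC t * (0, th)))%C
       (fun t => K * Rabs th * t) (fun _ => K * Rabs th)); [lra| | |].
    - intros t _. apply Rderive_line. now apply Cderive_lower_gamma.
    - intros t _. auto_derive; auto. ring.
    - intros t Ht. rewrite Cmod_mult, Rmult_comm.
      assert (Et : Rabs (t * th) <= Rabs th).
      { rewrite Rabs_mult, (Rabs_pos_eq t) by lra. generalize (Rabs_pos th). nra. }
      apply Rmult_le_compat; try apply Cmod_ge_0.
      + replace (RtoC u + RtoC t * (0, th))%C with (logpt u (t * th))
          by (unfold logpt, RtoC, Cplus, Cmult; simpl; f_equal; ring).
        assert (Hc := cos_le_abs (t * th) th Et Hth). assert (Hp := cos_pos_abs th Hth).
        eapply Rle_trans; [apply (gker_bound_pos s u (t * th) (cos th) n); auto|].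
        unfold K. apply Rmult_le_compat_r.
        * apply Rmult_le_pos; [|left; apply exp_pos]. left. apply Rdiv_lt_0_compat;
          [apply INR_fact_lt_0|now apply pow_lt].
        * apply exp_le. rewrite <- Rabs_Ropp in Et.
          eapply Rle_trans; [apply Rle_abs|]. rewrite Rabs_Ropp, Rabs_mult.
          rewrite Rabs_Ropp in Et. apply Rmult_le_compat_r; auto. apply Rabs_pos.
      + eapply Rle_trans; [apply Cmod_le_abs|]. simpl. rewrite Rabs_R0. lra. }
  unfold K in H. lra.
Qed.

Lemma lower_gamma_Gam_dist (s : C) (th : R) : 0 < Re s -> Rabs th < PI / 2 -> exists K, forall u, 0 <= u ->
  Cmod (lower_gamma s (logpt u th) - Gam s)%C <= K * exp (- u).
Proof.
  intros Hs Hth. destruct (lower_gamma_Gam_dist0 s Hs) as [K HK]. destruct (nat_above (Re s + 1)) as [N HN].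
  eexists (_ + K). intros u Hu. rewrite Rmult_plus_distr_r.
  eapply Rle_trans; [apply (Cmod_triangle_minus _ (lower_gamma s (logpt u 0)))|].
  apply Rplus_le_compat; [|now apply HK].
  apply (lower_gamma_vertical s u th N); auto.
Qed.

Lemma lower_gamma_neg_bound (s : C) (th : R) : 0 < Re s -> exists K, forall u, u <= 0 ->
  Cmod (lower_gamma s (logpt u th)) <= K * exp (Re s * u).
Proof.
  intros Hs. assert (He := entire_pcoef s Hs).
  exists (exp (- (th * Im s)) * Series (fun n => Cmod (pcoef s n) * 1 ^ n)).
  intros u Hu. unfold lower_gamma. rewrite Cmod_mult, Cmod_Cexp_mult.
  rewrite (Rmult_comm (exp (Re s * u))), !Rmult_assoc. apply Rmult_le_compat_l; [left; apply exp_pos|].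
  rewrite Rmult_comm. apply Rmult_le_compat_r; [left; apply exp_pos|].
  apply CSeries_bound; [|apply He; lra].
  intros n. rewrite Cmod_mult, Cmod_pow, Cmod_Cexp. apply Rmult_le_compat_l; [apply Cmod_ge_0|].
  apply pow_incr. split; [left; apply exp_pos|]. simpl. rewrite <- exp_0. now apply exp_le.
Qed.

Lemma Clim_exp_bound (f : R -> C) (l : C) (K c a b : R) : 0 < c -> 0 < a ->
  (forall u, 0 <= u -> Cmod (f u - l)%C <= K * exp (- (c * u))) ->
  Clim (fun n => f (a * INR n + b)) l.
Proof.
  intros Hc Ha H. destruct (nat_above (- b / a)) as [N HN].
  assert (HN' : - b <= a * INR N).
  { apply (Rmult_le_compat_l a) in HN; [|lra]. replace (a * (- b / a)) with (- b) in HN by (field; lra).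
    exact HN. }
  unfold Clim. apply (is_lim_seq_incr_n _ N).
  apply (Clim_le (fun n => f (a * INR (n + N) + b)) l (fun n => (K * exp (- (c * b))) * exp (- ((c * a) *
    INR (n + N))))).
  - intros n. rewrite Rmult_assoc, <- exp_plus.
    replace (- (c * b) + - (c * a * INR (n + N))) with (- (c * (a * INR (n + N) + b))) by ring.
    apply H. rewrite plus_INR. generalize (pos_INR n). nra.
  - apply is_lim_seq_scal0. apply (is_lim_seq_incr_n (fun n => exp (- (c * a * INR n))) N).
    apply is_lim_exp_neg. nra.
Qed.

(** The limit is the same along every ray of the open right half-plane. *)
Lemma lower_gamma_lim_pos (s : C) (th a b : R) : 0 < Re s -> Rabs th < PI / 2 -> 0 < a ->
  Clim (fun n => lower_gamma s (logpt (a * INR n + b) th)) (Gam s).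
Proof.
  intros Hs Hth Ha. destruct (lower_gamma_Gam_dist s th Hs Hth) as [K HK].
  apply (Clim_exp_bound (fun u => lower_gamma s (logpt u th)) _ K 1 a b); auto; [lra|].
  intros u Hu. rewrite Rmult_1_l. now apply HK.
Qed.

Lemma lower_gamma_lim_neg (s : C) (th a b : R) : 0 < Re s -> 0 < a ->
  Clim (fun n => lower_gamma s (logpt (- (a * INR n + b)) th)) 0%C.
Proof.
  intros Hs Ha. destruct (lower_gamma_neg_bound s th Hs) as [K HK].
  apply (Clim_exp_bound (fun u => lower_gamma s (logpt (- u) th)) _ K (Re s) a b); auto.
  intros u Hu. replace (lower_gamma s (logpt (- u) th) - 0)%C with (lower_gamma s (logpt (- u) th)) by ring.
  replace (- (Re s * u)) with (Re s * - u) by ring. apply HK. lra.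
Qed.

(** The total increment of the primitive along the ray of argument [th], split
    at [u = 0]. Since [th] is free, its sign can be chosen so that the first
    factor decays exponentially in [|Im s|]. *)
Lemma Gam_bound (s : C) (th : R) (n : nat) : 0 < Re s -> Rabs th < PI / 2 -> Re s + 1 <= INR n ->
  Cmod (Gam s) <= exp (- (th * Im s)) * (/ Re s + INR (fact n) / cos th ^ n).
Proof.
  intros Hs Hth Hn. assert (Hp := cos_pos_abs th Hth).
  set (K := exp (- (th * Im s)) * (/ Re s + INR (fact n) / cos th ^ n)).
  apply (Clim_bound (fun k => lower_gamma s (logpt (1 * INR k + 0) th) - lower_gamma s (logpt (- (1 * INR k
    + 0)) th))%C _ (fun _ => K)).
  - replace (Gam s) with (Gam s - 0)%C by ring.
    apply Clim_minus; [apply lower_gamma_lim_pos; auto; lra|apply lower_gamma_lim_neg; auto; lra].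
  - intros k. rewrite Rmult_1_l, Rplus_0_r.
    eapply Rle_trans; [apply (Cmod_triangle_minus _ (lower_gamma s (logpt 0 th)))|].
    assert (H1 := lower_gamma_increment_pos s 0 (INR k) th n Hs ltac:(generalize (pos_INR k); lra) Hp Hn).
    assert (H2 := lower_gamma_increment_neg s (- INR k) 0 th Hs ltac:(generalize (pos_INR k);
      lra) ltac:(lra)).
    rewrite Ropp_0, Rmult_0_r, exp_0 in *.
    assert (E := exp_pos (- (th * Im s))).
    assert (P1 : 0 < exp (- (th * Im s)) * (INR (fact n) / cos th ^ n)).
    { apply Rmult_lt_0_compat; auto. apply Rdiv_lt_0_compat; [apply INR_fact_lt_0|now apply pow_lt]. }
    assert (P2 : 0 < exp (- (th * Im s)) / Re s) by now apply Rdiv_lt_0_compat.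
    generalize (exp_pos (- INR k)) (exp_pos (Re s * - INR k)). intros E1 E2.
    replace K with (exp (- (th * Im s)) * (INR (fact n) / cos th ^ n) + exp (- (th * Im s)) / Re s)
      by (unfold K, Rdiv; ring).
    nra.
  - apply is_lim_seq_const.
Qed.

Lemma Cderive_gker (s z : C) : Cderive (gker s) z (s * gker s z - gker (s + 1) z)%C.
Proof.
  assert (D1 := Cderive_exp_scal s z).
  assert (D2 : Cderive (fun z => Cexp (- Cexp z)%C) z (- (1) * Cexp z * Cexp (- Cexp z))%C).
  { apply (Cderive_comp Cexp (fun z => (- Cexp z)%C)); [apply Cderive_Cexp|].
    eapply Cderive_ext; [|apply Cderive_scal, Cderive_Cexp]. intros x. simpl. ring. }
  eapply Cderive_eq; [apply (Cderive_mult _ _ _ _ _ D1 D2)|].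
  unfold gker. replace ((s + 1) * z)%C with (s * z + z)%C by ring. rewrite Cexp_plus. ring.
Qed.

(** The function [s * lower_gamma s - lower_gamma (s + 1) - gker s] has zero
    derivative; its limits at both ends of the real line are compared. This is
    integration by parts. *)
Lemma Gam_S (s : C) : 0 < Re s -> Gam (s + 1)%C = (s * Gam s)%C.
Proof.
  intros Hs. assert (Hs1 : 0 < Re (s + 1)%C) by (rewrite re_plus; simpl; lra).
  assert (P2 := PI_RGT_0).
  assert (H0 : Rabs 0 < PI / 2) by (rewrite Rabs_R0; lra).
  set (f := fun u => (s * lower_gamma s (RtoC u + 0) + - (1) * lower_gamma (s + 1) (RtoC u + 0) + - (1) *
    gker s (0 + RtoC u * 1))%C).
  assert (Hf : forall n, f (1 * INR n + 0) = f (- (1 * INR n + 0))).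
  { intros n. apply Rderive_zero_const; [generalize (pos_INR n); lra|].
    intros t _. eapply Rderive_eq.
    - apply Rderive_plus; [apply Rderive_plus|]; apply Rderive_scal;
      [now apply Rderive_lower_gamma|now apply Rderive_lower_gamma|].
      apply Rderive_line, Cderive_gker.
    - cbv beta. replace (0 + RtoC t * 1)%C with (RtoC t + 0)%C by ring. ring. }
  assert (E0 : forall u, (RtoC u + 0)%C = logpt u 0) by (intros u; unfold logpt, RtoC, Cplus; simpl;
    f_equal; ring).
  assert (E1 : forall u, (0 + RtoC u * 1)%C = logpt u 0) by (intros u; rewrite <- E0; ring).
  destruct (nat_above (Re s + 1)) as [N HN].
  assert (L1 : Clim (fun n => f (1 * INR n + 0)) (s * Gam s + - (1) * Gam (s + 1) + - (1) * 0)%C).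
  { unfold f. apply Clim_plus; [apply Clim_plus|]; apply Clim_scal.
    - eapply Clim_ext; [|apply (lower_gamma_lim_pos s 0 1 0); auto; lra]. intros n. now rewrite E0.
    - eapply Clim_ext; [|apply (lower_gamma_lim_pos (s + 1)%C 0 1 0); auto; lra]. intros n. now rewrite E0.
    - apply (Clim_exp_bound (fun u => gker s (0 + RtoC u * 1)%C) 0%C (INR (fact N)) 1 1 0); try lra.
      intros u Hu. rewrite E1. replace (gker s (logpt u 0) - 0)%C with (gker s (logpt u 0)) by ring.
      eapply Rle_trans; [apply (gker_bound_pos s u 0 1 N); auto; rewrite cos_0; lra|].
      rewrite pow1, Rmult_0_l, Ropp_0, exp_0, Rmult_1_l. right. rewrite (Rmult_1_l u). field. }
  assert (L2 : Clim (fun n => f (- (1 * INR n + 0))) (s * 0 + - (1) * 0 + - (1) * 0)%C).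
  { unfold f. apply Clim_plus; [apply Clim_plus|]; apply Clim_scal.
    - eapply Clim_ext; [|apply (lower_gamma_lim_neg s 0 1 0); auto; lra]. intros n. now rewrite E0.
    - eapply Clim_ext; [|apply (lower_gamma_lim_neg (s + 1)%C 0 1 0); auto; lra]. intros n. now rewrite E0.
    - apply (Clim_exp_bound (fun u => gker s (0 + RtoC (- u) * 1)%C) 0%C 1 (Re s) 1 0); try lra.
      intros u Hu. rewrite E1. replace (gker s (logpt (- u) 0) - 0)%C with (gker s (logpt (- u) 0)) by ring.
      eapply Rle_trans; [apply (gker_bound_neg s (- u) 0); rewrite cos_0; lra|].
      rewrite Rmult_0_l, Ropp_0, exp_0. right. f_equal. f_equal. ring. }
  assert (L := Clim_unique _ _ _ L1 (Clim_ext _ _ _ (fun n => eq_sym (Hf n)) L2)).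
  replace (Gam (s + 1)) with (s * Gam s - (s * Gam s + - (1) * Gam (s + 1) + - (1) * 0))%C by ring.
  rewrite L. ring.
Qed.

(** * Euler's Gamma function *)

(** The substitution [u = ln t] between the integral of Euler and [gker]. *)
Lemma Gamma_integrand (s : C) (t : R) : 0 < t ->
  (spow (of_pos t) (s - 1) * RtoC (exp (- t)) = RtoC (/ t) * gker s (logpt (ln t) 0))%C.
Proof.
  intros Ht. unfold gker, spow, of_pos, logpt.
  assert (E1 : Cexp (ln t, 0) = RtoC t).
  { change (ln t, 0) with (RtoC (ln t)). rewrite Cexp_RtoC, exp_ln; auto. }
  rewrite E1. rewrite <- RtoC_opp, Cexp_RtoC.
  replace ((s - 1) * (ln t, 0))%C with (s * (ln t, 0) + - (ln t, 0))%C by ring.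
  rewrite Cexp_plus, Cexp_opp, E1. rewrite RtoC_inv by lra. ring.
Qed.

Lemma Rderive_lower_gamma_ln (s : C) (t : R) : 0 < Re s -> 0 < t ->
  Rderive (fun x => lower_gamma s (logpt (ln x) 0)) t (RtoC (/ t) * gker s (logpt (ln t) 0))%C.
Proof.
  intros Hs Ht. apply (Rderive_comp (fun u => lower_gamma s (logpt u 0)) ln).
  - rewrite logpt_eq. eapply Rderive_ext; [|exact (Rderive_lower_gamma s (0, 0) (ln t) Hs)]. intros x.
    cbv beta. f_equal. symmetry. apply logpt_eq.
  - apply is_derive_ln; auto.
Qed.

Lemma Rderive_integrand (s : C) (t : R) : 0 < t ->
  exists l, Rderive (fun x => RtoC (/ x) * gker s (logpt (ln x) 0))%C t l.
Proof.
  intros Ht. eexists. apply Rderive_mult.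
  - apply Rderive_real. apply (is_derive_inv (fun x => x) t 1); [apply (is_derive_id (K := RA))|lra].
  - apply (Rderive_comp (fun u => gker s (logpt u 0)) ln).
    + eapply Rderive_ext; [|apply (Rderive_line (gker s) 0 1 (ln t)), Cderive_gker].
      intros x. cbv beta. f_equal. unfold logpt, RtoC, Cplus, Cmult. simpl. f_equal; ring.
    + apply is_derive_ln; auto.
Qed.

Lemma is_RInt_Rderive (F f : R -> C) (a b : R) :
  (forall t, Rmin a b <= t <= Rmax a b -> Rderive F t (f t)) ->
  (forall t, Rmin a b <= t <= Rmax a b -> exists l, Rderive f t l) ->
  @is_RInt C_R_NormedModule f a b (F b - F a)%C.
Proof.
  intros H1 H2.
  apply (is_RInt_fct_extend_pair (U := R_NormedModule) (V := RN) f a b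
    (minus (Re (F b)) (Re (F a))) (minus (Im (F b)) (Im (F a)))).
  - apply (is_RInt_derive (V := R_CompleteNormedModule) (fun x => Re (F x)) (fun x => Re (f x))).
    + intros t Ht. apply (H1 t Ht).
    + intros t Ht. destruct (H2 t Ht) as [l [Hl _]].
      apply (@ex_derive_continuous R_AbsRing R_NormedModule). eexists. exact Hl.
  - apply (is_RInt_derive (V := R_CompleteNormedModule) (fun x => Im (F x)) (fun x => Im (f x))).
    + intros t Ht. apply (H1 t Ht).
    + intros t Ht. destruct (H2 t Ht) as [l [_ Hl]].
      apply (@ex_derive_continuous R_AbsRing R_NormedModule). eexists. exact Hl.
Qed.

Lemma Gamma_int_eq (s : C) : 0 < Re s -> Gamma_int s = Gam s.
Proof.
  intros Hs. unfold Gamma_int.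
  apply (is_RInt_gen_unique (V := C_R_CompleteNormedModule)).
  intros P [eps HP].
  assert (P2 := PI_RGT_0).
  destruct (lower_gamma_Gam_dist s 0 Hs ltac:(rewrite Rabs_R0; lra)) as [K1 HK1].
  destruct (lower_gamma_neg_bound s 0 Hs) as [K2 HK2].
  set (e := pos eps / 4). assert (He : 0 < e) by (unfold e; generalize (cond_pos eps); lra).
  (* beyond B, and before A, the primitive is within e of its limit *)
  set (B := Rmax 0 (- ln (e / (Rabs K1 + 1)))).
  set (A := Rmin 0 (ln (e / (Rabs K2 + 1)) / Re s)).
  assert (HB : forall u, B < u -> Cmod (lower_gamma s (logpt u 0) - Gam s)%C <= e).
  { intros u Hu. assert (0 <= u) by (generalize (Rmax_l 0 (- ln (e / (Rabs K1 + 1)))); fold B; lra).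
    eapply Rle_trans; [now apply HK1|].
    assert (Hp : 0 < Rabs K1 + 1) by (generalize (Rabs_pos K1); lra).
    assert (Hd : exp (- u) <= e / (Rabs K1 + 1)).
    { rewrite <- (exp_ln (e / (Rabs K1 + 1))) by now apply Rdiv_lt_0_compat.
      apply exp_le. generalize (Rmax_r 0 (- ln (e / (Rabs K1 + 1)))); fold B; lra. }
    apply Rle_trans with ((Rabs K1 + 1) * (e / (Rabs K1 + 1))).
    - generalize (Rle_abs K1) (exp_pos (- u)). intros. nra.
    - right. field. lra. }
  assert (HA : forall u, u < A -> Cmod (lower_gamma s (logpt u 0)) <= e).
  { intros u Hu. assert (u <= 0) by (generalize (Rmin_l 0 (ln (e / (Rabs K2 + 1)) / Re s)); fold A; lra).
    eapply Rle_trans; [now apply HK2|].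
    assert (Hp : 0 < Rabs K2 + 1) by (generalize (Rabs_pos K2); lra).
    assert (Hd : exp (Re s * u) <= e / (Rabs K2 + 1)).
    { rewrite <- (exp_ln (e / (Rabs K2 + 1))) by now apply Rdiv_lt_0_compat.
      apply exp_le. assert (Hu2 : u <= ln (e / (Rabs K2 + 1)) / Re s).
      { generalize (Rmin_r 0 (ln (e / (Rabs K2 + 1)) / Re s)); fold A; lra. }
      apply (Rmult_le_compat_l (Re s)) in Hu2; [|lra].
      replace (Re s * (ln (e / (Rabs K2 + 1)) / Re s)) with (ln (e / (Rabs K2 + 1))) in Hu2 by (field; lra).
      exact Hu2. }
    apply Rle_trans with ((Rabs K2 + 1) * (e / (Rabs K2 + 1))).
    - generalize (Rle_abs K2) (exp_pos (Re s * u)). intros. nra.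
    - right. field. lra. }
  exists (fun a => 0 < a < exp A) (fun b => exp B < b).
  - exists (mkposreal _ (exp_pos A)). intros y Hy Hy0. split; auto.
    change (Rabs (y - 0) < exp A) in Hy. rewrite Rminus_0_r, Rabs_pos_eq in Hy; lra.
  - exists (exp B). auto.
  - intros a b [Ha HaA] HbB.
    assert (Hb : 0 < b) by (generalize (exp_pos B); lra).
    exists (lower_gamma s (logpt (ln b) 0) - lower_gamma s (logpt (ln a) 0))%C. split.
    + apply (is_RInt_ext (V := C_R_NormedModule) (fun x => RtoC (/ x) * gker s (logpt (ln x) 0))%C).
      { intros x Hx. simpl in Hx. symmetry. apply Gamma_integrand.
        assert (0 < Rmin a b) by now apply Rmin_glb_lt. lra. }
      assert (Hm : 0 < Rmin a b) by now apply Rmin_glb_lt.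
      apply (is_RInt_Rderive (fun x => lower_gamma s (logpt (ln x) 0)) (fun x => RtoC (/ x) * gker s (logpt
        (ln x) 0))%C).
      * intros t Ht. apply Rderive_lower_gamma_ln; auto. simpl in Ht. lra.
      * intros t Ht. apply Rderive_integrand. simpl in Ht. lra.
    + apply HP. apply C_NormedModule_mixin_compat1.
      change (Cmod (lower_gamma s (logpt (ln b) 0) - lower_gamma s (logpt (ln a) 0) - Gam s)%C < eps).
      replace (lower_gamma s (logpt (ln b) 0) - lower_gamma s (logpt (ln a) 0) - Gam s)%C with
        ((lower_gamma s (logpt (ln b) 0) - Gam s) + - lower_gamma s (logpt (ln a) 0))%C by ring.
      eapply Rle_lt_trans; [apply Cmod_triangle|]. rewrite Cmod_opp.
      assert (Hlb : B < ln b).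
      { rewrite <- (ln_exp B). apply ln_increasing; auto. apply exp_pos. }
      assert (Hla : ln a < A).
      { rewrite <- (ln_exp A). apply ln_increasing; auto. }
      specialize (HB _ Hlb). specialize (HA _ Hla). unfold e in *.
      generalize (cond_pos eps). lra.
Qed.

Definition nonpole (z : C) : Prop := forall n : nat, (z + RtoC (INR n))%C <> 0%C.

Lemma nonpole_pos (z : C) : 0 < Re z -> nonpole z.
Proof. intros H n. now apply plus_INR_neq_0. Qed.

Lemma nonpole_S (z : C) : nonpole z -> nonpole (z + 1)%C.
Proof.
  intros H n. replace (z + 1 + RtoC (INR n))%C with (z + RtoC (INR (S n)))%C
    by (rewrite S_INR, RtoC_plus; ring). apply H.
Qed.

Lemma poch_S (z : C) (n : nat) : poch z (S n) = (poch z n * (z + RtoC (INR n)))%C.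
Proof. reflexivity. Qed.

Lemma poch_S_l (z : C) (n : nat) : poch z (S n) = (z * poch (z + 1) n)%C.
Proof.
  induction n as [|n IH].
  - unfold poch. simpl. ring.
  - rewrite poch_S, IH, poch_S, S_INR, RtoC_plus. ring.
Qed.

Lemma poch_neq_0 (z : C) (n : nat) : nonpole z -> poch z n <> 0%C.
Proof.
  intros H. induction n as [|n IH]; [apply C1_nz|].
  rewrite poch_S. apply Cmult_neq_0; auto.
Qed.

(** The value does not depend on how many steps [n] are taken into the right
    half-plane, whereas the definition of [Gamma] takes the least [n]. *)
Lemma Gamma_Gam (z : C) (n : nat) : nonpole z -> 0 < Re z + INR n ->
  Gamma z = (Gam (z + RtoC (INR n)) / poch z n)%C.
Proof.
  intros Hz Hn. unfold Gamma. set (n0 := Z.to_nat (up (- Re z))).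
  assert (U := archimed (- Re z)).
  assert (H0 : 0 < Re z + INR n0).
  { unfold n0. rewrite INR_IZR_INZ. destruct (Z_le_gt_dec 0 (up (- Re z))) as [H|H].
    - rewrite Z2Nat.id by exact H. lra.
    - replace (Z.to_nat (up (- Re z))) with 0%nat by (destruct (up (- Re z)); simpl; lia).
      simpl. apply Z.gt_lt, IZR_lt in H. lra. }
  assert (Hle : (n0 <= n)%nat).
  { unfold n0. assert (HZ : (up (- Re z) < Z.of_nat n + 1)%Z).
    { apply lt_IZR. rewrite plus_IZR, <- INR_IZR_INZ. lra. }
    lia. }
  rewrite Gamma_int_eq by (rewrite Re_plus_INR; exact H0).
  clear Hn. induction Hle as [|n Hle IH]; [reflexivity|].
  rewrite IH, poch_S.
  assert (Hp : 0 < Re (z + RtoC (INR n))%C).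
  { rewrite Re_plus_INR. apply le_INR in Hle. lra. }
  replace (z + RtoC (INR (S n)))%C with (z + RtoC (INR n) + 1)%C by (rewrite S_INR, RtoC_plus; ring).
  rewrite Gam_S by exact Hp. assert (N1 := poch_neq_0 z n Hz). assert (N2 := Hz n).
  field. auto.
Qed.

Lemma Gamma_pos (z : C) : 0 < Re z -> Gamma z = Gam z.
Proof.
  intros H. rewrite (Gamma_Gam z 0); [|now apply nonpole_pos|simpl; lra].
  simpl INR. replace (z + 0)%C with z by ring. unfold poch. simpl. field.
Qed.

Lemma Gamma_poch (z : C) (j : nat) : nonpole z -> (Gamma z * poch z j = Gamma (z + RtoC (INR j)))%C.
Proof.
  assert (HS : forall z, nonpole z -> Gamma (z + 1)%C = (Gamma z * z)%C).
  { clear. intros z Hz. destruct (nat_above (Rabs (Re z) + 1)) as [N HN].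
    assert (HR := Rle_abs (- Re z)). rewrite Rabs_Ropp in HR.
    rewrite (Gamma_Gam (z + 1) N); [|now apply nonpole_S|rewrite re_plus; simpl; lra].
    rewrite (Gamma_Gam z (S N)); [|exact Hz|rewrite S_INR; lra].
    rewrite poch_S_l, S_INR, RtoC_plus.
    replace (z + (RtoC (INR N) + 1))%C with (z + 1 + RtoC (INR N))%C by ring.
    assert (N1 := poch_neq_0 _ N (nonpole_S z Hz)). assert (N2 := Hz 0%nat).
    simpl in N2. replace (z + 0)%C with z in N2 by ring. field. auto. }
  revert z. induction j as [|j IH]; intros z Hz.
  - simpl INR. replace (z + 0)%C with z by ring. unfold poch. simpl. ring.
  - rewrite poch_S_l. replace (z + RtoC (INR (S j)))%C with (z + 1 + RtoC (INR j))%C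
      by (rewrite S_INR, RtoC_plus; ring).
    rewrite <- IH by now apply nonpole_S. rewrite HS by exact Hz. ring.
Qed.

(** * Bilateral sums and Cesaro means *)

(** A bilateral sequence as an ordinary one, by pairing [n] with [- n]; the
    partial sums are the symmetric ones. *)
Definition foldZ (a : Z -> C) (n : nat) : C :=
  match n with
  | O => a 0%Z
  | S _ => (a (Z.of_nat n) + a (- Z.of_nat n)%Z)%C
  end.

Fixpoint cesaro_sum (u : nat -> C) (N : nat) : C :=
  match N with
  | O => RtoC 0
  | S n => (cesaro_sum u n + Csum u n)%C
  end.

Lemma foldZ_ext (a b : Z -> C) n : (forall k, a k = b k) -> foldZ a n = foldZ b n.
Proof. intros H. destruct n; simpl; now rewrite !H. Qed.

Lemma foldZ_scal (a : Z -> C) c n : foldZ (fun k => c * a k)%C n = (c * foldZ a n)%C.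
Proof. destruct n; simpl; ring. Qed.

Lemma cesaro_sum_ext (u v : nat -> C) N : (forall n, u n = v n) -> cesaro_sum u N = cesaro_sum v N.
Proof. intros H. induction N as [|N IH]; simpl; auto. rewrite IH. f_equal. now apply Csum_ext. Qed.

Lemma cesaro_sum_scal (u : nat -> C) c N : cesaro_sum (fun n => c * u n)%C N = (c * cesaro_sum u N)%C.
Proof. induction N as [|N IH]; simpl; [ring|]. rewrite IH, Csum_scal. ring. Qed.

Lemma Rderive_Csum (g : nat -> R -> C) (g' : nat -> C) (t : R) (n : nat) :
  (forall k, Rderive (g k) t (g' k)) -> Rderive (fun x => Csum (fun k => g k x) n) t (Csum g' n).
Proof.
  intros H. induction n as [|n IH].
  - rewrite Csum_O. eapply Rderive_ext; [|apply (H 0%nat)]. intros x. now rewrite Csum_O.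
  - rewrite Csum_S. eapply Rderive_ext; [|apply (Rderive_plus _ _ _ _ _ IH (H (S n)))].
    intros x. now rewrite Csum_S.
Qed.

Lemma Rderive_foldZ (g : Z -> R -> C) (g' : Z -> C) (t : R) (n : nat) :
  (forall k, Rderive (g k) t (g' k)) -> Rderive (fun x => foldZ (fun k => g k x) n) t (foldZ g' n).
Proof.
  intros H. destruct n as [|n]; simpl; auto. apply Rderive_plus; apply H.
Qed.

Lemma Rderive_cesaro_sum (g : nat -> R -> C) (g' : nat -> C) (t : R) (N : nat) :
  (forall k, Rderive (g k) t (g' k)) ->
  Rderive (fun x => cesaro_sum (fun k => g k x) N) t (cesaro_sum g' N).
Proof.
  intros H. induction N as [|N IH]; simpl.
  - apply Rderive_const.
  - apply (Rderive_plus _ _ _ _ _ IH). now apply Rderive_Csum.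
Qed.

Lemma Clim_foldZ (u : Z -> nat -> C) (l : Z -> C) (n : nat) :
  (forall k, Clim (u k) (l k)) -> Clim (fun i => foldZ (fun k => u k i) n) (foldZ l n).
Proof. intros H. destruct n as [|n]; simpl; auto. apply Clim_plus; auto. Qed.

Lemma Clim_Csum (u : nat -> nat -> C) (l : nat -> C) (n : nat) :
  (forall k, Clim (u k) (l k)) -> Clim (fun i => Csum (fun k => u k i) n) (Csum l n).
Proof.
  intros H. induction n as [|n IH].
  - rewrite Csum_O. eapply Clim_ext; [|apply (H 0%nat)]. intros i. now rewrite Csum_O.
  - rewrite Csum_S. eapply Clim_ext; [|apply (Clim_plus _ _ _ _ IH (H (S n)))]. intros i.
    now rewrite Csum_S.
Qed.

Lemma Clim_cesaro_sum (u : nat -> nat -> C) (l : nat -> C) (N : nat) :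
  (forall k, Clim (u k) (l k)) -> Clim (fun i => cesaro_sum (fun k => u k i) N) (cesaro_sum l N).
Proof.
  intros H. induction N as [|N IH]; simpl; [apply Clim_const|].
  apply Clim_plus; auto. now apply Clim_Csum.
Qed.

Lemma cesaro (u : nat -> C) (l : C) : Cis_series u l ->
  Clim (fun N => / RtoC (INR (S N)) * cesaro_sum u (S N))%C l.
Proof.
  rewrite is_series_Clim. intros H.
  set (v := fun n => Cmod (Csum u n - l)%C).
  assert (Hv : is_lim_seq (fun n => sum_f_R0 v n / INR (S n)) 0).
  { apply (is_lim_seq_incr_1 (fun n => sum_f_R0 v (pred n) / INR n)).
    apply is_lim_seq_Reals. apply Cesaro_1. apply is_lim_seq_Reals. exact H. }
  apply Clim_le with (2 := Hv). intros N.
  assert (HN : RtoC (INR (S N)) <> 0%C).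
  { intros E. apply RtoC_inj in E. revert E. now apply not_0_INR. }
  assert (HN' : 0 < INR (S N)) by (apply lt_0_INR; lia).
  assert (B : forall N, Cmod (cesaro_sum u (S N) - RtoC (INR (S N)) * l)%C <= sum_f_R0 v N).
  { clear. induction N as [|N IH].
    - cbn [cesaro_sum sum_f_R0]. unfold v. right. f_equal. simpl INR. ring.
    - simpl sum_f_R0. rewrite (S_INR (S N)), RtoC_plus.
      change (cesaro_sum u (S (S N))) with (cesaro_sum u (S N) + Csum u (S N))%C.
      replace (cesaro_sum u (S N) + Csum u (S N) - (INR (S N) + 1) * l)%C with
        ((cesaro_sum u (S N) - INR (S N) * l) + (Csum u (S N) - l))%C by ring.
      eapply Rle_trans; [apply Cmod_triangle|]. unfold v at 2. lra. }
  replace (/ RtoC (INR (S N)) * cesaro_sum u (S N) - l)%C with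
    (/ RtoC (INR (S N)) * (cesaro_sum u (S N) - RtoC (INR (S N)) * l))%C by (field; exact HN).
  rewrite Cmod_mult, Cmod_inv, Cmod_R, Rabs_pos_eq by (auto; lra).
  unfold Rdiv. rewrite Rmult_comm. apply Rmult_le_compat_r; [|apply B].
  left. now apply Rinv_0_lt_compat.
Qed.

(** * The Fejer kernel *)

Fixpoint dirichlet (n : nat) (y : R) : R :=
  match n with
  | O => 1
  | S m => dirichlet m y + 2 * cos (INR n * y)
  end.

(** The sum of the first [N] Dirichlet kernels, that is [N] times the usual
    Fejer kernel. *)
Fixpoint fejer (N : nat) (y : R) : R :=
  match N with
  | O => 0
  | S n => fejer n y + dirichlet n y
  end.

Lemma dirichlet_telescope (n : nat) (y : R) :
  dirichlet n y * (1 - cos y) = cos (INR n * y) - cos (INR (S n) * y).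
Proof.
  induction n as [|n IH].
  - simpl. rewrite Rmult_0_l, cos_0, !Rmult_1_l. reflexivity.
  - cbn [dirichlet]. rewrite Rmult_plus_distr_r, IH.
    replace (INR n * y) with (INR (S n) * y - y) by (rewrite S_INR; ring).
    replace (INR (S (S n)) * y) with (INR (S n) * y + y) by (rewrite (S_INR (S n)); ring).
    rewrite cos_minus, cos_plus. ring.
Qed.

Lemma fejer_closed_form (N : nat) (y : R) : fejer N y * (1 - cos y) = 1 - cos (INR N * y).
Proof.
  induction N as [|N IH].
  - simpl. rewrite !Rmult_0_l, cos_0. ring.
  - cbn [fejer]. rewrite Rmult_plus_distr_r, IH, dirichlet_telescope. ring.
Qed.

Lemma cos_INR_mult_1 (n : nat) (y : R) : cos y = 1 -> cos (INR n * y) = 1.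
Proof.
  intros H. assert (Hs : sin y = 0).
  { generalize (sin2_cos2 y). rewrite H. unfold Rsqr. intros. nra. }
  induction n as [|n IH].
  - simpl. rewrite Rmult_0_l. apply cos_0.
  - rewrite S_INR, Rmult_plus_distr_r, Rmult_1_l, cos_plus, IH, H, Hs. ring.
Qed.

(** Where [cos y = 1] the closed form is void, and every Dirichlet kernel is
    a sum of ones. *)
Lemma fejer_ge_0 (N : nat) (y : R) : 0 <= fejer N y.
Proof.
  destruct (COS_bound y) as [_ [Hlt|Heq]].
  - assert (E := fejer_closed_form N y). destruct (COS_bound (INR N * y)) as [_ H]. nra.
  - assert (D : forall n, 0 <= dirichlet n y).
    { induction n as [|n IH]; simpl; [lra|].
      change (match n with O => 1 | S _ => INR n + 1 end) with (INR (S n)).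
      rewrite cos_INR_mult_1; auto. lra. }
    induction N as [|N IH]; simpl; [lra|]. specialize (D N). lra.
Qed.

Lemma cos_PI4_sq : cos (PI / 4) ^ 2 = 1 / 2.
Proof.
  rewrite cos_PI4. replace ((1 / sqrt 2) ^ 2) with (/ (sqrt 2 * sqrt 2)).
  - rewrite sqrt_sqrt; lra.
  - field. apply Rgt_not_eq, sqrt_lt_R0. lra.
Qed.

Lemma sin_sq_ge (v : R) : Rabs v <= PI / 4 -> v ^ 2 / 2 <= sin v ^ 2.
Proof.
  assert (HP := PI_RGT_0).
  assert (H : forall v, 0 <= v <= PI / 4 -> v ^ 2 / 2 <= sin v ^ 2).
  { clear v. intros v Hv.
    assert (Hc : 0 < cos (PI / 4)) by (apply cos_gt_0; lra).
    assert (H : sin 0 - cos (PI / 4) * 0 <= sin v - cos (PI / 4) * v).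
    { apply (nondecreasing_MVT (fun t => sin t - cos (PI / 4) * t) (fun t => cos t - cos (PI / 4)));
      [lra| |].
      - intros t Ht. auto_derive; auto. ring.
      - intros t Ht. assert (cos (PI / 4) <= cos t); [|lra].
        apply cos_le_abs; rewrite !Rabs_pos_eq; lra. }
    rewrite sin_0 in H. assert (cos (PI / 4) * v <= sin v) by lra.
    replace (v ^ 2 / 2) with ((cos (PI / 4) * v) ^ 2) by (rewrite Rpow_mult_distr, cos_PI4_sq; field).
    apply pow_incr. nra. }
  intros Hv. specialize (H (Rabs v) ltac:(split; [apply Rabs_pos|exact Hv])).
  rewrite pow2_abs in H. unfold Rabs in H. destruct (Rcase_abs v); auto.
  rewrite sin_neg in H. replace ((- sin v) ^ 2) with (sin v ^ 2) in H by ring. exact H.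
Qed.

Lemma sq_le_one_minus_cos (y : R) : Rabs y <= PI -> y ^ 2 <= 8 * (1 - cos y).
Proof.
  intros Hy. assert (HP := PI_RGT_0).
  assert (H4 : Rabs (y / 4) <= PI / 4).
  { unfold Rdiv. rewrite Rabs_mult, (Rabs_pos_eq (/ 4)) by lra. lra. }
  assert (Hs := sin_sq_ge (y / 4) H4).
  assert (Hc : 1 / 2 <= cos (y / 4) ^ 2).
  { assert (cos (PI / 4) <= cos (y / 4)).
    { apply cos_le_abs; rewrite (Rabs_pos_eq (PI / 4)); lra. }
    assert (0 < cos (PI / 4)) by (apply cos_gt_0; lra).
    rewrite <- cos_PI4_sq. apply pow_incr. lra. }
  assert (E : 1 - cos y = 8 * (sin (y / 4) ^ 2 * cos (y / 4) ^ 2)).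
  { replace y with (2 * (2 * (y / 4))) at 1 by field. rewrite cos_2a_sin, sin_2a. ring. }
  rewrite E. assert (0 <= sin (y / 4) ^ 2) by apply pow2_ge_0. nra.
Qed.

Lemma cos_period_Z (x : R) (m : Z) : cos (x + 2 * IZR m * PI) = cos x.
Proof.
  destruct m as [|p|p].
  - f_equal. ring.
  - rewrite <- (positive_nat_Z p), <- INR_IZR_INZ. apply cos_period.
  - rewrite <- (cos_period (x + 2 * IZR (Z.neg p) * PI) (Pos.to_nat p)). f_equal.
    rewrite INR_IZR_INZ, positive_nat_Z. rewrite <- Pos2Z.opp_pos, opp_IZR. ring.
Qed.

(** Primitives of [dirichlet n (kappa * u)] and of [fejer N (kappa * u)] in [u]. *)
Fixpoint dirichlet_int (kappa : R) (n : nat) (u : R) : R :=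
  match n with
  | O => u
  | S m => dirichlet_int kappa m u + 2 * sin (INR n * (kappa * u)) / (INR n * kappa)
  end.

Fixpoint fejer_int (kappa : R) (N : nat) (u : R) : R :=
  match N with
  | O => 0
  | S n => fejer_int kappa n u + dirichlet_int kappa n u
  end.

Lemma is_derive_dirichlet_int (kappa : R) (n : nat) (u : R) : kappa <> 0 ->
  is_derive (dirichlet_int kappa n) u (dirichlet n (kappa * u)).
Proof.
  intros Hk. induction n as [|n IH].
  - apply (is_derive_id (K := RA)).
  - change (dirichlet (S n) (kappa * u)) with (dirichlet n (kappa * u) + 2 * cos (INR (S n) * (kappa * u))).
    apply (is_derive_plus (V := RN) (dirichlet_int kappa n)
      (fun u => 2 * sin (INR (S n) * (kappa * u)) / (INR (S n) * kappa))); auto.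
    assert (HN : INR (S n) <> 0) by now apply not_0_INR.
    generalize dependent (INR (S n)). intros k Hk0. auto_derive; auto. field. auto.
Qed.

Lemma is_derive_fejer_int (kappa : R) (N : nat) (u : R) : kappa <> 0 ->
  is_derive (fejer_int kappa N) u (fejer N (kappa * u)).
Proof.
  intros Hk. induction N as [|N IH].
  - apply (is_derive_const (V := RN) 0).
  - apply (is_derive_plus (V := RN) (fejer_int kappa N) (dirichlet_int kappa N)); auto.
    now apply is_derive_dirichlet_int.
Qed.

(** Over a cell centred at a lattice point all the sines vanish at both ends,
    and only the constant terms of the [N] Dirichlet kernels contribute. *)
Lemma fejer_int_period (kappa L : R) (N : nat) (m : Z) : kappa * L = 2 * PI -> kappa <> 0 ->
  fejer_int kappa N ((IZR m + 1 / 2) * L) - fejer_int kappa N ((IZR m - 1 / 2) * L) = INR N * L.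
Proof.
  intros HL Hk.
  assert (D : forall n, dirichlet_int kappa n ((IZR m + 1 / 2) * L) - dirichlet_int kappa n ((IZR m - 1 /
    2) * L) = L).
  { induction n as [|n IH]; [simpl; field|].
    cbn [dirichlet_int].
    rewrite (sin_eq_0_1 (INR (S n) * (kappa * ((IZR m + 1 / 2) * L)))).
    2: { exists (Z.of_nat (S n) * (2 * m + 1))%Z. rewrite mult_IZR, plus_IZR, mult_IZR, <- INR_IZR_INZ.
      transitivity (INR (S n) * (IZR m + 1 / 2) * (kappa * L)); [ring|]. rewrite HL. field. }
    rewrite (sin_eq_0_1 (INR (S n) * (kappa * ((IZR m - 1 / 2) * L)))).
    2: { exists (Z.of_nat (S n) * (2 * m - 1))%Z. rewrite mult_IZR, minus_IZR, mult_IZR, <- INR_IZR_INZ.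
      transitivity (INR (S n) * (IZR m - 1 / 2) * (kappa * L)); [ring|]. rewrite HL. field. }
    rewrite <- IH at 3. field. split; auto. now apply not_0_INR. }
  induction N as [|N IH]; [simpl; ring|].
  cbn [fejer_int]. rewrite S_INR. specialize (D N). lra.
Qed.

(** The kernel times [1 - cos], which is comparable to the squared distance,
    is bounded independently of [N]. *)
Lemma fejer_concentration (kappa L : R) (N : nat) (m : Z) (u : R) :
  kappa * L = 2 * PI -> 0 < kappa -> 0 < L ->
  Rabs (u - IZR m * L) <= L / 2 ->
  (u - IZR m * L) ^ 2 * fejer N (kappa * u) <= 16 / kappa ^ 2.
Proof.
  intros HL Hk HL0 Hu.
  assert (Hy : Rabs (kappa * (u - IZR m * L)) <= PI).
  { rewrite Rabs_mult, (Rabs_pos_eq kappa) by lra.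
    apply Rle_trans with (kappa * (L / 2)); [apply Rmult_le_compat_l; lra|lra]. }
  assert (H := sq_le_one_minus_cos _ Hy).
  replace (cos (kappa * (u - IZR m * L))) with (cos (kappa * u)) in H.
  2: { rewrite <- (cos_period_Z (kappa * (u - IZR m * L)) m). f_equal.
    transitivity (kappa * (u - IZR m * L) + IZR m * (2 * PI)); [|ring]. rewrite <- HL. ring. }
  assert (HF := fejer_ge_0 N (kappa * u)). assert (HE := fejer_closed_form N (kappa * u)).
  destruct (COS_bound (INR N * (kappa * u))) as [Hc _].
  assert (H2 : kappa ^ 2 * ((u - IZR m * L) ^ 2 * fejer N (kappa * u)) <= 16).
  { apply Rle_trans with (8 * (1 - cos (kappa * u)) * fejer N (kappa * u)).
    - rewrite <- Rmult_assoc, <- Rpow_mult_distr. now apply Rmult_le_compat_r.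
    - replace (8 * (1 - cos (kappa * u)) * fejer N (kappa * u)) with
        (8 * (fejer N (kappa * u) * (1 - cos (kappa * u)))) by ring. rewrite HE. lra. }
  assert (Hk2 : 0 < kappa ^ 2) by now apply pow_lt.
  apply (Rmult_le_reg_l (kappa ^ 2)); auto. eapply Rle_trans; [apply H2|]. right. field. lra.
Qed.

(** The increment of [H] is the integral of [f] against the Fejer kernel over
    a cell, and [N L f(c)] is the same integral with [f] replaced by its value
    at the centre [c]. As [|f - f(c)| <= M |u - c|] and
    [|u - c| <= eta / 2 + (u - c) ^ 2 / (2 eta)], the difference is controlled by
    the total mass of the kernel and by [fejer_concentration]. The parameter
    [eta] is chosen later as a function of [N]. *)
Lemma fejer_cell (kappa L M eta : R) (N : nat) (m : Z) (f : R -> C) (H : R -> C) :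
  kappa * L = 2 * PI -> 0 < kappa -> 0 < L -> 0 < eta -> 0 <= M ->
  (forall u, Rderive H u (RtoC (fejer N (kappa * u)%R) * f u)%C) ->
  (forall u, Rabs (u - IZR m * L) <= L / 2 -> Cmod (f u - f (IZR m * L)%R)%C <= M * Rabs (u - IZR m * L)) ->
  Cmod (H ((IZR m + 1 / 2) * L)%R - H ((IZR m - 1 / 2) * L)%R - RtoC (INR N * L) * f (IZR m * L)%R)%C
    <= M * (eta / 2 * (INR N * L) + 8 / (eta * kappa ^ 2) * L).
Proof.
  intros HL Hk HL0 Heta HM HH Hf.
  set (a := (IZR m - 1 / 2) * L). set (b := (IZR m + 1 / 2) * L). set (c := IZR m * L) in *.
  assert (Hper := fejer_int_period kappa L N m HL ltac:(lra)). fold a b in Hper.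
  set (g := fun u => M * (eta / 2 * fejer_int kappa N u + 8 / (eta * kappa ^ 2) * u)).
  replace (M * (eta / 2 * (INR N * L) + 8 / (eta * kappa ^ 2) * L)) with (g b - g a).
  2: { unfold g. rewrite <- Hper. assert (EL : b - a = L) by (unfold a, b; field).
    rewrite <- EL at 1. ring. }
  rewrite <- Hper, RtoC_minus.
  replace (H b - H a - (RtoC (fejer_int kappa N b) - RtoC (fejer_int kappa N a)) * f c)%C with
    ((H b + - f c * RtoC (fejer_int kappa N b)) - (H a + - f c * RtoC (fejer_int kappa N a)))%C by ring.
  apply (mean_value_inequality (fun u => H u + - f c * RtoC (fejer_int kappa N u))%C
    (fun u => RtoC (fejer N (kappa * u)%R) * f u + - f c * RtoC (fejer N (kappa * u)))%C g
    (fun u => M * (eta / 2 * fejer N (kappa * u) + 8 / (eta * kappa ^ 2)))).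
  - unfold a, b. nra.
  - intros t _. apply Rderive_plus; auto. apply Rderive_scal, Rderive_real.
    apply is_derive_fejer_int. lra.
  - intros t _. unfold g. apply is_derive_scal.
    apply (is_derive_plus (V := RN) (fun u => eta / 2 * fejer_int kappa N u) (fun u => 8 / (eta * kappa ^
      2) * u)).
    + apply is_derive_scal. apply is_derive_fejer_int. lra.
    + generalize (8 / (eta * kappa ^ 2)). intros k. auto_derive; auto. ring.
  - intros t Ht.
    assert (Htc : Rabs (t - c) <= L / 2).
    { apply Rabs_le. unfold a, b, c in *. nra. }
    replace (RtoC (fejer N (kappa * t)) * f t + - f c * RtoC (fejer N (kappa * t)))%C with
      (RtoC (fejer N (kappa * t)) * (f t - f c))%C by ring.
    assert (HF := fejer_ge_0 N (kappa * t)).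
    rewrite Cmod_mult, Cmod_R, Rabs_pos_eq by exact HF.
    specialize (Hf t Htc).
    assert (HC := fejer_concentration kappa L N m t HL Hk HL0 Htc). fold c in HC.
    assert (Hy : Rabs (t - c) <= eta / 2 + (t - c) ^ 2 / (2 * eta)).
    { rewrite <- (pow2_abs (t - c)). set (d := Rabs (t - c)).
      apply (Rmult_le_reg_r (2 * eta)); [lra|].
      replace ((eta / 2 + d ^ 2 / (2 * eta)) * (2 * eta)) with (eta ^ 2 + d ^ 2) by (field; lra).
      generalize (pow2_ge_0 (d - eta)). simpl. nra. }
    apply Rle_trans with (fejer N (kappa * t) * (M * (eta / 2 + (t - c) ^ 2 / (2 * eta)))).
    + apply Rmult_le_compat_l; auto. eapply Rle_trans; [apply Hf|]. now apply Rmult_le_compat_l.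
    + replace (fejer N (kappa * t) * (M * (eta / 2 + (t - c) ^ 2 / (2 * eta)))) with
        (M * (eta / 2 * fejer N (kappa * t) + (t - c) ^ 2 * fejer N (kappa * t) * / (2 * eta)))
          by (field; lra).
      apply Rmult_le_compat_l; auto. apply Rplus_le_compat_l.
      replace (8 / (eta * kappa ^ 2)) with (16 / kappa ^ 2 * / (2 * eta)) by (field; lra).
      apply Rmult_le_compat_r; auto. left. apply Rinv_0_lt_compat. lra.
Qed.

(** The sum of [A * g ^ |m|] over [|m| <= P]. *)
Fixpoint geo_bound (A g : R) (P : nat) : R :=
  match P with O => A | S p => geo_bound A g p + 2 * A * g ^ P end.

Lemma geo_bound_le (A g : R) (P : nat) : 0 <= A -> 0 < g < 1 -> geo_bound A g P <= 2 * A / (1 - g).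
Proof.
  intros HA Hg.
  assert (H : geo_bound A g P <= 2 * A / (1 - g) * (1 - g ^ S P)).
  { induction P as [|P IH].
    - simpl. replace (2 * A / (1 - g) * (1 - g * 1)) with (2 * A) by (field; lra). lra.
    - cbn [geo_bound]. apply Rle_trans with (2 * A / (1 - g) * (1 - g ^ S P) + 2 * A * g ^ S P); [lra|].
      right. simpl. field. lra. }
  eapply Rle_trans; [apply H|].
  assert (0 <= 2 * A / (1 - g)) by (apply Rdiv_le_0_compat; lra).
  assert (0 < g ^ S P) by (apply pow_lt; lra). nra.
Qed.

(** Cells are added in pairs, so the increments of [H] telescope to the
    increment over the union of [2 P + 1] cells. *)
Lemma fejer_cells (kappa L A g eta : R) (N P : nat) (f : R -> C) (H : R -> C) :
  kappa * L = 2 * PI -> 0 < kappa -> 0 < L -> 0 < eta -> 0 <= A -> 0 < g < 1 ->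
  (forall u, Rderive H u (RtoC (fejer N (kappa * u)%R) * f u)%C) ->
  (forall m u, Rabs (u - IZR m * L) <= L / 2 ->
     Cmod (f u - f (IZR m * L)%R)%C <= A * g ^ Z.abs_nat m * Rabs (u - IZR m * L)) ->
  Cmod (H ((INR P + 1 / 2) * L)%R - H (- ((INR P + 1 / 2) * L))%R
        - RtoC (INR N * L) * Csum (foldZ (fun m => f (IZR m * L)%R)) P)%C
    <= geo_bound A g P * (eta / 2 * (INR N * L) + 8 / (eta * kappa ^ 2) * L).
Proof.
  intros HL Hk HL0 Heta HA Hg HH Hf.
  set (B := eta / 2 * (INR N * L) + 8 / (eta * kappa ^ 2) * L).
  assert (Hcell : forall m, Cmod (H ((IZR m + 1 / 2) * L)%R - H ((IZR m - 1 / 2) * L)%R - RtoC (INR N * L)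
    * f (IZR m * L)%R)%C
    <= A * g ^ Z.abs_nat m * B).
  { intros m. apply fejer_cell; auto. apply Rmult_le_pos; auto. apply pow_le; lra. }
  induction P as [|P IH].
  - rewrite Csum_O. simpl foldZ. specialize (Hcell 0%Z). simpl in Hcell. rewrite Rmult_1_r in Hcell.
    simpl. replace (- ((0 + 1 / 2) * L)) with ((0 - 1 / 2) * L) by ring. exact Hcell.
  - rewrite Csum_S. cbn [geo_bound].
    assert (H1 := Hcell (Z.of_nat (S P))). assert (H2 := Hcell (- Z.of_nat (S P))%Z).
    replace (Z.abs_nat (- Z.of_nat (S P))) with (S P) in H2 by lia.
    rewrite Zabs2Nat.id in H1.
    replace ((IZR (Z.of_nat (S P)) + 1 / 2) * L) with ((INR (S P) + 1 / 2) * L) in H1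
      by now rewrite INR_IZR_INZ.
    replace ((IZR (Z.of_nat (S P)) - 1 / 2) * L) with ((INR P + 1 / 2) * L) in H1
      by (rewrite <- INR_IZR_INZ, S_INR; field).
    replace ((IZR (- Z.of_nat (S P)) + 1 / 2) * L) with (- ((INR P + 1 / 2) * L)) in H2
      by (rewrite opp_IZR, <- INR_IZR_INZ, S_INR; field).
    replace ((IZR (- Z.of_nat (S P)) - 1 / 2) * L) with (- ((INR (S P) + 1 / 2) * L)) in H2
      by (rewrite opp_IZR, <- INR_IZR_INZ; ring).
    unfold foldZ at 2.
    match type of H1 with Cmod ?x <= _ => set (X := x) in * end.
    match type of H2 with Cmod ?x <= _ => set (Y := x) in * end.
    match type of IH with Cmod ?x <= _ => set (W := x) in * end.
    match goal with |- Cmod ?x <= _ => replace x with (W + (X + Y))%C end.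
    2: { unfold W, X, Y. ring. }
    eapply Rle_trans; [apply Cmod_triangle|].
    generalize (Cmod_triangle X Y). lra.
Qed.

(** * Poisson summation for the Gamma integrand *)

(** The exponent [mu_k] attached to [s]. *)
Definition shift (s : C) (kappa : R) (k : Z) : C := (s + RtoC (IZR k) * RtoC kappa * Ci)%C.

Lemma Re_shift s kappa k : Re (shift s kappa k) = Re s.
Proof. destruct s. unfold shift, Ci. simpl. ring. Qed.

Lemma Im_shift s kappa k : Im (shift s kappa k) = Im s + IZR k * kappa.
Proof. destruct s. unfold shift, Ci. simpl. ring. Qed.

(** The [k]-th character [exp (i k kappa u)] of period [2 PI / kappa]. *)
Definition character (kappa u : R) (k : Z) : C := Cexp (RtoC (IZR k) * RtoC kappa * Ci * RtoC u)%C.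

Lemma character_eq kappa u k : character kappa u k = (cos (IZR k * (kappa * u)), sin (IZR k * (kappa * u))).
Proof.
  unfold character.
  replace (RtoC (IZR k) * RtoC kappa * Ci * RtoC u)%C with (0, IZR k * (kappa * u))
    by (unfold Ci, RtoC, Cmult; simpl; f_equal; ring).
  unfold Cexp. simpl. rewrite exp_0, !Rmult_1_l. reflexivity.
Qed.

Lemma cesaro_character (kappa u : R) (N : nat) :
  cesaro_sum (foldZ (character kappa u)) N = RtoC (fejer N (kappa * u)).
Proof.
  assert (D : forall n, Csum (foldZ (character kappa u)) n = RtoC (dirichlet n (kappa * u))).
  { induction n as [|n IH].
    - rewrite Csum_O. simpl. rewrite character_eq, Rmult_0_l, cos_0, sin_0. reflexivity.
    - rewrite Csum_S, IH. cbn [dirichlet]. rewrite RtoC_plus. f_equal.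
      unfold foldZ. rewrite !character_eq, opp_IZR, <- INR_IZR_INZ.
      replace (- INR (S n) * (kappa * u)) with (- (INR (S n) * (kappa * u))) by ring.
      rewrite cos_neg, sin_neg. unfold Cplus, RtoC. cbn [fst snd]. f_equal; ring. }
  induction N as [|N IH]; [reflexivity|].
  cbn [cesaro_sum fejer]. now rewrite IH, D, RtoC_plus.
Qed.

(** The function [exp (s u) * exp (- exp (u + w))] of [u], whose values on a
    lattice are the terms of the bilateral exponential sums. *)
Definition profile (s w : C) (u : R) : C := (Cexp (- s * w) * gker s (RtoC u + w))%C.

Lemma profile_eq (s w : C) (u : R) :
  profile s w u = (Cexp (s * RtoC u) * Cexp (- (Cexp (RtoC u) * Cexp w)))%C.
Proof.
  unfold profile, gker. rewrite Cmult_assoc, <- (Cexp_plus (- s * w)%C), <- (Cexp_plus (RtoC u) w).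
    f_equal. f_equal. ring.
Qed.

(** Multiplying by a character only shifts [s] vertically. Hence the Fourier
    coefficients of [profile s w] are increments of [lower_gamma] at the shifted
    exponents, up to the factor [exp (- s_k w)]. *)
Lemma profile_shift (s w : C) (kappa u : R) (k : Z) :
  (Cexp (- shift s kappa k * w) * gker (shift s kappa k) (RtoC u + w) = profile s w u * character kappa u
    k)%C.
Proof.
  change (Cexp (- shift s kappa k * w) * gker (shift s kappa k) (RtoC u + w))%C
    with (profile (shift s kappa k) w u).
  rewrite !profile_eq. unfold shift, character.
  rewrite Cmult_plus_distr_r, Cexp_plus. ring.
Qed.

Lemma exp_decay_abs (a b u : R) : a <= b -> 0 <= u -> exp (- (b * u)) <= exp (- (a * Rabs u)).
Proof. intros Hab Hu. rewrite Rabs_pos_eq by exact Hu. apply exp_le. nra. Qed.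

(** One exponent [a] serves at both ends: the decay rate is [Re s] at
    [- infinity] and arbitrarily large at [+ infinity]. *)
Lemma gker_decay (s : C) (r th a : R) : 0 < Re s -> Rabs th < PI / 2 -> 0 < a <= 1 -> a <= Re s ->
  exists A, 0 <= A /\ forall u, Cmod (gker s (RtoC u + logpt r th)%C) <= A * exp (- (a * Rabs u)).
Proof.
  intros Hs Hth Ha1 Ha2. destruct (nat_above (Re s + 1)) as [N HN].
  assert (Hc := cos_pos_abs th Hth). assert (HcN : 0 < cos th ^ N) by now apply pow_lt.
  assert (Hf := INR_fact_lt_0 N).
  set (E := exp (- (th * Im s))). assert (HE : 0 < E) by apply exp_pos.
  set (K := INR (fact N) / cos th ^ N). assert (HK : 0 < K) by now apply Rdiv_lt_0_compat.
  (* where 0 <= u < - r only the bound for - infinity applies, which K alone does not cover: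
     hence the factor 1 + K *)
  set (A := E * (exp (Re s * r) + (1 + K) * exp (- r))).
  exists A. assert (P1 := exp_pos (Re s * r)). assert (P2 := exp_pos (- r)).
  split; [left; unfold A; apply Rmult_lt_0_compat; nra|].
  intros u. replace (RtoC u + logpt r th)%C with (logpt (u + r) th)
    by (unfold logpt, RtoC, Cplus; simpl; f_equal; ring).
  assert (Q := exp_pos (- (a * Rabs u))).
  destruct (Rle_dec 0 u) as [Hu|Hu].
  - apply Rle_trans with (E * ((1 + K) * exp (- (u + r)))).
    + destruct (Rle_dec 0 (u + r)) as [Hur|Hur].
      * eapply Rle_trans; [apply (gker_bound_pos s (u + r) th (cos th) N); auto; lra|].
        fold E K. apply Rmult_le_compat_l; [lra|]. apply Rmult_le_compat_r; [left; apply exp_pos|lra].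
      * eapply Rle_trans; [apply gker_bound_neg; lra|]. fold E.
        apply Rmult_le_compat_l; [lra|].
        assert (exp (Re s * (u + r)) <= 1) by (rewrite <- exp_0; apply exp_le; nra).
        assert (1 <= exp (- (u + r))) by (rewrite <- exp_0 at 1; apply exp_le; lra). nra.
    + replace (- (u + r)) with (- (1 * u) + - r) by ring. rewrite exp_plus.
      assert (H := exp_decay_abs a 1 u ltac:(lra) Hu).
      unfold A.
      apply Rle_trans with (E * ((1 + K) * (exp (- (a * Rabs u)) * exp (- r)))).
      * apply Rmult_le_compat_l; [lra|]. apply Rmult_le_compat_l; [lra|].
        now apply Rmult_le_compat_r; [lra|].
      * rewrite Rmult_assoc. apply Rmult_le_compat_l; [lra|]. nra.
  - eapply Rle_trans; [apply gker_bound_neg; lra|]. fold E. unfold A.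
    rewrite Rmult_assoc. apply Rmult_le_compat_l; [lra|].
    rewrite Rmult_plus_distr_l, exp_plus.
    assert (H : exp (Re s * u) <= exp (- (a * Rabs u))).
    { rewrite Rabs_left by lra. apply exp_le. nra. }
    assert (0 <= (1 + K) * exp (- r) * exp (- (a * Rabs u))) by (apply Rmult_le_pos; nra).
    nra.
Qed.

Definition dprofile (s w : C) (u : R) : C :=
  (Cexp (- s * w) * (s * gker s (RtoC u + w) - gker (s + 1) (RtoC u + w)))%C.

Lemma Rderive_profile (s w : C) (u : R) : Rderive (profile s w) u (dprofile s w u).
Proof.
  apply Rderive_scal. apply Rderive_ext with (fun x => gker s (w + RtoC x * 1)%C).
  { intros x. f_equal. ring. }
  eapply Rderive_eq; [apply Rderive_line, Cderive_gker|].
  replace (w + RtoC u * 1)%C with (RtoC u + w)%C by ring. ring.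
Qed.

Lemma profile_bounds (s : C) (r th a : R) : 0 < Re s -> Rabs th < PI / 2 -> 0 < a <= 1 -> a <= Re s ->
  exists A, 0 <= A /\ forall u,
    Cmod (profile s (logpt r th) u) <= A * exp (- (a * Rabs u)) /\
    Cmod (dprofile s (logpt r th) u) <= A * exp (- (a * Rabs u)).
Proof.
  intros Hs Hth Ha1 Ha2.
  destruct (gker_decay s r th a Hs Hth Ha1 Ha2) as [A0 [HA0 H0]].
  destruct (gker_decay (s + 1) r th a) as [A1 [HA1 H1]]; auto; [rewrite re_plus; simpl;
    lra|rewrite re_plus; simpl; lra|].
  set (w := logpt r th) in *. set (e := Cmod (Cexp (- s * w)%C)).
  assert (He : 0 <= e) by apply Cmod_ge_0. assert (Hs0 := Cmod_ge_0 s).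
  exists (e * A0 + e * (Cmod s * A0 + A1)). split.
  { apply Rplus_le_le_0_compat; apply Rmult_le_pos; auto. nra. }
  intros u. specialize (H0 u). specialize (H1 u). assert (Q := exp_pos (- (a * Rabs u))).
  assert (T1 : Cmod (profile s w u) <= e * A0 * exp (- (a * Rabs u))).
  { unfold profile. rewrite Cmod_mult. fold e. rewrite Rmult_assoc. now apply Rmult_le_compat_l. }
  assert (S1 : 0 <= e * (Cmod s * A0 + A1) * exp (- (a * Rabs u))).
  { apply Rmult_le_pos; [apply Rmult_le_pos; auto; nra|lra]. }
  assert (S2 : 0 <= e * A0 * exp (- (a * Rabs u))).
  { apply Rmult_le_pos; [nra|lra]. }
  split; [lra|].
  unfold dprofile. rewrite Cmod_mult. fold e.
  assert (T2 : Cmod (s * gker s (RtoC u + w) - gker (s + 1) (RtoC u + w))%C <= (Cmod s * A0 + A1) * exp (-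
    (a * Rabs u))).
  { unfold Cminus. eapply Rle_trans; [apply Cmod_triangle|]. rewrite Cmod_opp, Cmod_mult.
    apply (Rmult_le_compat_l (Cmod s)) in H0; auto. nra. }
  apply (Rmult_le_compat_l e) in T2; auto. lra.
Qed.

Lemma Lipschitz_segment (f f' : R -> C) (M c u : R) :
  (forall t, Rmin c u <= t <= Rmax c u -> Rderive f t (f' t) /\ Cmod (f' t) <= M) ->
  Cmod (f u - f c)%C <= M * Rabs (u - c).
Proof.
  intros Hf'.
  destruct (Rle_dec c u) as [Hcu|Hcu].
  - rewrite Rmin_left, Rmax_right in Hf' by lra. rewrite Rabs_pos_eq by lra.
    replace (M * (u - c)) with (M * u - M * c) by ring.
    apply (mean_value_inequality f f' (fun t => M * t) (fun _ => M)); auto.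
    + intros t Ht. now apply Hf'.
    + intros t Ht. auto_derive; auto. ring.
    + intros t Ht. now apply Hf'.
  - rewrite Rmin_right, Rmax_left in Hf' by lra. rewrite Rabs_left by lra. rewrite Cmod_minus_sym.
    replace (M * - (u - c)) with (M * c - M * u) by ring.
    apply (mean_value_inequality f f' (fun t => M * t) (fun _ => M)); try lra.
    + intros t Ht. now apply Hf'.
    + intros t Ht. auto_derive; auto. ring.
    + intros t Ht. now apply Hf'.
Qed.

Lemma exp_cell_decay (a L u : R) (m : Z) : 0 < a -> 0 < L -> Rabs (u - IZR m * L) <= L / 2 ->
  exp (- (a * Rabs u)) <= exp (a * L / 2) * exp (- (a * L)) ^ Z.abs_nat m.
Proof.
  intros Ha HL Hu. rewrite <- exp_mult_INR, <- exp_plus. apply exp_le.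
  rewrite INR_IZR_INZ, Zabs2Nat.id_abs, abs_IZR.
  assert (H : Rabs (IZR m) * L <= Rabs u + L / 2).
  { rewrite <- (Rabs_pos_eq L) at 1 by lra. rewrite <- Rabs_mult.
    replace (IZR m * L) with (u - (u - IZR m * L)) by ring.
    eapply Rle_trans; [apply Rabs_triang|]. rewrite Rabs_Ropp. lra. }
  nra.
Qed.

Lemma foldZ_bound (a : Z -> C) (A g : R) (n : nat) : 0 <= A -> 0 <= g ->
  (forall k, Cmod (a k) <= A * g ^ Z.abs_nat k) -> Cmod (foldZ a n) <= 2 * A * g ^ n.
Proof.
  intros HA Hg H. assert (P : 0 <= g ^ n) by now apply pow_le.
  destruct n as [|n].
  - simpl. specialize (H 0%Z). simpl in H. lra.
  - unfold foldZ. eapply Rle_trans; [apply Cmod_triangle|].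
    assert (H1 := H (Z.of_nat (S n))). assert (H2 := H (- Z.of_nat (S n))%Z).
    replace (Z.abs_nat (- Z.of_nat (S n))) with (S n) in H2 by lia.
    rewrite Zabs2Nat.id in H1. lra.
Qed.

Lemma foldZ_abs_conv (a : Z -> C) (A g : R) : 0 <= A -> 0 < g < 1 ->
  (forall k, Cmod (a k) <= A * g ^ Z.abs_nat k) -> Cabs_conv (foldZ a).
Proof.
  intros HA Hg H. apply Cabs_conv_le with (fun n => 2 * A * g ^ n).
  - intros n. apply foldZ_bound; auto; lra.
  - apply ex_series_geo. lra.
Qed.

Lemma exp_neg_lt_1 (x : R) : 0 < x -> 0 < exp (- x) < 1.
Proof. intros H. split; [apply exp_pos|]. rewrite <- exp_0. apply exp_increasing. lra. Qed.

(** Integrate [profile] against the Fejer kernel. Over ever more cells the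
    integral tends to the [N]-th Cesaro sum of the Gamma terms, by
    [lower_gamma_lim_pos] and [lower_gamma_lim_neg]; by [fejer_cells] it stays close to
    [N L] times the lattice sum. Dividing by [N] and letting [N] tend to
    infinity identifies the two sums. *)
Theorem poisson (kappa L r th : R) (s : C) (Sa Sf : C) :
  kappa * L = 2 * PI -> 0 < kappa -> 0 < L -> 0 < Re s -> Rabs th < PI / 2 ->
  Cis_series (foldZ (fun k => Cexp (- shift s kappa k * logpt r th) * Gam (shift s kappa k))%C) Sa ->
  Cis_series (foldZ (fun m => profile s (logpt r th) (IZR m * L))) Sf ->
  Sa = (RtoC L * Sf)%C.
Proof.
  intros HL Hk HL0 Hs Hth HSa HSf.
  set (w := logpt r th) in *. set (a := Rmin (Re s) 1).
  assert (Ha1 : 0 < a <= 1) by (unfold a; split; [apply Rmin_glb_lt; lra|apply Rmin_r]).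
  assert (Ha2 : a <= Re s) by (unfold a; apply Rmin_l).
  destruct (profile_bounds s r th a Hs Hth Ha1 Ha2) as [A [HA HB]]. fold w in HB.
  set (g := exp (- (a * L))). assert (Hg : 0 < g < 1) by (apply exp_neg_lt_1; nra).
  set (A' := A * exp (a * L / 2)). assert (HA' : 0 <= A') by (apply Rmult_le_pos; auto; left;
    apply exp_pos).
  assert (Hlip : forall m u, Rabs (u - IZR m * L) <= L / 2 ->
    Cmod (profile s w u - profile s w (IZR m * L))%C <= A' * g ^ Z.abs_nat m * Rabs (u - IZR m * L)).
  { intros m u Hu. apply (Lipschitz_segment _ (dprofile s w)). intros t Ht. destruct (HB t) as [_ Hl2].
    split; [apply Rderive_profile|]. eapply Rle_trans; [apply Hl2|].
    unfold A'. rewrite Rmult_assoc. apply Rmult_le_compat_l; auto.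
    apply exp_cell_decay; [lra|lra|]. apply Rabs_le. apply Rabs_le_between in Hu.
    revert Ht. unfold Rmin, Rmax. destruct (Rle_dec (IZR m * L) u); lra. }
  set (c := fun k => Cexp (- shift s kappa k * w)%C).
  set (H := fun N u => cesaro_sum (foldZ (fun k => c k * lower_gamma (shift s kappa k) (RtoC u + w))%C) N).
  assert (HH : forall N u, Rderive (H N) u (RtoC (fejer N (kappa * u)) * profile s w u)%C).
  { intros N u. eapply Rderive_eq.
    - apply Rderive_cesaro_sum. intros n. apply Rderive_foldZ. intros k.
      apply Rderive_scal. apply Rderive_lower_gamma. now rewrite Re_shift.
    - cbv beta. rewrite <- cesaro_character, Cmult_comm, <- cesaro_sum_scal. apply cesaro_sum_ext.
      intros n. rewrite <- foldZ_scal. apply foldZ_ext. intros k. apply profile_shift. }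
  set (K := 2 * A' / (1 - g)).
  assert (HK : 0 <= K) by (apply Rdiv_le_0_compat; lra).
  (* for fixed N the number P of cells tends to infinity, and each lower_gamma in H tends to
     its limits at the two ends *)
  assert (HN : forall N eta, 0 < eta ->
    Cmod (cesaro_sum (foldZ (fun k => c k * Gam (shift s kappa k))%C) N - RtoC (INR N * L) * Sf)%C
      <= K * (eta / 2 * (INR N * L) + 8 / (eta * kappa ^ 2) * L)).
  { intros N eta Heta. set (B := eta / 2 * (INR N * L) + 8 / (eta * kappa ^ 2) * L).
    assert (HBp : 0 <= B).
    { unfold B. assert (0 <= INR N) by apply pos_INR. assert (0 < 8 / (eta * kappa ^ 2)).
      { apply Rdiv_lt_0_compat; [lra|]. apply Rmult_lt_0_compat; auto. now apply pow_lt. }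
      apply Rplus_le_le_0_compat; [|nra]. apply Rmult_le_pos; [lra|]. nra. }
    apply (Clim_bound (fun P => H N ((INR P + 1 / 2) * L)%R - H N (- ((INR P + 1 / 2) * L))%R
       - RtoC (INR N * L) * Csum (foldZ (fun m => profile s w (IZR m * L))) P)%C _ (fun _ => K * B)).
    - replace (cesaro_sum (foldZ (fun k => c k * Gam (shift s kappa k))%C) N)%C with
        (cesaro_sum (foldZ (fun k => c k * Gam (shift s kappa k))%C) N - cesaro_sum (foldZ (fun k => c k *
          0)%C) N)%C.
      2: { rewrite (cesaro_sum_ext (foldZ (fun k => c k * 0)%C) (fun n => 0 * foldZ c n)%C).
        - rewrite cesaro_sum_scal. ring.
        - intros n. rewrite <- foldZ_scal. apply foldZ_ext. intros k. ring. }
      apply Clim_minus; [apply Clim_minus|].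
      + apply (Clim_cesaro_sum (fun k i => foldZ (fun k => c k * lower_gamma (shift s kappa k) (RtoC ((INR
        i + 1 / 2) * L) + w))%C k)).
        intros n. apply (Clim_foldZ (fun k i => c k * lower_gamma (shift s kappa k) (RtoC ((INR i + 1 / 2)
          * L) + w))%C).
        intros k. apply Clim_scal.
        eapply Clim_ext; [|apply (lower_gamma_lim_pos (shift s kappa k) th L (L / 2 + r)); auto;
          now rewrite Re_shift].
        intros i. cbv beta. f_equal. unfold w, logpt, RtoC, Cplus. simpl. f_equal; field.
      + apply (Clim_cesaro_sum (fun k i => foldZ (fun k => c k * lower_gamma (shift s kappa k) (RtoC (-
        ((INR i + 1 / 2) * L)) + w))%C k)).
        intros n. apply (Clim_foldZ (fun k i => c k * lower_gamma (shift s kappa k) (RtoC (- ((INR i + 1 /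
          2) * L)) + w))%C).
        intros k. apply Clim_scal.
        eapply Clim_ext; [|apply (lower_gamma_lim_neg (shift s kappa k) th L (L / 2 - r)); auto;
          now rewrite Re_shift].
        intros i. cbv beta. f_equal. unfold w, logpt, RtoC, Cplus. simpl. f_equal; field.
      + apply Clim_scal. now apply is_series_Clim.
    - intros P. eapply Rle_trans; [apply (fejer_cells kappa L A' g eta N P (profile s w) (H N)); auto|].
      fold B. apply Rmult_le_compat_r; auto. now apply geo_bound_le.
    - apply is_lim_seq_const. }
  assert (HC := cesaro _ _ HSa).
  set (sub := fun p : nat => (p * p + 2 * p)%nat).
  assert (Hsub : forall p, S (sub p) = (S p * S p)%nat) by (intros p; unfold sub; lia).
  assert (HC2 : Clim (fun p => / RtoC (INR (S (sub p))) * cesaro_sum (foldZ (fun k => c k * Gam (shift s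
    kappa k))%C) (S (sub p)))%C Sa).
  { unfold Clim in *. apply (is_lim_seq_subseq _ _ sub) in HC; [exact HC|].
    apply eventually_subseq. intros n. unfold sub. lia. }
  apply (Clim_unique _ _ _ HC2).
  apply Clim_le with (fun p => (K * (L / 2 + 8 * L / kappa ^ 2)) * / INR (S p)).
  2: { apply is_lim_seq_scal0, is_lim_seq_inv_S. }
  intros p. rewrite Hsub, mult_INR.
  assert (Hp : 0 < INR (S p)) by (apply lt_0_INR; lia).
  assert (Hpp : 0 < INR (S p) * INR (S p)) by nra.
  assert (Hpc : RtoC (INR (S p) * INR (S p)) <> 0%C) by (intros E; apply RtoC_inj in E; lra).
  specialize (HN (S p * S p)%nat (/ INR (S p)) (Rinv_0_lt_compat _ Hp)). rewrite mult_INR in HN.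
  set (X := cesaro_sum (foldZ (fun k => c k * Gam (shift s kappa k))%C) (S p * S p)) in *.
  replace (/ RtoC (INR (S p) * INR (S p)) * X - RtoC L * Sf)%C with
    (/ RtoC (INR (S p) * INR (S p)) * (X - RtoC (INR (S p) * INR (S p) * L) * Sf))%C.
  2: { rewrite (RtoC_mult _ L). field. exact Hpc. }
  rewrite Cmod_mult, Cmod_inv, Cmod_R, Rabs_pos_eq by (auto; lra).
  apply (Rmult_le_compat_l (/ (INR (S p) * INR (S p)))) in HN; [|left; now apply Rinv_0_lt_compat].
  eapply Rle_trans; [apply HN|]. right. field. split; lra.
Qed.

(** * Euler's q-exponential series *)

Definition qexp (q : R) (mu : C) : C := spow (of_pos q) mu.

Lemma qexp_eq (q : R) (mu : C) : qexp q mu = Cexp (mu * RtoC (ln q))%C.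
Proof. reflexivity. Qed.

Lemma qexp_S (q : R) (mu : C) : 0 < q -> qexp q (mu + 1)%C = (qexp q mu * RtoC q)%C.
Proof.
  intros Hq. rewrite !qexp_eq, Cmult_plus_distr_r, Cexp_plus, Cmult_1_l, Cexp_RtoC, exp_ln; auto.
Qed.

Lemma RtoC_neq_0 (x : R) : x <> 0 -> RtoC x <> 0%C.
Proof. intros H E. apply H. now apply RtoC_inj in E. Qed.

Lemma pow_lt_1 (q : R) (n : nat) : 0 < q < 1 -> 0 < q ^ S n <= q.
Proof.
  intros Hq. split; [now apply pow_lt|]. induction n as [|n IH]; [simpl; lra|].
  change (q ^ S (S n)) with (q * q ^ S n). assert (0 < q ^ S n) by now apply pow_lt. nra.
Qed.

Lemma q_pow_bounds (q : R) (n : nat) : 0 < q < 1 -> 0 < q ^ n <= 1.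
Proof.
  intros Hq. split; [now apply pow_lt|]. rewrite <- (pow1 n). apply pow_incr. lra.
Qed.

Lemma qpoch_S (a : C) (q : R) (n : nat) : qpoch a q (S n) = (qpoch a q n * (1 - a * RtoC (q ^ n)))%C.
Proof. reflexivity. Qed.

(** Splitting off the first factor instead of the last. *)
Lemma qpoch_S_l (a : C) (q : R) (n : nat) : qpoch a q (S n) = ((1 - a) * qpoch (a * RtoC q) q n)%C.
Proof.
  induction n as [|n IH].
  - unfold qpoch. simpl. ring.
  - rewrite qpoch_S, IH, qpoch_S. simpl pow. rewrite RtoC_mult. ring.
Qed.

Lemma qpoch_q_S (q : R) (n : nat) : qpoch (RtoC q) q (S n) = (qpoch (RtoC q) q n * RtoC (1 - q ^ S n))%C.
Proof. rewrite qpoch_S. simpl pow. rewrite RtoC_minus, (RtoC_mult q). ring. Qed.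

Lemma qpoch_q_neq_0 (q : R) (n : nat) : 0 < q < 1 -> qpoch (RtoC q) q n <> 0%C.
Proof.
  intros Hq. induction n as [|n IH]; [apply C1_nz|].
  rewrite qpoch_q_S. apply Cmult_neq_0; auto. apply RtoC_neq_0.
  generalize (pow_lt_1 q n Hq). lra.
Qed.

Lemma qpoch_q_bound (q : R) (n : nat) : 0 < q < 1 -> Cmod (qpoch (RtoC q) q n) <= 1.
Proof.
  intros Hq. induction n as [|n IH]; [unfold qpoch; simpl; rewrite Cmod_1; lra|].
  rewrite qpoch_q_S, Cmod_mult, Cmod_R. assert (H := pow_lt_1 q n Hq).
  rewrite Rabs_pos_eq by lra. generalize (Cmod_ge_0 (qpoch (RtoC q) q n)). nra.
Qed.

(** The coefficients of Euler's series
    [(q z; q)_inf = sum_n q ^ (n (n + 1) / 2) / (q; q)_n * (- z) ^ n]. *)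
Definition qcoef (q : R) (n : nat) : C := (RtoC (q ^ Nat.div2 (n * (n + 1))) / qpoch (RtoC q) q n)%C.

Lemma div2_triangular (n : nat) : Nat.div2 (S n * (S n + 1)) = (Nat.div2 (n * (n + 1)) + S n)%nat.
Proof.
  replace (S n * (S n + 1))%nat with (n * (n + 1) + 2 * S n)%nat by lia.
  rewrite Nat.div2_div, Nat.div2_div, (Nat.mul_comm 2), Nat.div_add; lia.
Qed.

Lemma qcoef_S (q : R) (n : nat) : 0 < q < 1 ->
  (qcoef q (S n) * RtoC (1 - q ^ S n) = RtoC (q ^ S n) * qcoef q n)%C.
Proof.
  intros Hq. unfold qcoef. rewrite div2_triangular, pow_add, RtoC_mult, qpoch_q_S.
  assert (N1 := qpoch_q_neq_0 q n Hq).
  assert (N2 : RtoC (1 - q ^ S n) <> 0%C) by (apply RtoC_neq_0; generalize (pow_lt_1 q n Hq); lra).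
  field. auto.
Qed.

Lemma qcoef_0 (q : R) : qcoef q 0 = 1%C.
Proof. unfold qcoef, qpoch. simpl. field. Qed.

Lemma ln_lt_0 (q : R) : 0 < q < 1 -> ln q < 0.
Proof. intros Hq. rewrite <- ln_1. apply ln_increasing; lra. Qed.

Lemma lim_poly_pow (A q : R) : 0 < q < 1 -> is_lim_seq (fun n => (A + INR n) * q ^ S n) 0.
Proof.
  intros Hq.
  assert (L : 0 < - ln q) by (generalize (ln_lt_0 q Hq); lra).
  assert (G : is_lim_seq (fun n => q ^ n) 0) by (apply is_lim_seq_geom; rewrite Rabs_pos_eq; lra).
  assert (H : is_lim_seq (fun n => INR n * q ^ n) 0).
  { apply is_lim_seq_incr_1.
    apply (is_lim_seq_le_le (fun _ => 0) _ (fun n => INR (fact 2) / (- ln q) ^ 2 * / INR (S n))).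
    - intros n. assert (Hn : 0 < INR (S n)) by (apply lt_0_INR; lia).
      assert (Hp : 0 < q ^ S n) by now apply pow_lt.
      split; [nra|].
      assert (K := pow_exp_le (INR (S n)) (- ln q) 2 ltac:(lra) L).
      replace (exp (- (INR (S n) * - ln q))) with (q ^ S n) in K.
      2: { rewrite <- (exp_ln q) at 1 by lra. rewrite <- exp_mult_INR. f_equal. ring. }
      apply (Rmult_le_compat_r (/ INR (S n))) in K; [|left; now apply Rinv_0_lt_compat].
      eapply Rle_trans; [|apply K]. right. field. lra.
    - apply is_lim_seq_const.
    - apply is_lim_seq_scal0, is_lim_seq_inv_S. }
  eapply is_lim_seq_ext; [|apply (is_lim_seq_plus0 _ _ (is_lim_seq_scal0 _ (q * A) G) (is_lim_seq_scal0 _ q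
    H))].
  intros n. simpl. ring.
Qed.

(** The ratio of consecutive terms is at most [(A + n) q ^ (n + 1) / (1 - q)];
    the coefficients beat weights of factorial growth. *)
Lemma entire_weighted_qcoef (q : R) (c : nat -> C) (A : R) : 0 < q < 1 -> 0 <= A ->
  (forall n, Cmod (c (S n)) <= (A + INR n) * Cmod (c n)) -> entire (fun n => c n * qcoef q n)%C.
Proof.
  intros Hq HA Hc. apply entire_ratio with (fun n => / (1 - q) * ((A + INR n) * q ^ S n)).
  2: { apply is_lim_seq_scal0. now apply lim_poly_pow. }
  intros n. rewrite !Cmod_mult.
  assert (Hp := pow_lt_1 q n Hq). assert (E := qcoef_S q n Hq).
  apply (f_equal Cmod) in E. rewrite !Cmod_mult, !Cmod_R, !Rabs_pos_eq in E by lra.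
  assert (G0 := Cmod_ge_0 (qcoef q n)). assert (G1 := Cmod_ge_0 (qcoef q (S n))).
  assert (H1 : Cmod (qcoef q (S n)) <= / (1 - q) * (q ^ S n * Cmod (qcoef q n))).
  { apply (Rmult_le_reg_l (1 - q)); [lra|]. rewrite <- Rmult_assoc, Rinv_r, Rmult_1_l by lra. nra. }
  assert (C0 := Cmod_ge_0 (c n)). assert (C1 := Cmod_ge_0 (c (S n))). assert (Hn := pos_INR n).
  apply Rle_trans with ((A + INR n) * Cmod (c n) * (/ (1 - q) * (q ^ S n * Cmod (qcoef q n)))).
  - apply Rmult_le_compat; auto.
  - right. ring.
Qed.

Lemma entire_qcoef (q : R) : 0 < q < 1 -> entire (qcoef q).
Proof.
  intros Hq r Hr. apply ex_series_ext with (fun n => Cmod (1 * qcoef q n)%C * r ^ n).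
  { intros n. f_equal. f_equal. ring. }
  apply (entire_weighted_qcoef q (fun _ => 1%C) 1 Hq ltac:(lra)); auto.
  intros n. rewrite Cmod_1. generalize (pos_INR n). lra.
Qed.

(** This is [(q z; q)_inf]. *)
Definition qprod (q : R) (z : C) : C := PS (qcoef q) (- z)%C.

(** Compare coefficients, using [(1 - q ^ n) b_n = q ^ n b_(n - 1)] for
    [b = qcoef q]. *)
Lemma qprod_functional (q : R) (z : C) : 0 < q < 1 ->
  qprod q z = ((1 - RtoC q * z) * qprod q (RtoC q * z))%C.
Proof.
  intros Hq. unfold qprod. assert (He := entire_qcoef q Hq).
  set (b := qcoef q). set (y := (- z)%C).
  replace (- (RtoC q * z))%C with (RtoC q * y)%C by (unfold y; ring).
  replace (1 - RtoC q * z)%C with (1 + RtoC q * y)%C by (unfold y; ring).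
  assert (H1 := PS_correct b y He). assert (H2 := PS_correct b (RtoC q * y)%C He).
  apply Cis_series_incr_1 in H1.
  apply Cis_series_unique with (a := fun n => (b (S n) * y ^ S n)%C) (s := (PS b y - b 0%nat * y ^ 0)%C)
    (t := ((PS b (RtoC q * y) - b 0%nat * (RtoC q * y) ^ 0) + RtoC q * y * PS b (RtoC q * y))%C) in H1.
  - simpl in H1. replace (PS b y) with (PS b y - b 0%nat * 1 + b 0%nat)%C by ring. rewrite H1. ring.
  - assert (H3 := Cis_series_plus _ _ _ _ (Cis_series_incr_1 _ _ H2) (Cis_series_scal _ _ (RtoC q * y)%C
    H2)).
    eapply Cis_series_ext; [|apply H3].
    intros n. cbv beta. rewrite !Cpow_mult_l.
    assert (E := qcoef_S q n Hq). fold b in E. rewrite RtoC_minus in E.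
    rewrite <- !RtoC_pow.
    assert (E2 : (b (S n) = RtoC (q ^ S n) * b (S n) + RtoC (q ^ S n) * b n)%C) by (rewrite <- E; ring).
    rewrite E2 at 2. simpl pow. rewrite RtoC_mult. rewrite (Cpow_S y). ring.
Qed.

Lemma qprod_0 (q : R) : qprod q 0 = 1%C.
Proof. unfold qprod. replace (- 0)%C with (RtoC 0) by ring. rewrite PS_0. apply qcoef_0. Qed.

Lemma qprod_qpoch (q : R) (n : nat) : 0 < q < 1 ->
  qprod q 1 = (qpoch (RtoC q) q n * qprod q (RtoC (q ^ n)))%C.
Proof.
  intros Hq. induction n as [|n IH].
  - unfold qpoch. simpl. ring.
  - rewrite IH, (qprod_functional q (RtoC (q ^ n)) Hq), qpoch_S. simpl pow. rewrite RtoC_mult. ring.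
Qed.

(** The zeros of [(q z; q)_inf]. They extend sums over [m >= 0] to all integers. *)
Lemma qprod_neg_pow (q : R) (n : nat) : 0 < q < 1 -> qprod q (RtoC (/ q ^ S n)) = 0%C.
Proof.
  intros Hq. assert (Hn : forall n, q ^ n <> 0) by (intros; apply pow_nonzero; lra).
  induction n as [|n IH].
  - rewrite qprod_functional by exact Hq. rewrite <- RtoC_mult. simpl. rewrite Rmult_1_r, Rinv_r by lra.
    ring.
  - rewrite qprod_functional by exact Hq. rewrite <- RtoC_mult.
    replace (q * / q ^ S (S n)) with (/ q ^ S n).
    + rewrite IH. ring.
    + change (q ^ S (S n)) with (q * q ^ S n). specialize (Hn (S n)). field. split; lra.
Qed.

Lemma Clim_of_Cderive (f : C -> C) (z l : C) (h : nat -> C) :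
  Cderive f z l -> is_lim_seq (fun n => Cmod (h n)) 0 -> Clim (fun n => f (z + h n)%C) (f z).
Proof.
  intros Hf Hh. destruct (proj1 (Cderive_eps _ _ _) Hf 1 ltac:(lra)) as [d [Hd0 Hd]].
  assert (Hev := proj2 (is_lim_seq_spec _ _) Hh). clear Hev.
  apply is_lim_seq_spec in Hh. destruct (Hh (mkposreal d Hd0)) as [N HN]. simpl in HN.
  unfold Clim. apply (is_lim_seq_incr_n _ N).
  apply (is_lim_seq_le_le (fun _ => 0) _ (fun n => (1 + Cmod l) * Cmod (h (n + N)%nat))).
  - intros n. split; [apply Cmod_ge_0|].
    specialize (HN (n + N)%nat ltac:(lia)). rewrite Rminus_0_r, Rabs_pos_eq in HN by apply Cmod_ge_0.
    specialize (Hd _ HN).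
    replace (f (z + h (n + N)%nat) - f z)%C with ((f (z + h (n + N)%nat) - f z - h (n + N)%nat * l) + h (n
      + N)%nat * l)%C by ring.
    eapply Rle_trans; [apply Cmod_triangle|]. rewrite Cmod_mult. lra.
  - apply is_lim_seq_const.
  - apply is_lim_seq_scal0. apply (is_lim_seq_incr_n (fun n => Cmod (h n)) N).
    apply is_lim_seq_spec. exact Hh.
Qed.

Lemma Clim_qprod (q : R) : 0 < q < 1 -> Clim (fun n => qprod q (RtoC (q ^ n))) 1%C.
Proof.
  intros Hq. rewrite <- (qprod_0 q).
  assert (D : exists l, Cderive (qprod q) 0%C l).
  { eexists. unfold qprod. eapply Cderive_comp with (f := PS (qcoef q)) (g := fun z => (- z)%C).
    - apply Cderive_PS, entire_qcoef, Hq.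
    - eapply Cderive_ext; [|apply (Cderive_lin (- (1))%C 0%C)]. intros x. simpl. ring. }
  destruct D as [l Hl].
  eapply Clim_ext; [|apply (Clim_of_Cderive _ _ _ (fun n => RtoC (q ^ n)) Hl)].
  - intros n. cbv beta. f_equal. ring.
  - apply is_lim_seq_ext with (fun n => q ^ n).
    { intros n. rewrite Cmod_R, Rabs_pos_eq; auto. apply pow_le. lra. }
    apply is_lim_seq_geom. rewrite Rabs_pos_eq; lra.
Qed.

(** The quotient of [qprod q 1] by the [n]-th partial product is
    [qprod q (q ^ n)], which tends to 1. *)
Lemma qpoch_inf_q (q : R) : 0 < q < 1 -> qpoch_inf (RtoC q) q = qprod q 1.
Proof.
  intros Hq. apply CLim_seq_unique.
  apply Clim_le with (2 := Clim_qprod q Hq).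
  intros n. rewrite (qprod_qpoch q n Hq).
  replace (qpoch (RtoC q) q n - qpoch (RtoC q) q n * qprod q (RtoC (q ^ n)))%C with
    (- (qpoch (RtoC q) q n * (qprod q (RtoC (q ^ n)) - 1)))%C by ring.
  rewrite Cmod_opp, Cmod_mult. generalize (qpoch_q_bound q n Hq) (Cmod_ge_0 (qprod q (RtoC (q ^ n)) -
    1)%C). nra.
Qed.

Lemma qprod_1_neq_0 (q : R) : 0 < q < 1 -> qprod q 1 <> 0%C.
Proof.
  intros Hq E. assert (H : forall n, qprod q (RtoC (q ^ n)) = 0%C).
  { intros n. assert (H := qprod_qpoch q n Hq). rewrite E in H.
    assert (N := qpoch_q_neq_0 q n Hq).
    replace (qprod q (RtoC (q ^ n))) with (/ qpoch (RtoC q) q n * (qpoch (RtoC q) q n * qprod q (RtoC (q ^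
      n))))%C by (field; exact N).
    rewrite <- H. ring. }
  assert (K := Clim_unique _ _ _ (Clim_qprod q Hq) (Clim_ext _ _ _ (fun n => eq_sym (H n)) (Clim_const
    0%C))).
  now apply C1_nz in K.
Qed.

(** This is [1 / (q; q)_n = (q ^ (n + 1); q)_inf / (q; q)_inf]. *)
Lemma inv_qpoch (q : R) (n : nat) : 0 < q < 1 ->
  (/ qpoch (RtoC q) q n = qprod q (RtoC (q ^ n)) / qprod q 1)%C.
Proof.
  intros Hq. assert (N := qpoch_q_neq_0 q n Hq). assert (N1 := qprod_1_neq_0 q Hq).
  assert (H := qprod_qpoch q n Hq).
  assert (N2 : qprod q (RtoC (q ^ n)) <> 0%C).
  { intros E. rewrite E in H. apply N1. rewrite H. ring. }
  rewrite H. field. auto.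
Qed.

Lemma inv_qpoch_bounded (q : R) : 0 < q < 1 -> exists M, forall n, Cmod (/ qpoch (RtoC q) q n)%C <= M.
Proof.
  intros Hq. exists (Series (fun n => Cmod (qcoef q n) * 1 ^ n) / Cmod (qprod q 1)).
  assert (N1 := qprod_1_neq_0 q Hq).
  intros n. rewrite inv_qpoch, Cmod_div by auto. unfold Rdiv. apply Rmult_le_compat_r.
  - left. apply Rinv_0_lt_compat. now apply Cmod_gt_0.
  - apply CSeries_bound; [|apply entire_qcoef; auto; lra].
    intros k. rewrite Cmod_mult, Cmod_pow, Cmod_opp, Cmod_R. apply Rmult_le_compat_l; [apply Cmod_ge_0|].
    apply pow_incr. split; [apply Rabs_pos|]. rewrite Rabs_pos_eq by (apply pow_le; lra).
    rewrite <- (pow1 n). apply pow_incr. lra.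
Qed.

(** This is [1 / (z; q)_inf] for [|z| < 1], by Euler. *)
Definition qprod_inv (q : R) (z : C) : C := PS (fun n => / qpoch (RtoC q) q n)%C z.

Lemma qprod_inv_correct (q : R) (z : C) : 0 < q < 1 -> Cmod z < 1 ->
  Cis_series (fun n => / qpoch (RtoC q) q n * z ^ n)%C (qprod_inv q z).
Proof.
  intros Hq Hz. destruct (inv_qpoch_bounded q Hq) as [M HM]. apply CSeries_correct.
  apply Cabs_conv_le with (fun n => M * Cmod z ^ n).
  - intros n. rewrite Cmod_mult, Cmod_pow. apply Rmult_le_compat_r; auto. apply pow_le, Cmod_ge_0.
  - apply ex_series_geo. split; [apply Cmod_ge_0|exact Hz].
Qed.

Lemma qprod_inv_functional (q : R) (z : C) : 0 < q < 1 -> Cmod z < 1 ->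
  qprod_inv q (z * RtoC q)%C = ((1 - z) * qprod_inv q z)%C.
Proof.
  intros Hq Hz.
  assert (Hqz : Cmod (z * RtoC q)%C < 1).
  { rewrite Cmod_mult, Cmod_R, Rabs_pos_eq by lra. generalize (Cmod_ge_0 z). nra. }
  assert (H1 := qprod_inv_correct q z Hq Hz). assert (H2 := qprod_inv_correct q _ Hq Hqz).
  apply Cis_series_incr_1 in H2.
  assert (E : (qprod_inv q (z * RtoC q) - / qpoch (RtoC q) q 0 * (z * RtoC q) ^ 0 =
    (qprod_inv q z - / qpoch (RtoC q) q 0 * z ^ 0) - z * qprod_inv q z)%C).
  { apply Cis_series_unique with (1 := H2).
    eapply Cis_series_ext; [|apply (Cis_series_minus _ _ _ _ (Cis_series_incr_1 _ _ H1) (Cis_series_scal _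
      _ z H1))].
    intros n. cbv beta.
    rewrite qpoch_q_S, Cpow_mult_l, <- RtoC_pow, (Cpow_S z), RtoC_minus.
    assert (N1 := qpoch_q_neq_0 q n Hq).
    assert (N2 : (1 - RtoC (q ^ S n))%C <> 0%C).
    { rewrite <- RtoC_minus. apply RtoC_neq_0; generalize (pow_lt_1 q n Hq); lra. }
    field. auto. }
  simpl in E. replace (qprod_inv q (z * RtoC q)) with
    (qprod_inv q (z * RtoC q) - / qpoch (RtoC q) q 0 * 1 + / qpoch (RtoC q) q 0)%C by ring.
  rewrite E. ring.
Qed.

Lemma qprod_inv_lim (q : R) (z : C) : 0 < q < 1 -> Cmod z < 1 ->
  Clim (fun n => qprod_inv q (z * RtoC (q ^ n))%C) 1%C.
Proof.
  intros Hq Hz. destruct (inv_qpoch_bounded q Hq) as [M HM].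
  set (v := Series (fun n => M * Cmod z ^ n)).
  assert (Hz0 := Cmod_ge_0 z).
  assert (Hex : ex_series (fun n => M * Cmod z ^ n)).
  { now apply ex_series_geo. }
  assert (G : is_lim_seq (fun n => q ^ n) 0) by (apply is_lim_seq_geom; rewrite Rabs_pos_eq; lra).
  apply Clim_le with (2 := is_lim_seq_scal0 _ v G).
  intros n. assert (Hn : 0 < q ^ n) by (apply pow_lt; lra).
  assert (Hn1 : q ^ n <= 1) by (rewrite <- (pow1 n); apply pow_incr; lra).
  assert (Hc : Cmod (z * RtoC (q ^ n))%C = q ^ n * Cmod z).
  { rewrite Cmod_mult, Cmod_R, Rabs_pos_eq; lra. }
  assert (H := qprod_inv_correct q (z * RtoC (q ^ n))%C Hq ltac:(rewrite Hc; nra)).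
  apply Cis_series_incr_1 in H.
  replace (qprod_inv q (z * RtoC (q ^ n)) - 1)%C with
    (qprod_inv q (z * RtoC (q ^ n)) - / qpoch (RtoC q) q 0 * (z * RtoC (q ^ n)) ^ 0)%C
    by (unfold qpoch; simpl; field).
  apply (Cis_series_bound _ _ (fun k => M * Cmod z ^ k * q ^ n) _ H).
  - intros k. rewrite Cmod_mult, Cmod_pow, Hc, Rmult_assoc.
    apply Rmult_le_compat; [apply Cmod_ge_0|apply pow_le; nra|apply HM|].
    rewrite Rpow_mult_distr. simpl pow at 1.
    assert (0 <= (q ^ n) ^ k <= 1).
    { split; [apply pow_le; lra|]. rewrite <- (pow1 k). apply pow_incr. lra. }
    assert (0 <= Cmod z ^ k) by (now apply pow_le).
    simpl (Cmod z ^ S k).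
    apply Rle_trans with (q ^ n * (Cmod z * Cmod z ^ k)).
    + rewrite Rmult_assoc. apply Rmult_le_compat_l; [lra|].
      rewrite <- (Rmult_1_l (Cmod z * Cmod z ^ k)) at 2. apply Rmult_le_compat_r; [nra|lra].
    + rewrite (Rmult_comm (Cmod z ^ k)). apply Rmult_le_compat_l; [lra|].
      nra.
  - apply is_series_scal_r. now apply Series_correct.
Qed.

Lemma qprod_inv_qpoch (q : R) (z : C) (n : nat) : 0 < q < 1 -> Cmod z < 1 ->
  (qpoch z q n * qprod_inv q z = qprod_inv q (z * RtoC (q ^ n)))%C.
Proof.
  intros Hq Hz. induction n as [|n IH].
  - unfold qpoch. simpl. rewrite Cmult_1_r. ring.
  - rewrite qpoch_S. simpl pow. rewrite RtoC_mult.
    replace (z * (RtoC q * RtoC (q ^ n)))%C with (z * RtoC (q ^ n) * RtoC q)%C by ring.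
    rewrite qprod_inv_functional; auto; [rewrite <- IH; ring|].
    rewrite Cmod_mult, Cmod_R.
    assert (Hqn := q_pow_bounds q n Hq).
    rewrite Rabs_pos_eq by lra. generalize (Cmod_ge_0 z). nra.
Qed.

Lemma qprod_inv_neq_0 (q : R) (z : C) : 0 < q < 1 -> Cmod z < 1 -> qprod_inv q z <> 0%C.
Proof.
  intros Hq Hz E.
  assert (H : forall n, qprod_inv q (z * RtoC (q ^ n))%C = 0%C).
  { intros n. rewrite <- qprod_inv_qpoch, E by auto. ring. }
  assert (K := Clim_unique _ _ _ (qprod_inv_lim q z Hq Hz) (Clim_ext _ _ _ (fun n => eq_sym (H n))
    (Clim_const 0%C))).
  now apply C1_nz in K.
Qed.

Lemma qpoch_lim_small (q : R) (z : C) : 0 < q < 1 -> Cmod z < 1 ->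
  Clim (qpoch z q) (/ qprod_inv q z)%C.
Proof.
  intros Hq Hz. assert (N := qprod_inv_neq_0 q z Hq Hz).
  replace (/ qprod_inv q z)%C with (/ qprod_inv q z * 1)%C by ring.
  eapply Clim_ext; [|apply (Clim_scal _ _ (/ qprod_inv q z)%C (qprod_inv_lim q z Hq Hz))].
  intros n. cbv beta. rewrite <- qprod_inv_qpoch by auto. field. exact N.
Qed.

Lemma qpoch_inf_small (q : R) (z : C) : 0 < q < 1 -> Cmod z < 1 ->
  qpoch_inf z q = (/ qprod_inv q z)%C.
Proof. intros Hq Hz. now apply CLim_seq_unique, qpoch_lim_small. Qed.

(** Each factor split off multiplies the argument by [q], so after finitely
    many of them [qpoch_lim_small] applies. *)
Lemma qpoch_converges (q : R) (n : nat) (z : C) : 0 < q < 1 -> Cmod z * q ^ n < 1 ->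
  Clim (qpoch z q) (qpoch_inf z q).
Proof.
  intros Hq. revert z. induction n as [|n IH]; intros z Hz.
  - simpl in Hz. rewrite qpoch_inf_small by (auto; lra). apply qpoch_lim_small; auto; lra.
  - assert (Hz' : Cmod (z * RtoC q)%C * q ^ n < 1).
    { rewrite Cmod_mult, Cmod_R, Rabs_pos_eq by lra. simpl in Hz. lra. }
    assert (H : Clim (qpoch z q) ((1 - z) * qpoch_inf (z * RtoC q) q)%C).
    { apply Clim_incr_1. eapply Clim_ext; [|apply (Clim_scal _ _ (1 - z)%C (IH _ Hz'))].
      intros k. cbv beta. now rewrite qpoch_S_l. }
    unfold qpoch_inf at 1. now rewrite (CLim_seq_unique _ _ H).
Qed.

Lemma qpoch_inf_S (q : R) (z : C) : 0 < q < 1 ->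
  qpoch_inf z q = ((1 - z) * qpoch_inf (z * RtoC q) q)%C.
Proof.
  intros Hq.
  assert (G : is_lim_seq (fun n => Cmod z * q ^ n) 0).
  { apply is_lim_seq_scal0. apply is_lim_seq_geom. rewrite Rabs_pos_eq; lra. }
  apply is_lim_seq_spec in G. destruct (G (mkposreal 1 ltac:(lra))) as [n Hn]. simpl in Hn.
  assert (H1 : Cmod z * q ^ S n < 1).
  { specialize (Hn (S n) ltac:(lia)). rewrite Rminus_0_r in Hn.
    generalize (Rle_abs (Cmod z * q ^ S n)). lra. }
  assert (H2 : Cmod (z * RtoC q)%C * q ^ n < 1).
  { rewrite Cmod_mult, Cmod_R, Rabs_pos_eq by lra. simpl in H1. lra. }
  apply CLim_seq_unique. apply Clim_incr_1.
  eapply Clim_ext; [|apply (Clim_scal _ _ (1 - z)%C (qpoch_converges q n _ Hq H2))].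
  intros k. cbv beta. now rewrite qpoch_S_l.
Qed.

(** * The functional-differential equation *)

Definition fcoef (q : R) (mu : C) (n : nat) : C :=
  (qpoch (qexp q mu) q n / RtoC (INR (fact n)))%C.

Lemma F_PS (q : R) (mu x : C) : F mu q x = PS (fcoef q mu) (- x)%C.
Proof. reflexivity. Qed.

Lemma fcoef_S (q : R) (mu : C) (n : nat) :
  (RtoC (INR (S n)) * fcoef q mu (S n) = fcoef q mu n * (1 - qexp q mu * RtoC (q ^ n)))%C.
Proof.
  unfold fcoef. rewrite qpoch_S, fact_simpl, mult_INR, RtoC_mult.
  assert (N1 : RtoC (INR (S n)) <> 0%C) by (apply RtoC_neq_0; now apply not_0_INR).
  assert (N2 : RtoC (INR (fact n)) <> 0%C) by (apply RtoC_neq_0; apply INR_fact_neq_0).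
  field. auto.
Qed.

Lemma entire_fcoef (q : R) (mu : C) : 0 < q < 1 -> entire (fcoef q mu).
Proof.
  intros Hq. apply entire_ratio with (fun n => (1 + Cmod (qexp q mu)) * / INR (S n)).
  2: { apply is_lim_seq_scal0, is_lim_seq_inv_S. }
  intros n. assert (Hn : 0 < INR (S n)) by (apply lt_0_INR; lia).
  assert (E := f_equal Cmod (fcoef_S q mu n)). rewrite !Cmod_mult, Cmod_R, Rabs_pos_eq in E by lra.
  assert (B : Cmod (1 - qexp q mu * RtoC (q ^ n))%C <= 1 + Cmod (qexp q mu)).
  { unfold Cminus. eapply Rle_trans; [apply Cmod_triangle|]. rewrite Cmod_opp, Cmod_1, Cmod_mult, Cmod_R.
    assert (Hqn := q_pow_bounds q n Hq).
    rewrite Rabs_pos_eq by lra. generalize (Cmod_ge_0 (qexp q mu)). nra. }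
  apply (Rmult_le_reg_l (INR (S n))); auto. rewrite E.
  replace (INR (S n) * ((1 + Cmod (qexp q mu)) * / INR (S n) * Cmod (fcoef q mu n))) with
    (Cmod (fcoef q mu n) * (1 + Cmod (qexp q mu))) by (field; lra).
  apply Rmult_le_compat_l; auto. apply Cmod_ge_0.
Qed.

(** Coefficientwise this is [(a; q)_(n + 1) = (1 - a) (a q; q)_n]; it links
    [mu] to [mu + 1]. *)
Lemma F_shift (q : R) (mu x : C) : 0 < q < 1 ->
  (qexp q mu * F mu q (RtoC q * x) - F mu q x = - ((1 - qexp q mu) * F (mu + 1) q x))%C.
Proof.
  intros Hq. rewrite !F_PS. set (a := qexp q mu).
  assert (H1 := PS_correct _ (- x)%C (entire_fcoef q mu Hq)).
  assert (H2 := PS_correct _ (- (RtoC q * x))%C (entire_fcoef q mu Hq)).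
  assert (H3 := PS_correct _ (- x)%C (entire_fcoef q (mu + 1)%C Hq)).
  apply Cis_series_unique with (1 := Cis_series_minus _ _ _ _ (Cis_series_scal _ _ a H2) H1).
  replace (- ((1 - a) * PS (fcoef q (mu + 1)) (- x)))%C with (- (1 - a) * PS (fcoef q (mu + 1)) (- x))%C
    by ring.
  eapply Cis_series_ext; [|apply (Cis_series_scal _ _ (- (1 - a))%C H3)].
  intros n. cbv beta.
  replace (- (RtoC q * x))%C with (RtoC q * - x)%C by ring. rewrite Cpow_mult_l, <- RtoC_pow.
  assert (E : ((1 - a) * fcoef q (mu + 1) n = (1 - a * RtoC (q ^ n)) * fcoef q mu n)%C).
  { unfold fcoef. rewrite qexp_S by lra. fold a.
    assert (K := qpoch_S_l a q n). rewrite qpoch_S in K.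
    assert (N2 : RtoC (INR (fact n)) <> 0%C) by (apply RtoC_neq_0; apply INR_fact_neq_0).
    replace ((1 - a) * (qpoch (a * RtoC q) q n / RtoC (INR (fact n))))%C with
      (((1 - a) * qpoch (a * RtoC q) q n) / RtoC (INR (fact n)))%C by (field; exact N2).
    rewrite <- K. field. exact N2. }
  replace (- (1 - a) * (fcoef q (mu + 1) n * (- x) ^ n))%C with
    (- ((1 - a) * fcoef q (mu + 1) n) * (- x) ^ n)%C by ring.
  rewrite E. ring.
Qed.

Lemma Cderive_F (q : R) (mu x : C) : 0 < q < 1 ->
  Cderive (F mu q) x (qexp q mu * F mu q (RtoC q * x) - F mu q x)%C.
Proof.
  intros Hq. assert (He := entire_fcoef q mu Hq). set (a := qexp q mu).
  eapply Cderive_eq.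
  - apply (Cderive_comp (PS (fcoef q mu)) (fun x => (- x)%C)).
    + apply Cderive_PS, He.
    + eapply Cderive_ext; [|apply (Cderive_lin (- (1))%C 0%C)]. intros y. simpl. ring.
  - rewrite !F_PS.
    assert (H1 := PS_correct _ (- x)%C He).
    assert (H2 := PS_correct _ (- (RtoC q * x))%C He).
    assert (H3 := PS_correct _ (- x)%C (entire_dcoef _ He)).
    apply Cis_series_unique with (2 := Cis_series_minus _ _ _ _ (Cis_series_scal _ _ a H2) H1).
    eapply Cis_series_ext; [|apply (Cis_series_scal _ _ (- (1))%C H3)].
    intros n. cbv beta. unfold dcoef. rewrite fcoef_S. fold a.
    replace (- (RtoC q * x))%C with (RtoC q * - x)%C by ring. rewrite Cpow_mult_l, <- RtoC_pow. ring.
Qed.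

Definition gcoef (q : R) (a : C) (n : nat) : C := (poch a n * qcoef q n)%C.

Lemma entire_gcoef (q : R) (a : C) : 0 < q < 1 -> entire (gcoef q a).
Proof.
  intros Hq. apply (entire_weighted_qcoef q (poch a) (Cmod a)); auto; [apply Cmod_ge_0|].
  intros n. rewrite poch_S, Cmod_mult, Rmult_comm. apply Rmult_le_compat_r; [apply Cmod_ge_0|].
  eapply Rle_trans; [apply Cmod_triangle|]. rewrite Cmod_R, Rabs_pos_eq; [lra|apply pos_INR].
Qed.

Lemma G_PS (q : R) (a x : C) : G a q x = PS (gcoef q a) (- x)%C.
Proof.
  apply CSeries_ext. intros n. unfold gcoef, qcoef, Cdiv. ring.
Qed.

(** The function [x ^ (- a) G(a; q, 1 / x)] of [w = log x]. *)
Definition Ysol (q : R) (a w : C) : C := (spow w (- a) * G a q (1 / proj w))%C.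

Lemma Ysol_eq (q : R) (a w : C) : Ysol q a w = (Cexp (- a * w) * PS (gcoef q a) (- (1) * Cexp (- (1) *
  w)))%C.
Proof.
  unfold Ysol. rewrite G_PS. unfold spow, proj. f_equal. f_equal.
  replace (- (1) * w)%C with (- w)%C by ring. rewrite Cexp_opp. unfold Cdiv. ring.
Qed.

(** The recursion behind both [Ysol_shift] and [Cderive_Ysol]. *)
Lemma gcoef_S (q : R) (a : C) (n : nat) : 0 < q < 1 ->
  (gcoef q a (S n) * (RtoC (/ q ^ S n) - 1) = a * gcoef q (a + 1) n)%C.
Proof.
  intros Hq. unfold gcoef. rewrite poch_S_l.
  assert (Hn : q ^ S n <> 0) by (apply pow_nonzero; lra).
  assert (E := qcoef_S q n Hq).
  replace (RtoC (/ q ^ S n) - 1)%C with (RtoC (1 - q ^ S n) * RtoC (/ q ^ S n))%C.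
  2: { rewrite <- RtoC_mult, <- RtoC_minus. f_equal. field. exact Hn. }
  replace (a * poch (a + 1) n * qcoef q (S n) * (RtoC (1 - q ^ S n) * RtoC (/ q ^ S n)))%C with
    (a * poch (a + 1) n * (qcoef q (S n) * RtoC (1 - q ^ S n)) * RtoC (/ q ^ S n))%C by ring.
  rewrite E.
  replace (a * poch (a + 1) n * (RtoC (q ^ S n) * qcoef q n) * RtoC (/ q ^ S n))%C with
    (a * poch (a + 1) n * qcoef q n * (RtoC (q ^ S n) * RtoC (/ q ^ S n)))%C by ring.
  rewrite <- RtoC_mult, Rinv_r by exact Hn. ring.
Qed.

Lemma Ysol_shift (q : R) (a w : C) : 0 < q < 1 ->
  (qexp q a * Ysol q a (dilate q w) - Ysol q a w = - (a * Ysol q (a + 1) w))%C.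
Proof.
  intros Hq. rewrite !Ysol_eq. set (z := (- (1) * Cexp (- (1) * w))%C).
  assert (Hz : (- (1) * Cexp (- (1) * dilate q w) = RtoC (/ q) * z)%C).
  { unfold dilate, z, of_pos. change (ln q, 0) with (RtoC (ln q)).
    replace (- (1) * (RtoC (ln q) + w))%C with (- RtoC (ln q) + - (1) * w)%C by ring.
    rewrite Cexp_plus, Cexp_opp, Cexp_RtoC, exp_ln, RtoC_inv by lra. ring. }
  rewrite Hz.
  assert (Hea : (qexp q a * Cexp (- a * dilate q w) = Cexp (- a * w))%C).
  { rewrite qexp_eq, <- Cexp_plus. f_equal. unfold dilate, of_pos. change (ln q, 0) with (RtoC (ln q)).
    ring. }
  assert (He1 : (Cexp (- (a + 1) * w) = - (Cexp (- a * w) * z))%C).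
  { unfold z. replace (- (a + 1) * w)%C with (- a * w + - (1) * w)%C by ring. rewrite Cexp_plus. ring. }
  rewrite He1, Cmult_assoc, Hea.
  assert (He := entire_gcoef q a Hq).
  assert (H1 := PS_correct _ z He). assert (H2 := PS_correct _ (RtoC (/ q) * z)%C He).
  assert (H3 := PS_correct _ z (entire_gcoef q (a + 1)%C Hq)).
  assert (E : (PS (gcoef q a) (RtoC (/ q) * z) - PS (gcoef q a) z = z * (a * PS (gcoef q (a + 1)) z))%C).
  { assert (H := Cis_series_incr_1 _ _ (Cis_series_minus _ _ _ _ H2 H1)). simpl in H.
    replace (PS (gcoef q a) (RtoC (/ q) * z) - PS (gcoef q a) z)%C with
      (PS (gcoef q a) (RtoC (/ q) * z) - PS (gcoef q a) z - (gcoef q a 0 * 1 - gcoef q a 0 * 1))%C by ring.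
    apply Cis_series_unique with (1 := H).
    eapply Cis_series_ext; [|apply (Cis_series_scal _ _ z (Cis_series_scal _ _ a H3))].
    intros n. cbv beta.
    replace (z * (a * (gcoef q (a + 1) n * z ^ n)))%C with (z * (a * gcoef q (a + 1) n) * z ^ n)%C by ring.
    rewrite <- gcoef_S by exact Hq.
    change (RtoC (/ q) * z * (RtoC (/ q) * z) ^ n)%C with ((RtoC (/ q) * z) ^ S n)%C.
    rewrite Cpow_mult_l, <- RtoC_pow, (Cpow_S z). rewrite pow_inv. ring. }
  replace (Cexp (- a * w) * PS (gcoef q a) (RtoC (/ q) * z) - Cexp (- a * w) * PS (gcoef q a) z)%C with
    (Cexp (- a * w) * (PS (gcoef q a) (RtoC (/ q) * z) - PS (gcoef q a) z))%C by ring.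
  rewrite E. ring.
Qed.

Lemma Cderive_Ysol (q : R) (a w : C) : 0 < q < 1 ->
  Cderive (Ysol q a) w (Cexp w * (qexp q a * Ysol q a (dilate q w) - Ysol q a w))%C.
Proof.
  intros Hq. rewrite Ysol_shift by exact Hq.
  assert (He := entire_gcoef q a Hq).
  set (z := fun w => (- (1) * Cexp (- (1) * w))%C).
  eapply Cderive_ext; [intros x; symmetry; apply Ysol_eq|].
  assert (D1 := Cderive_exp_scal (- a)%C w).
  assert (D2 : Cderive z w (- z w)%C).
  { eapply Cderive_eq; [apply Cderive_scal, Cderive_exp_scal|]. unfold z. ring. }
  assert (D3 := Cderive_comp (PS (gcoef q a)) z w _ _ (Cderive_PS _ (z w) He) D2).
  eapply Cderive_eq; [apply (Cderive_mult _ _ _ _ _ D1 D3)|].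
  rewrite Ysol_eq. cbv beta. fold (z w).
  assert (E : (a * PS (gcoef q a) (z w) + z w * PS (dcoef (gcoef q a)) (z w) = a * PS (gcoef q (a + 1)) (z
    w))%C).
  { assert (H1 := PS_correct _ (z w) He). assert (H2 := PS_dcoef_correct _ (z w) He).
    assert (H3 := PS_correct _ (z w) (entire_gcoef q (a + 1)%C Hq)).
    apply Cis_series_unique with (2 := Cis_series_scal _ _ a H3).
    eapply Cis_series_ext; [|apply (Cis_series_plus _ _ _ _ (Cis_series_scal _ _ a H1) (Cis_series_scal _ _
      (z w) H2))].
    intros n. cbv beta.
    assert (Ep : (a * gcoef q (a + 1) n = (a + RtoC (INR n)) * gcoef q a n)%C).
    { unfold gcoef. assert (K := poch_S_l a n). rewrite poch_S in K.
      replace (a * (poch (a + 1) n * qcoef q n))%C with (a * poch (a + 1) n * qcoef q n)%C by ring.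
      rewrite <- K. ring. }
    replace (a * (gcoef q (a + 1) n * z w ^ n))%C with (a * gcoef q (a + 1) n * z w ^ n)%C by ring.
    rewrite Ep. destruct n as [|n]; [simpl INR; ring|]. simpl pred. rewrite (Cpow_S (z w)). ring. }
  assert (Ez : (Cexp w * Cexp (- (a + 1) * w) = Cexp (- a * w))%C).
  { rewrite <- Cexp_plus. f_equal. ring. }
  replace (Cexp w * - (a * (Cexp (- (a + 1) * w) * PS (gcoef q (a + 1)) (z w))))%C with
    (- (Cexp w * Cexp (- (a + 1) * w)) * (a * PS (gcoef q (a + 1)) (z w)))%C by ring.
  rewrite Ez, <- E. ring.
Qed.

(** The derivative with respect to [x = exp w] is the derivative with respect
    to [w] divided by [exp w]. *)
Lemma Cderive_surf (y : C -> C) (w l : C) : Cderive y w (Cexp w * l)%C -> is_derive_surf y w l.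
Proof.
  intros Hy. assert (He := Cderive_Cexp w). assert (N := Cexp_neq_0 w).
  set (e := Cexp w) in *. set (E := Cmod e). assert (HE : 0 < E) by now apply Cmod_gt_0.
  intros P [eps HP].
  set (D := Cmod (e * l)%C). assert (HD : 0 <= D) by apply Cmod_ge_0.
  (* the first bound keeps the denominator away from 0, the second makes the error of the
     quotient smaller than eps *)
  set (t := Rmin (E / 2) (eps * E ^ 2 / (4 * (E + D)))).
  assert (Ht : 0 < t).
  { unfold t. apply Rmin_glb_lt; [lra|]. apply Rdiv_lt_0_compat; [|lra].
    apply Rmult_lt_0_compat; [apply cond_pos|now apply pow_lt]. }
  destruct (proj1 (Cderive_eps _ _ _) Hy t Ht) as [d1 [Hd1 H1]].
  destruct (proj1 (Cderive_eps _ _ _) He t Ht) as [d2 [Hd2 H2]].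
  assert (Hd : 0 < Rmin d1 d2) by now apply Rmin_glb_lt.
  assert (Hl : @locally (AbsRing_UniformSpace C_AbsRing) w (fun v => v <> w ->
    P ((y v - y w) / (proj v - proj w))%C)).
  2: { apply locally_C in Hl. exact Hl. }
  exists (mkposreal _ Hd). intros v Hv Hne. change (Cmod (v - w)%C < Rmin d1 d2) in Hv.
  apply HP. apply C_NormedModule_mixin_compat1.
  change (Cmod ((y v - y w) / (proj v - proj w) - l)%C < eps).
  unfold proj. fold e. set (h := (v - w)%C).
  assert (Hh : 0 < Cmod h).
  { apply Cmod_gt_0. intros E0. apply Hne. apply Ceq_minus. exact E0. }
  specialize (H1 h). specialize (H2 h). fold h in Hv.
  replace (w + h)%C with (v : C) in H1, H2 by (unfold h; symmetry; apply Cplus_minus_r).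
  specialize (H1 (Rlt_le_trans _ _ _ Hv (Rmin_l _ _))). specialize (H2 (Rlt_le_trans _ _ _ Hv (Rmin_r _
    _))).
  fold e in H2.
  set (A := (y v - y w)%C) in *. set (B := (Cexp v - e)%C) in *.
  assert (Ht1 : t <= E / 2) by apply Rmin_l.
  assert (Ht2 : t <= eps * E ^ 2 / (4 * (E + D))) by apply Rmin_r.
  assert (HB : E / 2 * Cmod h <= Cmod B).
  { replace B with (h * e + (B - h * e))%C by ring.
    eapply Rle_trans; [|apply Cmod_ge_minus].
    replace (Cmod (B - h * e)%C) with (Cmod (B - h * e)%C) by reflexivity.
    rewrite Cmod_mult. fold E. nra. }
  assert (HB0 : 0 < Cmod B) by nra.
  assert (NB : B <> 0%C) by now apply Cmod_gt_0.
  replace (A / B - l)%C with (((A - h * (e * l)) * e - e * l * (B - h * e)) / (B * e))%C by (field; auto).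
  assert (NBe : (B * e)%C <> 0%C) by now apply Cmult_neq_0.
  rewrite Cmod_div by exact NBe. rewrite Cmod_mult. fold E.
  assert (Hnum : Cmod ((A - h * (e * l)) * e - e * l * (B - h * e))%C <= t * Cmod h * (E + D)).
  { unfold Cminus at 1. eapply Rle_trans; [apply Cmod_triangle|].
    rewrite Cmod_opp, !(Cmod_mult _ e), (Cmod_mult (e * l)).
    fold E D. nra. }
  apply (Rmult_lt_reg_r (Cmod B * E)); [nra|].
  unfold Rdiv. rewrite Rmult_assoc, Rinv_l, Rmult_1_r by nra.
  eapply Rle_lt_trans; [apply Hnum|].
  assert (Ht3 : t * (E + D) <= eps * E ^ 2 / 4).
  { apply (Rmult_le_compat_r (E + D)) in Ht2; [|lra].
    eapply Rle_trans; [apply Ht2|]. right. field. lra. }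
  apply Rle_lt_trans with (eps * E ^ 2 / 4 * Cmod h).
  - replace (t * Cmod h * (E + D)) with (t * (E + D) * Cmod h) by ring. apply Rmult_le_compat_r; lra.
  - apply Rlt_le_trans with (eps * (E / 2 * Cmod h * E)).
    + assert (0 < eps * (E ^ 2 * Cmod h)).
      { apply Rmult_lt_0_compat; [apply cond_pos|]. apply Rmult_lt_0_compat; auto. now apply pow_lt. }
      nra.
    + apply Rmult_le_compat_l; [left; apply cond_pos|]. apply Rmult_le_compat_r; lra.
Qed.

(** * Uniform bounds for the terms of the connection formula *)

Lemma Cexp_eq_1 (z : C) : Cexp z = 1%C -> exists n : Z, z = (0, 2 * IZR n * PI).
Proof.
  intros H. assert (HR : Re z = 0).
  { apply exp_inv. rewrite <- Cmod_Cexp, H, exp_0. apply Cmod_1. }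
  destruct z as [a b]. simpl in HR. subst a. unfold Cexp in H. simpl in H.
  rewrite exp_0, !Rmult_1_l in H. injection H as Hc Hs.
  assert (H2 : sin (b / 2) = 0).
  { replace b with (2 * (b / 2)) in Hc by field. rewrite cos_2a_sin in Hc. nra. }
  apply sin_eq_0_0 in H2. destruct H2 as [n Hn]. exists n. f_equal. lra.
Qed.

(** All the [mu_k] give the same [alpha], because [i kappa ln q] is a period
    of the exponential. *)
Lemma qexp_shift (q kappa : R) (mu : C) (k : Z) : kappa * ln q = - (2 * PI) ->
  qexp q (shift mu kappa k) = qexp q mu.
Proof.
  intros Hk. rewrite !qexp_eq. unfold shift. rewrite Cmult_plus_distr_r, Cexp_plus.
  change (Cexp (RtoC (IZR k) * RtoC kappa * Ci * RtoC (ln q))) with (character kappa (ln q) k).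
  rewrite character_eq, Hk.
  replace (IZR k * - (2 * PI)) with (0 + 2 * IZR (- k) * PI) by (rewrite opp_IZR; ring).
  rewrite cos_period_Z, cos_0, sin_eq_0_1.
  - change (1, 0) with (RtoC 1). ring.
  - exists (2 * - k)%Z. rewrite mult_IZR. ring.
Qed.

Lemma shift_plus (mu z : C) (kappa : R) (k : Z) : shift (mu + z) kappa k = (shift mu kappa k + z)%C.
Proof. unfold shift. ring. Qed.

(** The condition on [mu] in terms of [alpha]: no [alpha * q ^ i] equals 1.
    Equivalently, no [mu_k + i] vanishes. *)
Definition nonresonant (q : R) (mu : C) : Prop :=
  forall i : nat, qexp q (mu + RtoC (INR i))%C <> 1%C.

Lemma qexp_0 (q : R) : qexp q 0 = 1%C.
Proof. rewrite qexp_eq. replace (0 * RtoC (ln q))%C with (RtoC 0) by ring. apply Cexp_0. Qed.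

Lemma nonresonant_nonpole (q kappa : R) (mu : C) (k : Z) : kappa * ln q = - (2 * PI) ->
  nonresonant q mu -> nonpole (shift mu kappa k).
Proof.
  intros Hk H i E. apply (H i). rewrite <- (qexp_shift q kappa _ k Hk), shift_plus, E. apply qexp_0.
Qed.

Lemma nonresonant_S (q : R) (mu : C) : nonresonant q mu -> nonresonant q (mu + 1)%C.
Proof.
  intros H i. replace (mu + 1 + RtoC (INR i))%C with (mu + RtoC (INR (S i)))%C
    by (rewrite S_INR, RtoC_plus; ring). apply H.
Qed.

(** A small [z = mu_k + i] would make [q ^ z] close to 1, but [q ^ z] is the
    number [alpha * q ^ i], which differs from 1 and does not depend on [k]. *)
Lemma nonresonant_lower_bound (q kappa : R) (mu : C) (i : nat) : kappa * ln q = - (2 * PI) ->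
  nonresonant q mu ->
  exists c, 0 < c /\ forall k, c <= Cmod (shift mu kappa k + RtoC (INR i))%C.
Proof.
  intros Hk H.
  assert (D : Cderive (qexp q) 0%C (RtoC (ln q))).
  { eapply Cderive_eq; [eapply Cderive_ext; [|apply (Cderive_exp_scal (RtoC (ln q)) 0%C)]|].
    - intros x. simpl. rewrite qexp_eq. f_equal. ring.
    - rewrite Cmult_0_r, Cexp_0. ring. }
  destruct (proj1 (Cderive_eps _ _ _) D 1 ltac:(lra)) as [d [Hd0 Hd]].
  set (e := Cmod (qexp q (mu + RtoC (INR i)) - 1)%C).
  assert (He : 0 < e). { apply Cmod_gt_0. intros E. apply (H i). now apply Ceq_minus. }
  set (K := 1 + Rabs (ln q)). assert (HK : 0 < K) by (unfold K; generalize (Rabs_pos (ln q)); lra).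
  exists (Rmin d (e / K)). split; [apply Rmin_glb_lt; auto; now apply Rdiv_lt_0_compat|].
  intros k. set (z := (shift mu kappa k + RtoC (INR i))%C).
  destruct (Rlt_le_dec (Cmod z) d) as [Hz|Hz].
  - eapply Rle_trans; [apply Rmin_r|].
    specialize (Hd z Hz). replace (0 + z)%C with z in Hd by ring. rewrite qexp_0 in Hd.
    assert (E : qexp q z = qexp q (mu + RtoC (INR i))%C).
    { unfold z. rewrite <- shift_plus. now apply qexp_shift. }
    rewrite E in Hd.
    assert (B : e <= K * Cmod z).
    { unfold e. replace (qexp q (mu + RtoC (INR i)) - 1)%C with
        ((qexp q (mu + RtoC (INR i)) - 1 - z * RtoC (ln q)) + z * RtoC (ln q))%C by ring.
      eapply Rle_trans; [apply Cmod_triangle|]. rewrite Cmod_mult, Cmod_R. unfold K. lra. }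
    apply (Rmult_le_reg_l K); auto. eapply Rle_trans; [|apply B]. right. field. lra.
  - eapply Rle_trans; [apply Rmin_l|exact Hz].
Qed.

(** [Gam_bound] on the ray of argument [th2] or [- th2], according to the sign
    of [Im s]; the gap between [th2] and [|th|] is the rate of decay. *)
Lemma Gam_rotated_bound (s : C) (r th th2 : R) (n : nat) : 0 < Re s -> Rabs th < th2 -> th2 < PI / 2 ->
  Re s + 1 <= INR n ->
  Cmod (Gam s * Cexp (- s * logpt r th))%C <=
    exp (- (Re s * r)) * exp (- ((th2 - Rabs th) * Rabs (Im s))) * (/ Re s + INR (fact n) / cos th2 ^ n).
Proof.
  intros Hs Hth Hth2 Hn.
  assert (Hth0 := Rabs_pos th).
  assert (H2 : exists t2, (t2 = th2 \/ t2 = - th2) /\ t2 * Im s = th2 * Rabs (Im s)).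
  { unfold Rabs. destruct (Rcase_abs (Im s)).
    - exists (- th2). split; auto. ring.
    - exists th2. auto. }
  destruct H2 as [t2 [Ht2 E2]].
  assert (Ha : Rabs t2 = th2).
  { destruct Ht2 as [-> | ->]; rewrite ?Rabs_Ropp; apply Rabs_pos_eq; lra. }
  assert (Hc : cos t2 = cos th2) by (destruct Ht2 as [-> | ->]; rewrite ?cos_neg; auto).
  rewrite Cmod_mult.
  assert (E : Cmod (Cexp (- s * logpt r th)%C) = exp (- (Re s * r)) * exp (th * Im s)).
  { rewrite Cmod_Cexp_mult. destruct s as [a b]. simpl. f_equal; f_equal; ring. }
  rewrite E.
  assert (B := Gam_bound s t2 n Hs ltac:(rewrite Ha; lra) Hn). rewrite E2, Hc in B.
  assert (P1 := exp_pos (- (Re s * r))). assert (P2 := exp_pos (th * Im s)).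
  apply (Rmult_le_compat_r (exp (- (Re s * r)) * exp (th * Im s))) in B; [|left;
    now apply Rmult_lt_0_compat].
  eapply Rle_trans; [apply B|].
  set (K := / Re s + INR (fact n) / cos th2 ^ n).
  assert (HK : 0 <= K).
  { unfold K. assert (Hcp : 0 < cos th2) by (rewrite <- Hc; apply cos_pos_abs; lra).
    apply Rplus_le_le_0_compat; [left; now apply Rinv_0_lt_compat|].
    left. apply Rdiv_lt_0_compat; [apply INR_fact_lt_0|now apply pow_lt]. }
  replace (exp (- (th2 * Rabs (Im s))) * K * (exp (- (Re s * r)) * exp (th * Im s))) with
    (exp (- (Re s * r)) * (exp (- (th2 * Rabs (Im s))) * exp (th * Im s)) * K) by ring.
  rewrite <- exp_plus. apply Rmult_le_compat_r; auto. apply Rmult_le_compat_l; [lra|].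
  apply exp_le. assert (th * Im s <= Rabs th * Rabs (Im s)) by (rewrite <- Rabs_mult; apply Rle_abs). lra.
Qed.

(** Growth in [j] of [Gamma (mu_k + j) x ^ (- mu_k - j)] for [|x| >= 1 / rho]:
    factorial times geometric, which [qcoef] still makes summable. *)
Definition weight (N0 : nat) (c rho : R) (j : nat) : R :=
  (1 + INR (fact (N0 + j)) / c ^ (N0 + j)) * rho ^ j.

Lemma weight_pos (N0 : nat) (c rho : R) (j : nat) : 0 < c -> 0 < rho -> 0 < weight N0 c rho j.
Proof.
  intros Hc Hr. unfold weight. apply Rmult_lt_0_compat; [|now apply pow_lt].
  assert (0 < INR (fact (N0 + j)) / c ^ (N0 + j)); [|lra].
  apply Rdiv_lt_0_compat; [apply INR_fact_lt_0|now apply pow_lt].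
Qed.

Lemma qcoef_weight_summable (q c rho : R) (N0 : nat) : 0 < q < 1 -> 0 < c <= 1 -> 1 <= rho ->
  ex_series (fun j => Cmod (qcoef q j) * weight N0 c rho j).
Proof.
  intros Hq Hc Hrho.
  assert (H1 := entire_qcoef q Hq rho Hrho).
  assert (H2 : ex_series (fun j => Cmod (RtoC (INR (fact (N0 + j))) * qcoef q j)%C * (rho / c) ^ j)).
  { apply (entire_weighted_qcoef q (fun j => RtoC (INR (fact (N0 + j)))) (INR N0 + 1) Hq).
    - generalize (pos_INR N0). lra.
    - intros n. rewrite !Cmod_R, !Rabs_pos_eq by apply pos_INR.
      replace (N0 + S n)%nat with (S (N0 + n)) by lia. rewrite fact_simpl, mult_INR, S_INR, plus_INR.
      right. ring.
    - apply (Rmult_le_reg_r c); [lra|]. unfold Rdiv. rewrite Rmult_assoc, Rinv_l by lra. lra. }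
  apply (ex_series_scal (V := RN) (/ c ^ N0)) in H2.
  apply (ex_series_ext (V := RN)) with (2 := ex_series_plus (V := RN) _ _ H1 H2).
  intros j. change (Cmod (qcoef q j) * rho ^ j + / c ^ N0 * (Cmod (RtoC (INR (fact (N0 + j))) * qcoef q
    j)%C * (rho / c) ^ j)
     = Cmod (qcoef q j) * weight N0 c rho j).
  rewrite Cmod_mult, Cmod_R, Rabs_pos_eq by apply pos_INR. unfold weight, Rdiv.
  rewrite pow_add, Rpow_mult_distr, pow_inv, Rinv_mult. ring.
Qed.

Definition gamma_term (mu : C) (kappa : R) (w : C) (k : Z) (j : nat) : C :=
  (Gamma (shift mu kappa k + RtoC (INR j)) * Cexp (- (shift mu kappa k + RtoC (INR j)) * w))%C.

(** For [j] so large that [mu_k + j] has real part at least 1 this is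
    [Gam_rotated_bound]. The finitely many smaller [j] follow downwards from
    [Gamma (s) = Gamma (s + 1) / s], where [s] stays away from 0 uniformly in
    [k]. The bound is uniform for [|ln |x|| <= Rm], as required for varying [x]
    on a ray. *)
Lemma gamma_term_bound (q kappa : R) (mu : C) (th Rm : R) :
  0 < q < 1 -> 0 < kappa -> kappa * ln q = - (2 * PI) -> nonresonant q mu -> Rabs th < PI / 2 -> 0 <= Rm ->
  exists (g M : R) (B : nat -> R), 0 < g < 1 /\ 0 <= M /\ (forall j, 0 < B j) /\
    ex_series (fun j => Cmod (qcoef q j) * B j) /\
    forall r k j, Rabs r <= Rm -> Cmod (gamma_term mu kappa (logpt r th) k j) <= M * B j * g ^ Z.abs_nat k.
Proof.
  intros Hq Hk Hkq Hnr Hth HRm.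
  assert (Hth0 := Rabs_pos th).
  set (th2 := (Rabs th + PI / 2) / 2).
  assert (Hth2 : Rabs th < th2) by (unfold th2; lra). assert (Hth2' : th2 < PI / 2) by (unfold th2; lra).
  set (c := cos th2).
  assert (Hc : 0 < c <= 1).
  { split; [apply cos_pos_abs; rewrite Rabs_pos_eq; lra|apply COS_bound]. }
  set (d := th2 - Rabs th). assert (Hd : 0 < d) by (unfold d; lra).
  set (g := exp (- (d * kappa))). assert (Hg : 0 < g < 1) by (apply exp_neg_lt_1; nra).
  destruct (nat_above (Rabs (Re mu) + 1)) as [N0 HN0].
  set (rho := exp Rm). assert (Hrho : 1 <= rho) by (unfold rho; rewrite <- exp_0; now apply exp_le).
  set (B := weight N0 c rho).
  assert (HB : forall j, 0 < B j) by (intros j; apply weight_pos; lra).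
  assert (HR1 := Rle_abs (Re mu)). assert (HR2 := Rle_abs (- Re mu)). rewrite Rabs_Ropp in HR2.
  assert (Hgk : forall k, 0 < g ^ Z.abs_nat k) by (intros; now apply pow_lt).
  assert (K : forall n, exists M, 0 <= M /\ forall r k j, (N0 - n <= j)%nat -> Rabs r <= Rm ->
     Cmod (gamma_term mu kappa (logpt r th) k j) <= M * B j * g ^ Z.abs_nat k).
  { induction n as [|n IH].
    - exists (exp (Rabs (Re mu) * Rm) * exp (d * Rabs (Im mu))).
      split; [left; apply Rmult_lt_0_compat; apply exp_pos|].
      intros r k j Hj Hr. assert (Hj' : INR N0 <= INR j) by (apply le_INR; lia).
      set (s := (shift mu kappa k + RtoC (INR j))%C).
      assert (Hs : Re s = Re mu + INR j) by (unfold s; now rewrite Re_plus_INR, Re_shift).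
      assert (Hs1 : 1 <= Re s) by lra.
      unfold gamma_term. fold s. rewrite Gamma_pos by lra.
      eapply Rle_trans; [apply (Gam_rotated_bound s r th th2 (N0 + j)); auto; [lra|rewrite plus_INR; lra]|].
      fold d c.
      assert (E1 : exp (- (Re s * r)) <= exp (Rabs (Re mu) * Rm) * rho ^ j).
      { unfold rho. rewrite <- exp_mult_INR, <- exp_plus. apply exp_le. rewrite Hs.
        assert (- (Re mu * r) <= Rabs (Re mu) * Rm).
        { eapply Rle_trans; [apply Rle_abs|]. rewrite Rabs_Ropp, Rabs_mult. apply Rmult_le_compat_l; auto.
          apply Rabs_pos. }
        assert (- r <= Rm) by (apply Rabs_le_between in Hr; lra).
        assert (HI := pos_INR j). nra. }
      assert (E2 : exp (- (d * Rabs (Im s))) <= exp (d * Rabs (Im mu)) * g ^ Z.abs_nat k).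
      { unfold g. rewrite <- exp_mult_INR, <- exp_plus. apply exp_le.
        rewrite INR_IZR_INZ, Zabs2Nat.id_abs, abs_IZR.
        assert (Hi : Im s = Im mu + IZR k * kappa).
        { unfold s. rewrite im_plus, im_RtoC, Im_shift. ring. }
        assert (Rabs (IZR k) * kappa <= Rabs (Im s) + Rabs (Im mu)).
        { rewrite <- (Rabs_pos_eq kappa) at 1 by lra. rewrite <- Rabs_mult.
          replace (IZR k * kappa) with (Im s + - Im mu) by (rewrite Hi; ring).
          eapply Rle_trans; [apply Rabs_triang|]. rewrite Rabs_Ropp. lra. }
        nra. }
      assert (E3 : / Re s + INR (fact (N0 + j)) / c ^ (N0 + j) <= 1 + INR (fact (N0 + j)) / c ^ (N0 + j)).
      { apply Rplus_le_compat_r. rewrite <- Rinv_1. apply Rinv_le_contravar; lra. }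
      replace (exp (Rabs (Re mu) * Rm) * exp (d * Rabs (Im mu)) * B j * g ^ Z.abs_nat k) with
        ((exp (Rabs (Re mu) * Rm) * rho ^ j) * (exp (d * Rabs (Im mu)) * g ^ Z.abs_nat k) *
          (1 + INR (fact (N0 + j)) / c ^ (N0 + j))) by (unfold B, weight; ring).
      apply Rmult_le_compat; auto.
      + left. apply Rmult_lt_0_compat; apply exp_pos.
      + apply Rplus_le_le_0_compat; [left; apply Rinv_0_lt_compat; lra|].
        left. apply Rdiv_lt_0_compat; [apply INR_fact_lt_0|apply pow_lt; lra].
      + apply Rmult_le_compat; auto; left; apply exp_pos.
    - destruct IH as [M [HM HI]].
      destruct (nonresonant_lower_bound q kappa mu (N0 - S n) Hkq Hnr) as [c1 [Hc1 Hlow]].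
      set (i := (N0 - S n)%nat) in *.
      set (M2 := M * B (S i) * rho / (c1 * B i)).
      assert (HM2 : 0 <= M2).
      { unfold M2. apply Rdiv_le_0_compat; [|apply Rmult_lt_0_compat; auto].
        apply Rmult_le_pos; [|lra]. apply Rmult_le_pos; auto. left; auto. }
      exists (M + M2). split; [lra|]. intros r k j Hj Hr.
      assert (Hpos : 0 < B j * g ^ Z.abs_nat k) by now apply Rmult_lt_0_compat.
      destruct (le_lt_dec (N0 - n) j) as [Hle|Hlt].
      + specialize (HI r k j Hle Hr). nra.
      + assert (j = i) by lia. subst j.
        specialize (HI r k (S i) ltac:(lia) Hr).
        assert (Hnp := nonresonant_nonpole q kappa mu k Hkq Hnr).
        set (s := (shift mu kappa k + RtoC (INR i))%C).
        assert (Ns : s <> 0%C) by apply Hnp.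
        assert (Es : gamma_term mu kappa (logpt r th) k i = (gamma_term mu kappa (logpt r th) k (S i) *
          Cexp (logpt r th) / s)%C).
        { unfold gamma_term. rewrite <- !Gamma_poch by exact Hnp. rewrite poch_S. fold s.
          rewrite S_INR, RtoC_plus.
          replace (- (shift mu kappa k + (RtoC (INR i) + 1)) * logpt r th)%C with
            (- s * logpt r th + - logpt r th)%C by (unfold s; ring).
          rewrite Cexp_plus, Cexp_opp. assert (Ne := Cexp_neq_0 (logpt r th)). field. auto. }
        rewrite Es, Cmod_div, Cmod_mult, Cmod_Cexp by exact Ns.
        assert (Er : exp (Re (logpt r th)) <= rho).
        { apply exp_le. simpl. apply Rabs_le_between in Hr. lra. }
        assert (Hs := Hlow k). fold s in Hs.
        assert (Hs0 : 0 < Cmod s) by lra.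
        assert (T : Cmod (gamma_term mu kappa (logpt r th) k (S i)) * exp (Re (logpt r th)) / Cmod s <=
          M * B (S i) * g ^ Z.abs_nat k * rho / c1).
        { unfold Rdiv. apply Rmult_le_compat.
          - apply Rmult_le_pos; [apply Cmod_ge_0|left; apply exp_pos].
          - left. now apply Rinv_0_lt_compat.
          - apply Rmult_le_compat; auto; [apply Cmod_ge_0|left; apply exp_pos].
          - now apply Rinv_le_contravar. }
        eapply Rle_trans; [apply T|].
        replace (M * B (S i) * g ^ Z.abs_nat k * rho / c1) with (M2 * B i * g ^ Z.abs_nat k).
        * nra.
        * unfold M2. assert (HBi := HB i). field. lra. }
  destruct (K N0) as [M [HM HI]].
  exists g, M, B. repeat split; auto; try lra.
  - apply qcoef_weight_summable; auto.
  - intros r k j Hr. apply HI; auto. lia.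
Qed.

(** The [k]-th term [Gamma (mu_k) x ^ (- mu_k) G(mu_k; q, 1 / x)]. *)
Definition solution_term (q kappa : R) (mu w : C) (k : Z) : C :=
  (Gamma (shift mu kappa k) * Ysol q (shift mu kappa k) w)%C.

Definition alt_sign (j : nat) : C := ((- (1)) ^ j)%C.

Lemma Cmod_alt_sign j : Cmod (alt_sign j) = 1.
Proof. unfold alt_sign. now rewrite Cmod_pow, Cmod_opp, Cmod_1, pow1. Qed.

(** The factor [Gamma (mu_k)] turns each Pochhammer symbol of [G] into
    [Gamma (mu_k + j)]. *)
Lemma solution_term_series (q kappa : R) (mu w : C) (k : Z) : 0 < q < 1 ->
  kappa * ln q = - (2 * PI) -> nonresonant q mu ->
  Cis_series (fun j => alt_sign j * qcoef q j * gamma_term mu kappa w k j)%C (solution_term q kappa mu w k).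
Proof.
  intros Hq Hkq Hnr. assert (Hnp := nonresonant_nonpole q kappa mu k Hkq Hnr).
  unfold solution_term. rewrite Ysol_eq. set (a := shift mu kappa k) in *.
  rewrite Cmult_assoc.
  eapply Cis_series_ext; [|apply Cis_series_scal, PS_correct, entire_gcoef, Hq].
  intros j. cbv beta. unfold gamma_term, gcoef. fold a. rewrite <- Gamma_poch by exact Hnp.
  rewrite Cpow_mult_l. fold (alt_sign j). rewrite <- Cexp_INR.
  replace (- (a + RtoC (INR j)) * w)%C with (- a * w + RtoC (INR j) * (- (1) * w))%C by ring.
  rewrite Cexp_plus. ring.
Qed.

Lemma solution_term_bound (q kappa : R) (mu : C) (th Rm : R) :
  0 < q < 1 -> 0 < kappa -> kappa * ln q = - (2 * PI) -> nonresonant q mu -> Rabs th < PI / 2 -> 0 <= Rm ->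
  exists g A, 0 < g < 1 /\ 0 <= A /\ forall r k, Rabs r <= Rm ->
    Cmod (solution_term q kappa mu (logpt r th) k) <= A * g ^ Z.abs_nat k.
Proof.
  intros Hq Hk Hkq Hnr Hth HRm.
  destruct (gamma_term_bound q kappa mu th Rm Hq Hk Hkq Hnr Hth HRm) as [g [M [B [Hg [HM [HB [Hex H]]]]]]].
  exists g, (Series (fun j => Cmod (qcoef q j) * B j) * M). split; auto.
  assert (HS : 0 <= Series (fun j => Cmod (qcoef q j) * B j)).
  { apply Rle_trans with (Series (fun j => 0 * (Cmod (qcoef q j) * B j))).
    - rewrite Series_scal_l. lra.
    - apply Series_le; auto. intros n. specialize (HB n). assert (Hc := Cmod_ge_0 (qcoef q n)).
      assert (0 <= Cmod (qcoef q n) * B n) by (apply Rmult_le_pos; lra). lra. }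
  split; [now apply Rmult_le_pos|].
  intros r k Hr.
  apply (Cis_series_bound _ _ (fun j => Cmod (qcoef q j) * B j * (M * g ^ Z.abs_nat k)) _
    (solution_term_series q kappa mu (logpt r th) k Hq Hkq Hnr)).
  - intros j. rewrite !Cmod_mult, Cmod_alt_sign, Rmult_1_l. specialize (H r k j Hr).
    rewrite Rmult_assoc. apply Rmult_le_compat_l; [apply Cmod_ge_0|]. lra.
  - rewrite Rmult_assoc. apply is_series_scal_r. now apply Series_correct.
Qed.

Lemma CSeries_foldZ (a : Z -> nat -> C) (s : Z -> C) (n : nat) :
  (forall k, Cis_series (a k) (s k)) ->
  CSeries (fun j => foldZ (fun k => a k j) n) = foldZ s n.
Proof.
  intros H. apply CSeries_unique. destruct n as [|n]; simpl; auto. apply Cis_series_plus; auto.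
Qed.

Lemma foldZ_convergent (a : Z -> C) (A g : R) : 0 <= A -> 0 < g < 1 ->
  (forall k, Cmod (a k) <= A * g ^ Z.abs_nat k) -> Cis_series (foldZ a) (CSeries (foldZ a)).
Proof. intros HA Hg H. apply CSeries_correct. now apply foldZ_abs_conv with A g. Qed.

(** * The connection formula for positive real part *)

Lemma Cmod_profile (s : C) (r th u : R) :
  Cmod (profile s (logpt r th) u) = exp (Re s * u) * exp (- (exp u * (exp r * cos th))).
Proof.
  rewrite profile_eq, Cmod_mult, !Cmod_Cexp. f_equal.
  - f_equal. destruct s as [a b]. simpl. ring.
  - f_equal. rewrite Cexp_RtoC. unfold Cexp, logpt. simpl. ring.
Qed.

(** The same splitting as in [gamma_term_bound]: a product bound in [j] and [m]
    which stays summable against [qcoef]. *)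
Lemma profile_family_bound (mu : C) (L r th : R) : 0 < Re mu -> 0 < L -> Rabs th < PI / 2 ->
  exists (g c : R) (N0 : nat), 0 < g < 1 /\ 0 < c <= 1 /\ forall j m,
    Cmod (profile (mu + RtoC (INR j)) (logpt r th) (IZR m * L)) <= weight N0 c 1 j * g ^ Z.abs_nat m.
Proof.
  intros Hmu HL Hth.
  set (a := Rmin (Re mu) 1).
  assert (Ha1 : 0 < a <= 1) by (unfold a; split; [apply Rmin_glb_lt; lra|apply Rmin_r]).
  assert (Ha2 : a <= Re mu) by (unfold a; apply Rmin_l).
  set (xi := exp r * cos th).
  assert (Hxi : 0 < xi) by (apply Rmult_lt_0_compat; [apply exp_pos|now apply cos_pos_abs]).
  set (c := Rmin xi 1).
  assert (Hc : 0 < c <= 1) by (unfold c; split; [apply Rmin_glb_lt; lra|apply Rmin_r]).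
  assert (Hcx : c <= xi) by apply Rmin_l.
  destruct (nat_above (Re mu + 1)) as [N0 HN0].
  exists (exp (- (a * L))), c, N0. split; [apply exp_neg_lt_1; nra|]. split; auto.
  intros j m. rewrite Cmod_profile. fold xi. rewrite Re_plus_INR.
  assert (HI := pos_INR j).
  rewrite <- exp_mult_INR, (INR_IZR_INZ (Z.abs_nat m)), Zabs2Nat.id_abs, abs_IZR.
  set (u := IZR m * L). assert (Hu : Rabs u = Rabs (IZR m) * L)
    by (unfold u; rewrite Rabs_mult, (Rabs_pos_eq L); lra).
  replace (Rabs (IZR m) * - (a * L)) with (- (a * Rabs u)) by (rewrite Hu; ring).
  unfold weight. rewrite pow1, Rmult_1_r.
  assert (Hw : 0 < INR (fact (N0 + j)) / c ^ (N0 + j)) by (apply Rdiv_lt_0_compat;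
    [apply INR_fact_lt_0|apply pow_lt; lra]).
  assert (Q := exp_pos (- (a * Rabs u))).
  assert (E1 : exp (- (exp u * xi)) <= exp (- (exp u * c))) by (apply exp_le; generalize (exp_pos u); nra).
  assert (P := exp_pos ((Re mu + INR j) * u)).
  apply Rle_trans with (exp ((Re mu + INR j) * u) * exp (- (exp u * c))); [apply Rmult_le_compat_l; lra|].
  destruct (Rle_dec 0 u) as [Hu0|Hu0].
  - eapply Rle_trans; [apply (exp_decay_bound (Re mu + INR j) u c (N0 + j)); auto; [lra|rewrite plus_INR;
    lra]|].
    assert (H := exp_decay_abs a 1 u ltac:(lra) Hu0). rewrite Rmult_1_l in H.
    apply Rle_trans with (INR (fact (N0 + j)) / c ^ (N0 + j) * exp (- (a * Rabs u)));
      [apply Rmult_le_compat_l; lra|nra].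
  - assert (H1 : exp (- (exp u * c)) <= 1) by (rewrite <- exp_0; apply exp_le; generalize (exp_pos u); nra).
    assert (H2 : exp ((Re mu + INR j) * u) <= exp (- (a * Rabs u))).
    { rewrite Rabs_left by lra. apply exp_le. nra. }
    assert (H3 := exp_pos (- (exp u * c))). nra.
Qed.

Lemma profile_sum_over_j (q : R) (mu w : C) (u : R) : 0 < q < 1 ->
  Cis_series (fun j => alt_sign j * qcoef q j * profile (mu + RtoC (INR j)) w u)%C
    (profile mu w u * qprod q (Cexp (RtoC u)))%C.
Proof.
  intros Hq.
  eapply Cis_series_ext; [|apply Cis_series_scal, (PS_correct (qcoef q) (- Cexp (RtoC u))%C), entire_qcoef,
    Hq].
  intros j. cbv beta. rewrite !profile_eq.
  replace ((mu + RtoC (INR j)) * RtoC u)%C with (mu * RtoC u + RtoC (INR j) * RtoC u)%C by ring.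
  rewrite Cexp_plus, Cexp_INR.
  replace (- Cexp (RtoC u))%C with (- (1) * Cexp (RtoC u))%C by ring. rewrite Cpow_mult_l.
    fold (alt_sign j). ring.
Qed.

Lemma Cmod_qexp_lt_1 (q : R) (mu : C) : 0 < q < 1 -> 0 < Re mu -> Cmod (qexp q mu) < 1.
Proof.
  intros Hq Hmu. rewrite qexp_eq, Cmod_Cexp, re_scal_r, <- exp_0. apply exp_increasing.
  generalize (ln_lt_0 q Hq). nra.
Qed.

(** Replace [(alpha; q)_n] by the Euler series of
    [1 / (alpha q ^ n; q)_inf], exchange the sums and recognise exponentials. *)
Lemma F_times_qprod_inv (q : R) (mu x : C) : 0 < q < 1 -> 0 < Re mu ->
  Cis_series (fun m => / qpoch (RtoC q) q m * qexp q mu ^ m * Cexp (- (RtoC (q ^ m) * x)))%C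
    (qprod_inv q (qexp q mu) * F mu q x)%C.
Proof.
  intros Hq Hmu. set (a := qexp q mu).
  assert (Ha : Cmod a < 1) by now apply Cmod_qexp_lt_1.
  assert (Ha0 := Cmod_ge_0 a).
  destruct (inv_qpoch_bounded q Hq) as [M HM].
  assert (HM0 : 0 <= M) by (eapply Rle_trans; [apply Cmod_ge_0|apply (HM 0%nat)]).
  set (t := fun (n m : nat) => (expcoef n * (- x) ^ n * (/ qpoch (RtoC q) q m * (a * RtoC (q ^ n)) ^ m))%C).
  destruct (Cseries_swap t (fun n => Cmod (expcoef n) * (1 + Cmod x) ^ n) (fun m => M * Cmod a ^ m)) as [s
    [S1 S2]].
  - intros n m. unfold t. rewrite !Cmod_mult, !Cmod_pow, Cmod_opp.
    apply Rmult_le_compat.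
    + apply Rmult_le_pos; [apply Cmod_ge_0|apply pow_le, Cmod_ge_0].
    + apply Rmult_le_pos; [apply Cmod_ge_0|apply pow_le, Cmod_ge_0].
    + apply Rmult_le_compat_l; [apply Cmod_ge_0|]. apply pow_incr. generalize (Cmod_ge_0 x). lra.
    + apply Rmult_le_compat; [apply Cmod_ge_0|apply pow_le, Cmod_ge_0|apply HM|].
      apply pow_incr. split; [apply Cmod_ge_0|]. rewrite Cmod_mult, Cmod_R.
      assert (Hqn := q_pow_bounds q n Hq).
      rewrite Rabs_pos_eq by lra. nra.
  - intros n. apply Rmult_le_pos; [apply Cmod_ge_0|]. apply pow_le. generalize (Cmod_ge_0 x). lra.
  - intros m. apply Rmult_le_pos; auto. now apply pow_le.
  - apply entire_expcoef. generalize (Cmod_ge_0 x). lra.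
  - now apply ex_series_geo.
  - assert (E1 : s = (qprod_inv q a * F mu q x)%C).
    { apply Cis_series_unique with (1 := S1). rewrite F_PS.
      eapply Cis_series_ext; [|apply Cis_series_scal, (PS_correct _ (- x)%C (entire_fcoef q mu Hq))].
      intros n. cbv beta. symmetry. apply CSeries_unique.
      replace (qprod_inv q a * (fcoef q mu n * (- x) ^ n))%C with
        (expcoef n * (- x) ^ n * qprod_inv q (a * RtoC (q ^ n)))%C.
      - apply Cis_series_scal. apply qprod_inv_correct; auto.
        rewrite Cmod_mult, Cmod_R.
        assert (Hqn := q_pow_bounds q n Hq).
        rewrite Rabs_pos_eq by lra. nra.
      - rewrite <- qprod_inv_qpoch by auto. unfold fcoef, expcoef. fold a.
        rewrite RtoC_inv by apply INR_fact_neq_0. unfold Cdiv. ring. }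
    rewrite <- E1. eapply Cis_series_ext; [|apply S2].
    intros m. apply CSeries_unique.
    replace (/ qpoch (RtoC q) q m * a ^ m * Cexp (- (RtoC (q ^ m) * x)))%C with
      (/ qpoch (RtoC q) q m * a ^ m * PS expcoef (- (RtoC (q ^ m) * x)))%C by now rewrite PS_exp.
    eapply Cis_series_ext; [|apply Cis_series_scal, PS_correct, entire_expcoef].
    intros n. cbv beta. unfold t.
    replace (- (RtoC (q ^ m) * x))%C with (RtoC (q ^ m) * - x)%C by ring.
    rewrite !Cpow_mult_l, <- !RtoC_pow. rewrite <- !pow_mult, (Nat.mul_comm n m). ring.
Qed.

Definition connection_const (q : R) (mu : C) : C :=
  (qpoch_inf (qexp q mu) q / (RtoC (- ln q) * qpoch_inf (RtoC q) q))%C.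

(** A double series over [j] and an integer [m] or [k] is exchanged on either
    side of [poisson]. Terms with lattice index [m > 0] correspond to
    [t = q ^ (- m)], where [qprod] vanishes. *)
Lemma connection_base (q kappa : R) (mu : C) (r th : R) :
  0 < q < 1 -> 0 < kappa -> kappa * ln q = - (2 * PI) -> 0 < Re mu -> Rabs th < PI / 2 ->
    nonresonant q mu ->
  F mu q (Cexp (logpt r th)) = (connection_const q mu * CSeries (foldZ (solution_term q kappa mu (logpt r
    th))))%C.
Proof.
  intros Hq Hk Hkq Hmu Hth Hnr.
  set (L := - ln q). assert (HL : 0 < L) by (unfold L; generalize (ln_lt_0 q Hq); lra).
  assert (HkL : kappa * L = 2 * PI) by (unfold L; lra).
  set (w := logpt r th). set (x := Cexp w). set (a := qexp q mu).
  assert (Ha : Cmod a < 1) by now apply Cmod_qexp_lt_1.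
  set (Sa := fun j => CSeries (foldZ (fun k => gamma_term mu kappa w k j))).
  set (Sf := fun j => CSeries (foldZ (fun m => profile (mu + RtoC (INR j)) w (IZR m * L)))).
  destruct (gamma_term_bound q kappa mu th (Rabs r) Hq Hk Hkq Hnr Hth (Rabs_pos r)) as [g [M [B [Hg [HM [HB
    [Hex HgB]]]]]]].
  destruct (profile_family_bound mu L r th Hmu HL Hth) as [g2 [c [N0 [Hg2 [Hc Hprof]]]]].
  assert (Hw0 : forall j, 0 < weight N0 c 1 j) by (intros; apply weight_pos; lra).
  assert (HP : forall j, Sa j = (RtoC L * Sf j)%C).
  { intros j. apply (poisson kappa L r th (mu + RtoC (INR j))%C); auto.
    - rewrite Re_plus_INR. generalize (pos_INR j). lra.
    - apply Cis_series_ext with (foldZ (fun k => gamma_term mu kappa w k j)).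
      + intros n. apply foldZ_ext. intros k. unfold gamma_term. rewrite shift_plus, Gamma_pos.
        * apply Cmult_comm.
        * rewrite Re_plus_INR, Re_shift. generalize (pos_INR j). lra.
      + apply foldZ_convergent with (M * B j) g; auto.
        * specialize (HB j). nra.
        * intros k. apply HgB. lra.
    - apply foldZ_convergent with (weight N0 c 1 j) g2; auto.
      specialize (Hw0 j). lra. }
  assert (HA : Cis_series (fun j => alt_sign j * qcoef q j * Sa j)%C (CSeries (foldZ (solution_term q kappa
    mu w)))).
  { destruct (Cseries_swap (fun j n => alt_sign j * qcoef q j * foldZ (fun k => gamma_term mu kappa w k j)
    n)%C
      (fun j => Cmod (qcoef q j) * B j) (fun n => 2 * M * g ^ n)) as [s [S1 S2]].
    - intros j n. rewrite !Cmod_mult, Cmod_alt_sign, Rmult_1_l, Rmult_assoc.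
      apply Rmult_le_compat_l; [apply Cmod_ge_0|].
      replace (B j * (2 * M * g ^ n)) with (2 * (M * B j) * g ^ n) by ring.
      apply foldZ_bound; [specialize (HB j); nra|lra|]. intros k. apply HgB. lra.
    - intros j. apply Rmult_le_pos; [apply Cmod_ge_0|left; auto].
    - intros n. apply Rmult_le_pos; [lra|apply pow_le; lra].
    - exact Hex.
    - apply ex_series_geo. lra.
    - assert (E : CSeries (foldZ (solution_term q kappa mu w)) = s).
      { apply CSeries_unique. eapply Cis_series_ext; [|apply S2]. intros n.
        rewrite <- (CSeries_foldZ (fun k j => alt_sign j * qcoef q j * gamma_term mu kappa w k j)%C
          (solution_term q kappa mu w)).
        - apply CSeries_ext. intros j. now rewrite foldZ_scal.
        - intros k. now apply solution_term_series. }
      rewrite E. eapply Cis_series_ext; [|apply S1]. intros j. apply CSeries_unique.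
      apply Cis_series_scal. apply foldZ_convergent with (M * B j) g; auto; [specialize (HB j); nra|].
      intros k. apply HgB. lra. }
  assert (HF : Cis_series (fun j => alt_sign j * qcoef q j * Sf j)%C (qprod q 1 * (qprod_inv q a * F mu q
    x))%C).
  { destruct (Cseries_swap (fun j n => alt_sign j * qcoef q j * foldZ (fun m => profile (mu + RtoC (INR j))
    w (IZR m * L)) n)%C
      (fun j => Cmod (qcoef q j) * weight N0 c 1 j) (fun n => 2 * g2 ^ n)) as [s [S1 S2]].
    - intros j n. rewrite !Cmod_mult, Cmod_alt_sign, Rmult_1_l, Rmult_assoc.
      apply Rmult_le_compat_l; [apply Cmod_ge_0|].
      replace (weight N0 c 1 j * (2 * g2 ^ n)) with (2 * (weight N0 c 1 j) * g2 ^ n) by ring.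
      apply foldZ_bound; [left; auto|lra|]. intros m. apply Hprof.
    - intros j. apply Rmult_le_pos; [apply Cmod_ge_0|left; auto].
    - intros n. apply Rmult_le_pos; [lra|apply pow_le; lra].
    - apply qcoef_weight_summable; auto; lra.
    - apply ex_series_geo. lra.
    - assert (E : (qprod q 1 * (qprod_inv q a * F mu q x))%C = s).
      { apply Cis_series_unique with (2 := S2).
        eapply Cis_series_ext; [|apply Cis_series_scal, F_times_qprod_inv; auto].
        intros n. cbv beta. fold a. rewrite inv_qpoch by exact Hq. symmetry.
        transitivity (CSeries (fun j => foldZ (fun m => alt_sign j * qcoef q j * profile (mu + RtoC (INR
          j)) w (IZR m * L))%C n)).
        { apply CSeries_ext. intros j. now rewrite foldZ_scal. }
        rewrite (CSeries_foldZ (fun m j => alt_sign j * qcoef q j * profile (mu + RtoC (INR j)) w (IZR m *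
          L))%C
          (fun m => profile mu w (IZR m * L)%R * qprod q (Cexp (RtoC (IZR m * L))))%C).
        2: { intros m. now apply profile_sum_over_j. }
        assert (Hneg : forall n, (profile mu w (IZR (- Z.of_nat n) * L)%R * qprod q (Cexp (RtoC (IZR (-
          Z.of_nat n) * L))) =
           a ^ n * qprod q (RtoC (q ^ n)) * Cexp (- (RtoC (q ^ n) * x)))%C).
        { clear n. intros n. rewrite profile_eq.
          assert (Eq : exp (IZR (- Z.of_nat n) * L) = q ^ n).
          { rewrite opp_IZR, <- INR_IZR_INZ. unfold L. replace (- INR n * - ln q) with (INR n * ln q)
            by ring.
            rewrite exp_mult_INR, exp_ln; lra. }
          rewrite Cexp_RtoC, Eq.
          assert (Em : Cexp (mu * RtoC (IZR (- Z.of_nat n) * L)) = (a ^ n)%C).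
          { unfold a. rewrite qexp_eq, <- Cexp_INR. f_equal.
            rewrite opp_IZR, <- INR_IZR_INZ. unfold L. replace (- INR n * - ln q) with (INR n * ln q)
              by ring.
            rewrite RtoC_mult. ring. }
          rewrite Em. fold x. ring. }
        assert (NE := qprod_1_neq_0 q Hq).
        destruct n as [|n].
        - unfold foldZ. rewrite (Hneg 0%nat : profile mu w (IZR 0 * L)%R * qprod q (Cexp (RtoC (IZR 0 *
          L))) = _)%C.
          field. exact NE.
        - unfold foldZ. rewrite Hneg.
          assert (Ep : exp (IZR (Z.of_nat (S n)) * L) = / q ^ S n).
          { rewrite <- INR_IZR_INZ. unfold L. replace (INR (S n) * - ln q) with (- (INR (S n) * ln q))
            by ring.
            rewrite exp_Ropp, exp_mult_INR, exp_ln; lra. }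
          rewrite (Cexp_RtoC (IZR (Z.of_nat (S n)) * L)), Ep, qprod_neg_pow by exact Hq. field. exact NE. }
      rewrite E. eapply Cis_series_ext; [|apply S1]. intros j. apply CSeries_unique.
      apply Cis_series_scal. apply foldZ_convergent with (weight N0 c 1 j) g2; auto. left; auto. }
  assert (EQ : CSeries (foldZ (solution_term q kappa mu w)) = (RtoC L * (qprod q 1 * (qprod_inv q a * F mu
    q x)))%C).
  { apply Cis_series_unique with (1 := HA).
    eapply Cis_series_ext; [|apply (Cis_series_scal _ _ (RtoC L) HF)]. intros j. cbv beta. rewrite HP.
      ring. }
  rewrite EQ. unfold connection_const. fold a L. rewrite qpoch_inf_q, qpoch_inf_small by auto.
  assert (N1 := qprod_1_neq_0 q Hq). assert (N2 := qprod_inv_neq_0 q a Hq Ha).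
  assert (N3 : RtoC L <> 0%C) by (apply RtoC_neq_0; lra). field. auto.
Qed.

(** * From mu + 1 to mu *)

(** The analogue of [F_shift] for the terms of the right-hand side. *)
Lemma solution_term_shift (q kappa : R) (mu w : C) (k : Z) : 0 < q < 1 -> kappa * ln q = - (2 * PI) ->
  nonresonant q mu ->
  (qexp q mu * solution_term q kappa mu (dilate q w) k - solution_term q kappa mu w k =
   - solution_term q kappa (mu + 1) w k)%C.
Proof.
  intros Hq Hkq Hnr. unfold solution_term. rewrite shift_plus.
  assert (Hnp := nonresonant_nonpole q kappa mu k Hkq Hnr).
  assert (E := Ysol_shift q (shift mu kappa k) w Hq). rewrite qexp_shift in E by exact Hkq.
  assert (EG := Gamma_poch (shift mu kappa k) 1 Hnp). rewrite poch_S in EG. simpl INR in EG.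
  unfold poch in EG. simpl Cprod in EG. rewrite <- EG.
  transitivity (Gamma (shift mu kappa k) * (qexp q mu * Ysol q (shift mu kappa k) (dilate q w) - Ysol q
    (shift mu kappa k) w))%C; [ring|].
  rewrite E. ring.
Qed.

Lemma Cderive_solution_term (q kappa : R) (mu w : C) (k : Z) : 0 < q < 1 -> kappa * ln q = - (2 * PI) ->
  Cderive (fun v => solution_term q kappa mu v k) w
    (Cexp w * (qexp q mu * solution_term q kappa mu (dilate q w) k - solution_term q kappa mu w k))%C.
Proof.
  intros Hq Hkq. unfold solution_term.
  eapply Cderive_eq; [apply Cderive_scal, Cderive_Ysol, Hq|]. rewrite qexp_shift by exact Hkq. ring.
Qed.

Lemma Csum_foldZ_linear (f h : Z -> C) (c : C) (n : nat) :
  Csum (foldZ (fun k => c * f k - h k)%C) n = (c * Csum (foldZ f) n - Csum (foldZ h) n)%C.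
Proof.
  induction n as [|n IH]; rewrite ?Csum_O, ?Csum_S, ?IH; simpl; ring.
Qed.

Lemma connection_const_S (q : R) (mu : C) : 0 < q < 1 ->
  connection_const q mu = ((1 - qexp q mu) * connection_const q (mu + 1))%C.
Proof.
  intros Hq. unfold connection_const. rewrite (qpoch_inf_S q (qexp q mu) Hq), <- qexp_S by lra.
  unfold Cdiv. ring.
Qed.

Lemma dilate_logpt (q r th : R) : dilate q (logpt r th) = logpt (r + ln q) th.
Proof. unfold dilate, of_pos, logpt, Cplus. simpl. f_equal; ring. Qed.

Lemma Cexp_dilate (q : R) (w : C) : 0 < q -> Cexp (dilate q w) = (RtoC q * Cexp w)%C.
Proof.
  intros Hq. unfold dilate, of_pos. change (ln q, 0) with (RtoC (ln q)).
  now rewrite Cexp_plus, Cexp_RtoC, exp_ln.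
Qed.

(** [D n] is the difference of the two sides with the series truncated.
    Its q-difference, and therefore its derivative, is a multiple of the
    truncation error of the formula for [mu + 1], which is uniformly small on
    the segment from [q x] to [x]. In the limit the difference [d] satisfies
    both [alpha d(q x) = d(x)] and [d(q x) = d(x)]. *)
Lemma connection_step (q kappa : R) (mu : C) (th : R) :
  0 < q < 1 -> 0 < kappa -> kappa * ln q = - (2 * PI) -> nonresonant q mu -> Rabs th < PI / 2 ->
  (forall r, F (mu + 1) q (Cexp (logpt r th)) =
     (connection_const q (mu + 1) * CSeries (foldZ (solution_term q kappa (mu + 1) (logpt r th))))%C) ->
  forall r, F mu q (Cexp (logpt r th)) =
     (connection_const q mu * CSeries (foldZ (solution_term q kappa mu (logpt r th))))%C.
Proof.
  intros Hq Hk Hkq Hnr Hth IH r.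
  assert (Hlq := ln_lt_0 q Hq).
  set (a := qexp q mu). set (c := connection_const q mu). set (c1 := connection_const q (mu + 1)) in *.
  assert (Ha : a <> 1%C).
  { unfold a. replace mu with (mu + RtoC (INR 0))%C at 1 by (simpl; ring). apply Hnr. }
  assert (Hc : c = ((1 - a) * c1)%C) by now apply connection_const_S.
  set (Rm := Rabs r - ln q).
  assert (HRm : 0 <= Rm) by (unfold Rm; generalize (Rabs_pos r); lra).
  destruct (solution_term_bound q kappa mu th Rm Hq Hk Hkq Hnr Hth HRm) as [g0 [A0 [Hg0 [HA0 H0]]]].
  destruct (solution_term_bound q kappa (mu + 1) th Rm Hq Hk Hkq (nonresonant_S _ _ Hnr) Hth HRm) as [g [A
    [Hg [HA H1]]]].
  set (T := fun w => CSeries (foldZ (solution_term q kappa mu w))).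
  assert (HT : forall r, Rabs r <= Rm -> Cis_series (foldZ (solution_term q kappa mu (logpt r th))) (T
    (logpt r th))).
  { intros r' Hr'. apply foldZ_convergent with A0 g0; auto. }
  set (D := fun n w => (F mu q (Cexp w) - c * Csum (foldZ (solution_term q kappa mu w)) n)%C).
  assert (Hlim : forall r, Rabs r <= Rm -> Clim (fun n => D n (logpt r th)) (F mu q (Cexp (logpt r th)) - c
    * T (logpt r th))%C).
  { intros r' Hr'. apply Clim_minus; [apply Clim_const|]. apply Clim_scal. apply is_series_Clim.
    now apply HT. }
  (* the q-difference of D is the error term of the relation already known for mu + 1 *)
  assert (Hshift : forall n w, (a * D n (dilate q w) - D n w =
     - ((1 - a) * (F (mu + 1) q (Cexp w) - c1 * Csum (foldZ (solution_term q kappa (mu + 1) w)) n)))%C).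
  { intros n w. unfold D.
    assert (E1 := F_shift q mu (Cexp w) Hq). fold a in E1. rewrite <- Cexp_dilate in E1 by lra.
    assert (E2 : (a * Csum (foldZ (solution_term q kappa mu (dilate q w))) n - Csum (foldZ (solution_term q
      kappa mu w)) n =
       - Csum (foldZ (solution_term q kappa (mu + 1) w)) n)%C).
    { rewrite <- Csum_foldZ_linear.
      transitivity (Csum (foldZ (fun k => 0 * 0 - solution_term q kappa (mu + 1) w k)%C) n).
      - apply Csum_ext. intros i. apply foldZ_ext. intros k.
        unfold a. rewrite solution_term_shift by auto. ring.
      - rewrite (Csum_foldZ_linear (fun _ => 0%C)). ring. }
    transitivity ((a * F mu q (Cexp (dilate q w)) - F mu q (Cexp w)) -
      c * (a * Csum (foldZ (solution_term q kappa mu (dilate q w))) n - Csum (foldZ (solution_term q kappa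
        mu w)) n))%C; [ring|].
    rewrite E1, E2, Hc. ring. }
  set (tail := fun n => Series (fun i => 2 * A * g ^ i) - sum_n (fun i => 2 * A * g ^ i) n).
  assert (Hexg : ex_series (fun i => 2 * A * g ^ i)) by (apply ex_series_geo; lra).
  assert (Htail : is_lim_seq tail 0) by now apply series_tail.
  assert (Herr : forall n r, Rabs r <= Rm ->
     Cmod (a * D n (dilate q (logpt r th)) - D n (logpt r th))%C <= Cmod (1 - a)%C * (Cmod c1 * tail n)).
  { intros n r' Hr'. rewrite Hshift, Cmod_opp, Cmod_mult, IH.
    apply Rmult_le_compat_l; [apply Cmod_ge_0|].
    set (S1 := CSeries _).
    replace (c1 * S1 - c1 * Csum (foldZ (solution_term q kappa (mu + 1) (logpt r' th))) n)%C with
      (c1 * (S1 - Csum (foldZ (solution_term q kappa (mu + 1) (logpt r' th))) n))%C by ring.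
    rewrite Cmod_mult. apply Rmult_le_compat_l; [apply Cmod_ge_0|].
    apply Cis_series_tail; auto.
    - apply foldZ_convergent with A g; auto.
    - intros i. apply foldZ_bound; auto; lra. }
  set (d := fun r => (F mu q (Cexp (logpt r th)) - c * T (logpt r th))%C).
  assert (Rr : Rabs r <= Rm) by (unfold Rm; lra).
  assert (Rr2 : Rabs (r + ln q) <= Rm).
  { unfold Rm. eapply Rle_trans; [apply Rabs_triang|]. rewrite (Rabs_left (ln q)); lra. }
  assert (Q1 : (a * d (r + ln q)%R - d r = 0)%C).
  { apply (Clim_unique (fun n => a * D n (logpt (r + ln q) th) - D n (logpt r th))%C).
    - apply Clim_minus; [apply Clim_scal|]; now apply Hlim.
    - apply Clim_le with (fun n => Cmod (1 - a)%C * (Cmod c1 * tail n)).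
      + intros n. rewrite <- dilate_logpt.
        replace (a * D n (dilate q (logpt r th)) - D n (logpt r th) - 0)%C with
          (a * D n (dilate q (logpt r th)) - D n (logpt r th))%C by ring. now apply Herr.
      + now do 2 apply is_lim_seq_scal0. }
  (* the derivative of D n on the segment is exp times the q-difference bounded by Herr *)
  assert (Q2 : (d r - d (r + ln q)%R = 0)%C).
  { apply (Clim_unique (fun n => D n (logpt r th) - D n (logpt (r + ln q) th))%C).
    - apply Clim_minus; now apply Hlim.
    - set (K := exp (Rabs r)).
      apply Clim_le with (fun n => (K * (- ln q)) * (Cmod (1 - a)%C * (Cmod c1 * tail n))).
      2: { now do 3 apply is_lim_seq_scal0. }
      intros n. set (e := Cmod (1 - a)%C * (Cmod c1 * tail n)).
      replace (D n (logpt r th) - D n (logpt (r + ln q) th) - 0)%C with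
        (D n (logpt r th) - D n (logpt (r + ln q) th))%C by ring.
      replace (K * - ln q * e) with (K * e * r - K * e * (r + ln q)) by ring.
      assert (Ept : forall u, logpt u th = ((0, th) + RtoC u * 1)%C).
      { intros u. unfold logpt, RtoC, Cplus, Cmult. simpl. f_equal; ring. }
      apply (mean_value_inequality (fun u => D n (logpt u th))
        (fun u => (Cexp (logpt u th) * (a * D n (dilate q (logpt u th)) - D n (logpt u th)))%C)
        (fun u => K * e * u) (fun _ => K * e)); [lra| | |].
      + intros t Ht.
        assert (HF : Rderive (fun u => F mu q (Cexp (logpt u th))) t
          (Cexp (logpt t th) * (a * F mu q (Cexp (dilate q (logpt t th))) - F mu q (Cexp (logpt t th))))%C).
        { apply Rderive_ext with (fun u => F mu q (Cexp ((0, th) + RtoC u * 1)%C)).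
          { intros u. now rewrite (Ept u). }
          eapply Rderive_eq.
          - apply (Rderive_line (fun z => F mu q (Cexp z))).
            apply (Cderive_comp (F mu q) Cexp); [apply Cderive_F, Hq|apply Cderive_Cexp].
          - rewrite <- Ept. fold a. rewrite Cexp_dilate by lra. ring. }
        assert (HS : forall k, Rderive (fun u => solution_term q kappa mu (logpt u th) k) t
           (Cexp (logpt t th) * (a * solution_term q kappa mu (dilate q (logpt t th)) k - solution_term q
             kappa mu (logpt t th) k))%C).
        { intros k. apply Rderive_ext with (fun u => solution_term q kappa mu ((0, th) + RtoC u * 1)%C k).
          { intros u. now rewrite (Ept u). }
          eapply Rderive_eq.
          - apply (Rderive_line (fun z => solution_term q kappa mu z k)), Cderive_solution_term; auto.
          - rewrite <- Ept. fold a. ring. }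
        assert (HSum := Rderive_Csum (fun i u => foldZ (fun k => solution_term q kappa mu (logpt u th) k)
          i) _ t n
          (fun i => Rderive_foldZ (fun k u => solution_term q kappa mu (logpt u th) k) _ t i HS)).
        assert (HD := Rderive_plus _ _ _ _ _ HF (Rderive_scal _ (- c)%C _ _ HSum)).
        eapply Rderive_ext; [|apply (Rderive_eq _ _ _ _ HD)].
        * intros u. cbv beta. unfold D.
          change (Csum (fun i : nat => foldZ (fun k : Z => solution_term q kappa mu (logpt u th) k) i) n)
            with
            (Csum (foldZ (solution_term q kappa mu (logpt u th))) n). ring.
        * cbv beta. unfold D.
          rewrite (Csum_ext _ (fun i => Cexp (logpt t th) * foldZ (fun k => a * solution_term q kappa mu
            (dilate q (logpt t th)) k - solution_term q kappa mu (logpt t th) k) i)%C).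
          -- rewrite Csum_scal. rewrite Csum_foldZ_linear.
             change (Csum (foldZ (fun k => solution_term q kappa mu (dilate q (logpt t th)) k)) n) with
                (Csum (foldZ (solution_term q kappa mu (dilate q (logpt t th)))) n).
             change (Csum (foldZ (fun k => solution_term q kappa mu (logpt t th) k)) n) with
                (Csum (foldZ (solution_term q kappa mu (logpt t th))) n). ring.
          -- intros i. now rewrite foldZ_scal.
      + intros t Ht. auto_derive; auto. ring.
      + intros t Ht. rewrite Cmod_mult, Cmod_Cexp.
        assert (Hr := Rle_abs r). assert (Hr2 := Rle_abs (- r)). rewrite Rabs_Ropp in Hr2.
        apply Rmult_le_compat; [left; apply exp_pos|apply Cmod_ge_0| |].
        * apply exp_le. simpl. lra.
        * apply Herr. unfold Rm. apply Rabs_le. lra. }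
  assert (Z : d r = 0%C).
  { assert (E1 : d (r + ln q)%R = d r).
    { symmetry. now apply Ceq_minus. }
    rewrite E1 in Q1.
    assert (Na : (a - 1)%C <> 0%C) by (intros E0; apply Ha; now apply Ceq_minus).
    replace (d r) with (/ (a - 1) * (a * d r - d r))%C by (field; exact Na).
    rewrite Q1. ring. }
  apply Ceq_minus. exact Z.
Qed.

Lemma connection_formula (q kappa : R) (th : R) (n : nat) :
  0 < q < 1 -> 0 < kappa -> kappa * ln q = - (2 * PI) -> Rabs th < PI / 2 ->
  forall mu, nonresonant q mu -> 0 < Re mu + INR n -> forall r,
  F mu q (Cexp (logpt r th)) = (connection_const q mu * CSeries (foldZ (solution_term q kappa mu (logpt r
    th))))%C.
Proof.
  intros Hq Hk Hkq Hth. induction n as [|n IH]; intros mu Hnr Hn r.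
  - simpl in Hn. apply connection_base; auto. lra.
  - apply connection_step; auto. intros r'. apply IH.
    + now apply nonresonant_S.
    + rewrite re_plus. rewrite S_INR in Hn. simpl. lra.
Qed.

(** * Proof of the theorem *)

Lemma is_Zseries_foldZ (a : Z -> C) (A g : R) : 0 <= A -> 0 < g < 1 ->
  (forall k, Cmod (a k) <= A * g ^ Z.abs_nat k) -> is_Zseries a (CSeries (foldZ a)).
Proof.
  intros HA Hg H.
  assert (H1 : Cis_series (fun n => a (Z.of_nat n)) (CSeries (fun n => a (Z.of_nat n)))).
  { apply CSeries_correct. apply Cabs_conv_le with (fun n => A * g ^ n); [|apply ex_series_geo; lra].
    intros n. specialize (H (Z.of_nat n)). now rewrite Zabs2Nat.id in H. }
  assert (H2 : Cis_series (fun n => a (- Z.of_nat (S n))%Z) (CSeries (fun n => a (- Z.of_nat (S n))%Z))).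
  { apply CSeries_correct. apply Cabs_conv_le with (fun n => A * g * g ^ n); [|apply ex_series_geo; lra].
    intros n. specialize (H (- Z.of_nat (S n))%Z).
    replace (Z.abs_nat (- Z.of_nat (S n))) with (S n) in H by lia. simpl in H. simpl. lra. }
  exists (CSeries (fun n => a (Z.of_nat n))), (CSeries (fun n => a (- Z.of_nat (S n))%Z)).
  split; [exact H1|]. split; [exact H2|].
  apply CSeries_unique. apply Cis_series_ext with
    (fun n => a (Z.of_nat n) + match n with O => 0 | S m => a (- Z.of_nat (S m))%Z end)%C.
  - intros [|n]; [simpl; ring|reflexivity].
  - apply Cis_series_plus; auto.
    assert (H3 := Cis_series_decr_1 (fun n => match n with O => RtoC 0 | S m => a (- Z.of_nat (S m))%Z end)
      _ H2).
    cbv beta iota in H3. rewrite Cplus_0_l in H3. exact H3.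
Qed.

Lemma of_rhp_proj (x : C) : 0 < Re x -> Cexp (of_rhp x) = x.
Proof.
  intros Hx. unfold of_rhp, Cexp. destruct x as [a b]. simpl in *.
  assert (Hm : 0 < Cmod (a, b)).
  { apply Cmod_gt_0. intros E. injection E. intros _ Ea. lra. }
  rewrite exp_ln by exact Hm. rewrite cos_atan, sin_atan.
  assert (E : Cmod (a, b) = a * sqrt (1 + (b / a) ^ 2)).
  { unfold Cmod. cbn [fst snd]. replace (a ^ 2 + b ^ 2) with (a ^ 2 * (1 + (b / a) ^ 2)) by (field; lra).
    rewrite sqrt_mult_alt by apply pow2_ge_0. rewrite sqrt_pow2 by lra. reflexivity. }
  assert (Hs : 0 < sqrt (1 + (b / a) ^ 2)).
  { apply sqrt_lt_R0. generalize (pow2_ge_0 (b / a)). lra. }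
  replace (1 + (b / a)²) with (1 + (b / a) ^ 2) by (unfold Rsqr; ring).
  rewrite E. f_equal; field; lra.
Qed.

Theorem theorem1p1
  (q : R) (mu alpha : C) (kappa : R) (mu_ : Z -> C)
  (hq : 0 < q < 1)
  (halpha : alpha = spow (of_pos q) mu)
  (hkappa : kappa = - (2 * PI / ln q))
  (hmu : forall k : Z, mu_ k = (mu + RtoC (IZR k) * RtoC kappa * Ci)%C) :
  ((forall x : C,
      @is_derive C_AbsRing C_NormedModule (F mu q) x
        (alpha * F mu q (RtoC q * x) - F mu q x)%C)
   /\
   (forall k : Z,
      let y := fun w : logsurf =>
        (spow w (- mu_ k) * G (mu_ k) q (1 / proj w))%C in
      forall w : logsurf,
        is_derive_surf y w (alpha * y (dilate q w) - y w)%C))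
  /\
  ((~ exists m k : Z,
        (m <= 0)%Z /\ mu = (RtoC (IZR m) + RtoC kappa * RtoC (IZR k) * Ci)%C) ->
   forall x : C, 0 < Re x ->
     exists s : C,
       is_Zseries (fun k : Z =>
         (Gamma (mu_ k) * spow (of_rhp x) (- mu_ k) * G (mu_ k) q (1 / x))%C) s
       /\
       F mu q x =
         (RtoC kappa * qpoch_inf (spow (of_pos q) mu) q
            / (RtoC (2 * PI) * qpoch_inf (RtoC q) q) * s)%C).
Proof.
  assert (Hlq := ln_lt_0 q hq). assert (HP := PI_RGT_0).
  assert (Hkq : kappa * ln q = - (2 * PI)) by (rewrite hkappa; field; lra).
  assert (Hk : 0 < kappa).
  { rewrite hkappa. replace (- (2 * PI / ln q)) with (2 * PI / - ln q) by (field; lra).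
    apply Rdiv_lt_0_compat; lra. }
  assert (Hmuk : forall k, mu_ k = shift mu kappa k) by exact hmu.
  assert (Ha : alpha = qexp q mu) by exact halpha.
  split; [split|].
  - intros x. apply Cderive_is_derive. rewrite Ha. now apply Cderive_F.
  - intros k y w. apply Cderive_surf. rewrite Ha.
    replace (qexp q mu) with (qexp q (mu_ k)) by (rewrite Hmuk; now apply qexp_shift).
    exact (Cderive_Ysol q (mu_ k) w hq).
  - intros Hmu x Hx.
    assert (Hnr : nonresonant q mu).
    { intros i E. rewrite qexp_eq in E. destruct (Cexp_eq_1 _ E) as [n Hn].
      apply Hmu. exists (- Z.of_nat i)%Z, (- n)%Z. split; [lia|].
      assert (Hz : (mu + RtoC (INR i))%C = (RtoC kappa * RtoC (IZR (- n)) * Ci)%C).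
      { assert (N : RtoC (ln q) <> 0%C) by (apply RtoC_neq_0; lra).
        replace (mu + RtoC (INR i))%C with ((mu + RtoC (INR i)) * RtoC (ln q) / RtoC (ln q))%C
          by (field; exact N).
        rewrite Hn.
        replace (0, 2 * IZR n * PI) with (RtoC (2 * IZR n * PI) * Ci)%C
          by (unfold RtoC, Ci, Cmult; simpl; f_equal; ring).
        replace (2 * IZR n * PI) with (kappa * IZR (- n) * ln q).
        - rewrite !RtoC_mult. field. exact N.
        - rewrite opp_IZR. transitivity (- IZR n * (kappa * ln q)); [ring|]. rewrite Hkq. ring. }
      rewrite opp_IZR, <- INR_IZR_INZ, RtoC_opp.
      replace mu with (mu + RtoC (INR i) + - RtoC (INR i))%C at 1 by ring. rewrite Hz. ring. }
    set (r := ln (Cmod x)). set (th := atan (Im x / Re x)).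
    assert (Hth : Rabs th < PI / 2).
    { apply Rabs_def1; generalize (atan_bound (Im x / Re x)); fold th; lra. }
    assert (Hw : of_rhp x = logpt r th) by reflexivity.
    assert (Hx' : Cexp (logpt r th) = x) by (rewrite <- Hw; now apply of_rhp_proj).
    exists (CSeries (foldZ (solution_term q kappa mu (logpt r th)))).
    assert (Hterm : (fun k : Z => (Gamma (mu_ k) * spow (of_rhp x) (- mu_ k) * G (mu_ k) q (1 / x))%C) =
       solution_term q kappa mu (logpt r th)).
    { apply functional_extensionality. intros k.
      unfold solution_term, Ysol. rewrite Hw, Hmuk. unfold proj. rewrite Hx'. ring. }
    rewrite Hterm. split.
    + destruct (solution_term_bound q kappa mu th (Rabs r) hq Hk Hkq Hnr Hth (Rabs_pos r)) as [g [A [Hg [HA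
      H]]]].
      apply is_Zseries_foldZ with A g; auto. intros k. apply H. lra.
    + destruct (nat_above (Rabs (Re mu) + 1)) as [n Hn].
      assert (Hre := Rle_abs (- Re mu)). rewrite Rabs_Ropp in Hre.
      rewrite <- Hx' at 1. rewrite (connection_formula q kappa th n hq Hk Hkq Hth mu Hnr ltac:(lra) r).
      f_equal. unfold connection_const. fold (qexp q mu).
      assert (N1 := qprod_1_neq_0 q hq). rewrite <- qpoch_inf_q in N1 by exact hq.
      assert (N2 : RtoC (- ln q) <> 0%C) by (apply RtoC_neq_0; lra).
      assert (N3 : RtoC (2 * PI) <> 0%C) by (apply RtoC_neq_0; lra).
      replace (2 * PI) with (kappa * - ln q) in N3 |- * by lra. rewrite RtoC_mult in N3 |- *.
      assert (N4 : RtoC kappa <> 0%C) by (apply RtoC_neq_0; lra).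
      field. auto.
Qed.
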